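(* Let $p\in\mathbb{N}$, $T>0$ and $\theta\in[0,1]$. Let $u_0\in\mathbb{H}^{4p+2}(\mathbb{R})$, and moreover $u_0\in\mathbb{H}^{6p+3}(\mathbb{R})$ if $\theta=\frac12$. Let $u$ be the exact solution of $\partial_t u+\partial_x^{2p+1}u=0$ with $u|_{t=0}=u_0$, let $(v_j^n)$ be the solution of the finite difference $\theta$-scheme with space step $\Delta x>0$ and time step $\Delta t>0$ started from the cell averages of $u_0$, and let $e_j^n=\frac{1}{\Delta x}\int_{x_j}^{x_{j+1}}u(t^n,y)\,dy-v_j^n$ be the convergence error. (i) Consider the forward scheme ($D_\bullet^{2p+1}=D_+^{2p+1}$) if $p$ is odd, or the backward scheme ($D_\bullet^{2p+1}=D_-^{2p+1}$) if $p$ is even. Under the CFL condition $\Delta t(1-2\theta)\le \frac{\Delta x^{2p+1}}{2^{2p}}$, $$\|e\|_{\ell^{\infty}(0,N;\ell^2_{\Delta}(\mathbb{Z}))}\lesssim\Delta t\left|\tfrac12-\theta\right|\,\|\partial_x^{4p+2}u_0\|_{\mathbb{L}^2(\mathbb{R})}+\Delta x\,\|\partial_x^{2p+2}u_0\|_{\mathbb{L}^2(\mathbb{R})}+\Delta t^2\,\|\partial_x^{6p+3}u_0\|_{\mathbb{L}^2(\mathbb{R})}.$$ (ii) Consider the central scheme ($D_\bullet^{2p+1}=D_c^{2p+1}$), for any $p\in\mathbb{N}$. Under the CFL condition $\Delta t(1-2\theta)\le 2C_0\frac{\Delta x^{4p+2}}{2^{4p}}$, where $C_0>0$ is a fixed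 constant independent of $\Delta t$ and $\Delta x$, $$\|e\|_{\ell^{\infty}(0,N;\ell^2_{\Delta}(\mathbb{Z}))}\lesssim\Delta t\left|\tfrac12-\theta\right|\,\|\partial_x^{4p+2}u_0\|_{\mathbb{L}^2(\mathbb{R})}+\Delta x^2\,\|\partial_x^{2p+3}u_0\|_{\mathbb{L}^2(\mathbb{R})}+\Delta t^2\,\|\partial_x^{6p+3}u_0\|_{\mathbb{L}^2(\mathbb{R})}.$$
   Context: $\mathbb{N}$ contains $0$. Set $t^n=n\Delta t$ for $n\in\{0,\dots,N\}$ with $N=\lfloor T/\Delta t\rfloor$, and $x_j=j\Delta x$ for $j\in\mathbb{Z}$. The exact solution $u$ is the one given by Fourier transform in $x$: $\widehat{u}(t,\xi)=e^{-t(i\xi)^{2p+1}}\widehat{u_0}(\xi)$. The scheme determines sequences $v^n=(v_j^n)_{j\in\mathbb{Z}}$, square summable in $j$, by $$v_j^{n+1}+\theta\Delta t\,(D_\bullet^{2p+1}v)_j^{n+1}=v_j^n-(1-\theta)\Delta t\,(D_\bullet^{2p+1}v)_j^n,\qquad v_j^0=\frac1{\Delta x}\int_{x_j}^{x_{j+1}}u_0(y)\,dy,$$ where $D_\bullet^{2p+1}$ is one of $$(D_+^{2p+1}v)_j^n=\sum_{k=0}^{2p+1}\frac{\binom{2p+1}{k}(-1)^k}{\Delta x^{2p+1}}v^n_{p-k+j+1}\ \text{(forward)},\qquad (D_-^{2p+1}v)_j^n=\sum_{k=0}^{2p+1}\frac{\binom{2p+1}{k}(-1)^k}{\Delta x^{2p+1}}v^n_{p-k+j}\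 \text{(backward)},$$ $$(D_c^{2p+1}v)_j^n=\tfrac12\left(D_+^{2p+1}v+D_-^{2p+1}v\right)_j^n\ \text{(central)}.$$ $\mathbb{H}^s(\mathbb{R})$ is the Sobolev space with norm $\left(\int_{\mathbb{R}}(1+|\xi|^2)^s|\widehat u(\xi)|^2d\xi\right)^{1/2}$. Also $\|v\|_{\ell^\infty(0,N;\ell^2_\Delta(\mathbb{Z}))}=\sup_{n\in\{0,\dots,N\}}\left(\sum_{j\in\mathbb{Z}}\Delta x|v_j^n|^2\right)^{1/2}$. The notation $A\lesssim B$ means $A\le CB$ with $C$ a constant independent of $\Delta x$ and $\Delta t$. An $\mathbb{L}^2$-norm of a derivative of $u_0$ that is not in $\mathbb{L}^2(\mathbb{R})$ is read as $+\infty$. *)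

(* Defs.v *)
From HB Require Import structures.
From mathcomp Require Import all_boot all_order all_algebra.
From mathcomp Require Import complex.
From mathcomp Require Import all_classical all_reals all_analysis.

Set Implicit Arguments.
Unset Strict Implicit.
Unset Printing Implicit Defensive.

Import Order.TTheory GRing.Theory Num.Theory.
Import numFieldNormedType.Exports.
Import ComplexField.

Local Open Scope classical_set_scope.
Local Open Scope complex_scope.
Local Open Scope ring_scope.

Definition cexp (R : realType) (z : R[i]) : R[i] :=
  (expR (complex.Re z))%:C * (cos (complex.Im z) +i* sin (complex.Im z)).

Definition cintegral (R : realType) (D : set R) (f : R -> R[i]) : R[i] :=
  (\int[@lebesgue_measure R]_(x in D) complex.Re (f x)) +i*
  (\int[@lebesgue_measure R]_(x in D) complex.Im (f x)).

Definition is_L2 (R : realType) (f : R -> R[i]) : Prop :=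
  (fun x => complex.Re (f x)) \in Lfun (@lebesgue_measure R) 2%:E /\
  (fun x => complex.Im (f x)) \in Lfun (@lebesgue_measure R) 2%:E.

Definition L2norm (R : realType) (f : R -> R[i]) : \bar R :=
  Lnorm (@lebesgue_measure R) 2%:E (fun x => (Normc.normc (f x))%:E).

(* The transform of f cut off outside [-A, A]. The normalisation
   \int f(x) e^{-i x xi} dx is the one for which a derivative in x becomes
   multiplication by i xi; no constant is put in front of the integral. *)
Definition fourier_trunc (R : realType) (f : R -> R[i]) (A xi : R) : R[i] :=
  cintegral `[- A, A] (fun x => f x * cexp (- ('i%C * (x * xi)%:C))).

(* Plancherel's transform on L^2(R), as a relation since it is only determined
   up to a null set: the L^2-limit of the transforms of the truncations. *)
Definition is_fourier (R : realType) (f fhat : R -> R[i]) : Prop :=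
  [/\ is_L2 f, is_L2 fhat &
    L2norm (fun xi => fhat xi - fourier_trunc f A xi) @[A --> +oo] --> 0%E].

Definition in_sobolev (R : realType) (s : nat) (f : R -> R[i]) : Prop :=
  exists2 fhat, is_fourier f fhat &
    (\int[@lebesgue_measure R]_xi
       ((1 + xi ^+ 2) ^+ s * Normc.normc (fhat xi) ^+ 2)%:E < +oo)%E.

Definition test_function (R : realType) (phi : R -> R) : Prop :=
  (forall (n : nat) (x : R), derivable (derive1n n phi) x 1) /\
  (exists A : R, forall x : R, A < `|x| -> phi x = 0).

Definition weak_derivative (R : realType) (k : nat) (f g : R -> R[i]) : Prop :=
  forall phi : R -> R, test_function phi ->
    cintegral setT (fun x => f x * (derive1n k phi x)%:C) =
    (-1) ^+ k * cintegral setT (fun x => g x * (phi x)%:C).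

(* The set below has at most one element, and none when the k-th derivative of
   f is not in L^2(R); the infimum is then +oo. *)
Definition L2norm_deriv (R : realType) (k : nat) (f : R -> R[i]) : \bar R :=
  ereal_inf [set L2norm g | g in [set g | is_L2 g /\ weak_derivative k f g]].

Definition exact_solution (R : realType) (p : nat) (T : R) (u0 : R -> R[i])
    (u : R -> R -> R[i]) : Prop :=
  exists2 u0hat, is_fourier u0 u0hat &
    forall t : R, 0 <= t <= T ->
      is_fourier (u t)
        (fun xi => cexp (- (t%:C * ('i%C * xi%:C) ^+ (2 * p + 1))) * u0hat xi).

Definition cell_average (R : realType) (dx : R) (f : R -> R[i]) (j : int) :
    R[i] :=
  (dx^-1)%:C * cintegral `[j%:~R * dx, (j + 1)%:~R * dx] f.

Definition D_forward (R : realType) (p : nat) (dx : R) (v : int -> R[i])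
    (j : int) : R[i] :=
  \sum_(0 <= k < (2 * p + 1).+1)
    ('C(2 * p + 1, k)%:R * (-1) ^+ k / dx ^+ (2 * p + 1))%:C *
      v (p%:Z - k%:Z + j + 1).

Definition D_backward (R : realType) (p : nat) (dx : R) (v : int -> R[i])
    (j : int) : R[i] :=
  \sum_(0 <= k < (2 * p + 1).+1)
    ('C(2 * p + 1, k)%:R * (-1) ^+ k / dx ^+ (2 * p + 1))%:C *
      v (p%:Z - k%:Z + j).

Definition D_central (R : realType) (p : nat) (dx : R) (v : int -> R[i])
    (j : int) : R[i] :=
  (2^-1)%:C * (D_forward p dx v j + D_backward p dx v j).

(* The one-sided operator whose Fourier symbol has nonnegative real part. *)
Definition D_upwind (R : realType) (p : nat) (dx : R) :
    (int -> R[i]) -> int -> R[i] :=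
  if odd p then D_forward p dx else D_backward p dx.

Definition l2norm (R : realType) (dx : R) (v : int -> R[i]) : \bar R :=
  sqrte (\esum_(j in [set: int]) (dx * Normc.normc (v j) ^+ 2)%:E)%E.

Definition linf_l2norm (R : realType) (N : nat) (dx : R)
    (v : nat -> int -> R[i]) : \bar R :=
  ereal_sup [set l2norm dx (v n) | n in [set n | (n <= N)%N]].

Definition nsteps (R : realType) (T dt : R) : nat := Num.truncn (T / dt).

Definition theta_scheme (R : realType) (D : (int -> R[i]) -> int -> R[i])
    (T theta dx dt : R) (u0 : R -> R[i]) (v : nat -> int -> R[i]) : Prop :=
  [/\ forall n, (n <= nsteps T dt)%N -> (l2norm dx (v n) < +oo)%E,
      forall j, v 0%N j = cell_average dx u0 j &
      forall n j, (n < nsteps T dt)%N ->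
        v n.+1 j + (theta * dt)%:C * D (v n.+1) j =
        v n j - ((1 - theta) * dt)%:C * D (v n) j].

Definition conv_error (R : realType) (dx dt : R) (u : R -> R -> R[i])
    (v : nat -> int -> R[i]) (n : nat) (j : int) : R[i] :=
  cell_average dx (u (n%:R * dt)) j - v n j.

(* Main.v *)
(* A grid sequence is the step function [st dx v] on its cells, of L^2-norm [l2norm dx v],
   and averaging over the cells is a contraction of L^2 which commutes with translations
   by [dx].  Hence the error satisfies A e^{n+1} = B e^n + (cell averages of the defect),
   where A = 1 + theta dt D and B = 1 - (1 - theta) dt D act on L^2.

   Stability.  |w| <= |A w| because <D w, w> >= 0, and |B w|^2 - |A w|^2 equals
   (1 - 2 theta) dt^2 |D w|^2 - 2 dt <D w, w>.  Writing D as a translate of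
   dx^{-(2p+1)} N^{2p+1}, N the backward difference, summation by parts gives
   2 <D w, w> >= dx^{2p+1} 2^{-2p} |D w|^2 for the upwind operator, and <D w, w> = 0 for
   the central one; the CFL conditions then yield |B w| <= (1 + c dt) |A w|, with c = 0
   and c = 8 C_0 respectively.

   Consistency.  On the Fourier side the defect is the initial datum times a multiplier
   bounded by dt (dt |1/2 - theta| |xi|^{4p+2} + C dx |xi|^{2p+2} + C dt^2 |xi|^{6p+3}),
   with dx^2 |xi|^{2p+3} in the middle for the central scheme.  Plancherel's formula,
   obtained from Fejer's kernel, and testing weak derivatives against cut off exponentials
   turn the powers of |xi| into the norms of the derivatives of the datum. *)
Require Import Defs.
From HB Require Import structures.
From mathcomp Require Import all_boot all_order all_algebra.
From mathcomp Require Import complex.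
From mathcomp Require Import all_classical all_reals all_analysis measurable_realfun.
From mathcomp Require Import ring lra.
Import Order.TTheory GRing.Theory Num.Theory.
Import numFieldNormedType.Exports.
Local Open Scope complex_scope.
Local Open Scope classical_set_scope.
Local Open Scope ring_scope.
Set Implicit Arguments.
Unset Strict Implicit.
Unset Printing Implicit Defensive.

(** * Square integrable real functions *)

(** Only functions on the line are Fourier transformed, never grid sequences: the energy estimates
    are identities between translates in L^2(R), so no Fourier series is involved. Of the transform
    one needs the norm identity, linearity and the rule for translations, but no inversion, which is
    why the constant [kappa] can stay unevaluated. Since the transform is an L^2 limit, estimates
    are made on norms, and multipliers by powers of xi are kept truncated to bounded frequencies
    until the last passage to the limit. The operator A is never inverted: the recursion runs on A
    e^n, and |e^n| <= |A e^n| is used once, at the end. The central operator is skew-symmetric and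
    dissipates nothing, so |D w|^2 can only be compared with |w|^2; this costs dx^(4p+2) in the CFL
    condition and the factor exp(8 C_0 T) in the constant. A norm of a derivative may be infinite.
    Its coefficient may also vanish, for theta = 1/2, and 0 times +oo is 0: the term then disappears
    and the bound must do without that derivative. *)

Section RealL2.
Variable R : realType.
Implicit Types (f g h : R -> R) (a b : R).
Local Notation mu := (@lebesgue_measure R).

Definition L1 f := mu.-integrable setT (EFin \o f).
Definition L2 f :=
  measurable_fun [set: R] f /\ mu.-integrable setT (EFin \o (fun x => f x ^+ 2)).

Lemma L1_meas f : L1 f -> measurable_fun [set: R] f.
Proof. by move=> /measurable_int/measurable_EFinP. Qed.

Lemma L1_le f g : measurable_fun [set: R] f -> L1 g ->
  (forall x, `|f x| <= g x) -> L1 f.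
Proof.
move=> mf ig fg; apply: (le_integrable measurableT _ _ ig) => /=.
  exact/measurable_EFinP.
by move=> x _ /=; rewrite lee_fin (le_trans (fg x))// ler_norm.
Qed.

Lemma L1D f g : L1 f -> L1 g -> L1 (fun x => f x + g x).
Proof. by move=> /(integrableD measurableT) h /h. Qed.

Lemma L1B f g : L1 f -> L1 g -> L1 (fun x => f x - g x).
Proof. by move=> /(integrableB measurableT) h /h. Qed.

Lemma L1Z a f : L1 f -> L1 (fun x => a * f x).
Proof. by move=> /(integrableZl measurableT a). Qed.

Lemma L1_norm f : L1 f -> L1 (fun x => `|f x|).
Proof. by move=> /integrable_norm. Qed.

Lemma L1_mulb f (b : R -> R) K : L1 f -> measurable_fun [set: R] b ->
  (forall x, `|b x| <= K) -> L1 (fun x => b x * f x).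
Proof.
move=> if_ mb bK; apply: (L1_le (g := fun x => K * `|f x|)).
- by apply: measurable_funM => //; exact: L1_meas.
- by apply/L1Z/L1_norm.
- by move=> x; rewrite normrM ler_wpM2r.
Qed.

Lemma L2P f : f \in Lfun mu 2%:E <-> L2 f.
Proof.
split=> [lf|[mf lf]].
  split; last exact: Lfun2_integrable_sqr.
  by move: lf; rewrite inE => /andP[]; rewrite inE.
rewrite inE; apply/andP; split; rewrite inE//= /finite_norm unlock/=.
rewrite poweR_lty//.
move/integrableP: lf => [_]; apply: le_lt_trans.
rewrite le_eqVlt; apply/orP; left; apply/eqP; apply: eq_integral => x _ /=.
by rewrite powR_mulrn// normrX.
Qed.

Lemma L2_meas f : L2 f -> measurable_fun [set: R] f. Proof. by case. Qed.
Lemma L2_sqr f : L2 f -> L1 (fun x => f x ^+ 2). Proof. by case. Qed.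

Lemma L2_le f g : measurable_fun [set: R] f -> L2 g ->
  (forall x, `|f x| <= `|g x|) -> L2 f.
Proof.
move=> mf [mg ig] fg; split=> //; apply: (L1_le _ ig).
  exact: measurable_funX.
by move=> x; rewrite ger0_norm ?sqr_ge0// -(real_normK (num_real (f x)))
  -(real_normK (num_real (g x))) lerXn2r ?nnegrE.
Qed.

Lemma L2_mul f g : L2 f -> L2 g -> L1 (fun x => f x * g x).
Proof.
move=> [mf f2] [mg g2].
apply: (L1_le (g := fun x => f x ^+ 2 + g x ^+ 2)).
- exact: measurable_funM.
- exact: L1D.
- move=> x; rewrite ler_norml; nra.
Qed.

Lemma L2Z a f : L2 f -> L2 (fun x => a * f x).
Proof.
move=> [mf f2]; split; first exact: measurable_funM.
by under [X in integrable _ _ X]eq_fun do rewrite /= exprMn; exact: L1Z.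
Qed.

Lemma L2D f g : L2 f -> L2 g -> L2 (fun x => f x + g x).
Proof.
move=> [mf f2] [mg g2]; split; first exact: measurable_funD.
apply: (L1_le (g := fun x => 2 * (f x ^+ 2 + g x ^+ 2))).
- exact/measurable_funX/measurable_funD.
- exact/L1Z/L1D.
- move=> x; rewrite ger0_norm ?sqr_ge0//.
  by have := sqr_ge0 (f x - g x); nra.
Qed.

Lemma L2N f : L2 f -> L2 (fun x => - f x).
Proof.
by move=> /(L2Z (-1)); congr L2; apply/funext => x; rewrite mulN1r.
Qed.

Lemma L2B f g : L2 f -> L2 g -> L2 (fun x => f x - g x).
Proof. by move=> hf /L2N; exact: L2D. Qed.

Lemma L2_mulb f (b : R -> R) K : L2 f -> measurable_fun [set: R] b ->
  (forall x, `|b x| <= K) -> L2 (fun x => b x * f x).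
Proof.
move=> hf mb bK; apply: (L2_le _ (L2Z K hf)) => [|x].
  by apply: measurable_funM => //; exact: L2_meas.
by rewrite !normrM ler_wpM2r// (le_trans (bK x))// ler_norm.
Qed.

Lemma L2_0 : L2 (fun _ => 0).
Proof.
split; first exact: measurable_cst.
under [X in integrable _ _ X]eq_fun do rewrite /= expr0n.
exact: integrable0.
Qed.

Definition rip f g := \int[mu]_x (f x * g x).

Lemma ripC f g : rip f g = rip g f.
Proof. by apply: eq_Rintegral => x _; rewrite mulrC. Qed.

Lemma ripDl f g h : L2 f -> L2 g -> L2 h ->
  rip (fun x => f x + g x) h = rip f h + rip g h.
Proof.
move=> hf hg hh; rewrite /rip -RintegralD//; [|exact: L2_mul|exact: L2_mul].
by apply: eq_Rintegral => x _; rewrite mulrDl.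
Qed.

Lemma ripZl a f h : L2 f -> L2 h -> rip (fun x => a * f x) h = a * rip f h.
Proof.
move=> hf hh; rewrite /rip -RintegralZl//; last exact: L2_mul.
by apply: eq_Rintegral => x _; rewrite mulrA.
Qed.

Lemma rip_ge0 f : 0 <= rip f f.
Proof. by apply: Rintegral_ge0 => x _; rewrite -expr2 sqr_ge0. Qed.

Lemma EFin_Rintegral (D : set R) f : mu.-integrable D (EFin \o f) -> measurable D ->
  (\int[mu]_(x in D) f x)%:E = (\int[mu]_(x in D) (f x)%:E)%E.
Proof. by move=> hf mD; rewrite /Rintegral fineK//; exact: integrable_fin_num. Qed.

(** The image of [a] times Lebesgue measure under x -> a x + b gives half-open intervals their
    length, hence is Lebesgue measure by uniqueness. *)
Lemma ge0_integral_affine (h : R -> \bar R) a b : 0 < a -> measurable_fun [set: R] h ->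
  (forall x, (0 <= h x)%E) ->
  (\int[mu]_x h x = a%:E * \int[mu]_x h (a * x + b)%R)%E.
Proof.
move=> a0 mh h0.
pose phi : measurableTypeR R -> measurableTypeR R := fun x => a * x + b.
have mphi : measurable_fun [set: measurableTypeR R] phi.
  by apply: (@measurable_funD _ R R) => //; exact: measurable_funM.
pose M := mscale (NngNum (ltW a0)) mu.
have mh' : measurable_fun [set: measurableTypeR R] (h \o phi) by exact: measurableT_comp.
rewrite -(@ge0_integral_mscale _ _ _ mu setT measurableT (NngNum (ltW a0)) (h \o phi))//.
have E := @ge0_integral_pushforward _ _ _ _ R phi mphi M
  setT h measurableT mh (fun x _ => h0 x).
rewrite preimage_setT in E; rewrite -[RHS]E.
apply: eq_measure_integral => /= A mA _; apply: lebesgue_measure_unique => //= _ [[c d]] _ <-.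
rewrite /mscale /pushforward /=.
rewrite [X in _ = (_ * lebesgue_measure X)%E](_ : _ = `](c - b) / a, (d - b) / a]%classic); last first.
  apply/seteqP; split=> x /=; rewrite !in_itv/= /phi.
    by rewrite ltr_pdivrMr// ler_pdivlMr// => /andP[? ?]; apply/andP; split; lra.
  by rewrite ltr_pdivrMr// ler_pdivlMr// => /andP[? ?]; apply/andP; split; lra.
rewrite !lebesgue_measure_itv/= !lte_fin ltr_pM2r ?invr_gt0// ltrD2r.
case: ifPn => _; rewrite ?mule0//.
rewrite -!EFinD -EFinM; congr EFin.
have : a != 0 by rewrite gt_eqF.
by move=> ?; field.
by move=> x _; exact: h0.
Qed.

Lemma L1_affine f a b : 0 < a -> L1 f -> L1 (fun x => f (a * x + b)).
Proof.
move=> a0 /[dup] /L1_meas mf /integrableP[_ iff].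
have mg : measurable_fun [set: R] (fun x => f (a * x + b)).
  apply: (measurableT_comp mf).
  by apply: measurable_funD => //; exact: measurable_funM.
apply/integrableP; split; first exact/measurable_EFinP.
move: iff; rewrite (@ge0_integral_affine (fun x => `|(f x)%:E|%E) a b)//; last first.
  exact/measurableT_comp/measurable_EFinP.
move=> H; rewrite -(@lte_pmul2l _ a%:E) ?lte_fin// gt0_muley ?lte_fin//.
Qed.

Lemma Rintegral_affine f a b : 0 < a -> L1 f ->
  \int[mu]_x f x = a * \int[mu]_x f (a * x + b).
Proof.
move=> a0; have ge0 g : (forall x, 0 <= g x) -> L1 g ->
    \int[mu]_x g x = a * \int[mu]_x g (a * x + b).
  move=> g0 hg; apply: EFin_inj; rewrite EFinM !EFin_Rintegral//; last exact: L1_affine.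
  apply: ge0_integral_affine => //.
  exact: measurable_int hg.
move=> hf; have hn := L1_norm hf; have hd := L1D hf hn.
(* A difference of two nonnegative integrable functions, to which the nonnegative case applies. *)
have E : f = fun x => (f x + `|f x|) - `|f x| by apply/funext => x; rewrite addrK.
have P x : 0 <= f x + `|f x| by have := ler_norm (- f x); rewrite normrN; lra.
rewrite E RintegralB// [X in a * X]RintegralB//; [|exact: (L1_affine b a0 hd)|exact: (L1_affine b a0 hn)].
by rewrite mulrBr (ge0 (fun x => f x + `|f x|))// (ge0 (fun x => `|f x|)).
Qed.

Lemma L1_shift f b : L1 f -> L1 (fun x => f (x + b)).
Proof. by move=> /(L1_affine b ltr01); under eq_fun do rewrite mul1r. Qed.

Lemma Rintegral_shift f b : L1 f -> \int[mu]_x f (x + b) = \int[mu]_x f x.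
Proof.
move=> /(Rintegral_affine b ltr01) ->; rewrite mul1r.
by apply: eq_Rintegral => x _; rewrite mul1r.
Qed.

Lemma measurable_shift f b : measurable_fun [set: R] f -> measurable_fun [set: R] (fun x : R => f (x + b)).
Proof. by move=> mf; apply: (measurableT_comp mf); exact: measurable_funD. Qed.

Lemma L2_shift f b : L2 f -> L2 (fun x => f (x + b)).
Proof. by move=> [mf hf]; split; [exact: measurable_shift|exact: (L1_shift b hf)]. Qed.

Lemma rip_shift f g b : L2 f -> L2 g ->
  rip (fun x => f (x + b)) (fun x => g (x + b)) = rip f g.
Proof. by move=> hf hg; rewrite /rip -(Rintegral_shift b (L2_mul hf hg)). Qed.

End RealL2.

(** * Cauchy-Schwarz and continuity of translations *)

Section Translation.
Variable R : realType.
Implicit Types (f g h : R -> R) (a b : R).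
Local Notation mu := (@lebesgue_measure R).

Lemma quadratic_discr (a b c : R) : 0 <= c ->
  (forall t : R, 0 <= a + 2 * t * b + t ^+ 2 * c) -> b ^+ 2 <= a * c.
Proof.
move=> c0 H; have [c_eq0|c_neq0] := eqVneq c 0.
  have [->|b0] := eqVneq b 0; first by rewrite c_eq0 expr0n/= mulr0.
  (* With [c = 0] the polynomial is affine in [t], and this [t] makes it equal to -1. *)
  have := H (- (a + 1) / (2 * b)).
  have -> : a + 2 * (- (a + 1) / (2 * b)) * b = -1 by field.
  rewrite c_eq0 mulr0 addr0; lra.
have cp : 0 < c by rewrite lt_def c_neq0.
have := H (- b / c).
have -> : a + 2 * (- b / c) * b + (- b / c) ^+ 2 * c = (a * c - b ^+ 2) / c by field.
by rewrite pmulr_lge0 ?invr_gt0// subr_ge0.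
Qed.

Lemma rip_expand f g (t : R) : L2 f -> L2 g ->
  rip (fun x => f x + t * g x) (fun x => f x + t * g x) =
  rip f f + 2 * t * rip f g + t ^+ 2 * rip g g.
Proof.
move=> hf hg; have htg := L2Z t hg; have hfg := L2D hf htg.
rewrite (ripDl hf htg hfg) (ripZl t hg hfg) ripC (ripDl hf htg hf).
rewrite [X in t * X]ripC (ripDl hf htg hg) !(ripZl t hg)// (ripC g f); ring.
Qed.

Lemma rip_CS f g : L2 f -> L2 g -> rip f g ^+ 2 <= rip f f * rip g g.
Proof.
move=> hf hg; apply: quadratic_discr; first exact: rip_ge0.
by move=> t; rewrite -rip_expand// rip_ge0.
Qed.

(** By the parallelogram law the two sides differ by the squared norm of f - g. *)
Lemma rip_le2D f g : L2 f -> L2 g ->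
  rip (fun x => f x + g x) (fun x => f x + g x) <= 2 * rip f f + 2 * rip g g.
Proof.
move=> hf hg.
have := rip_ge0 (fun x => f x + -1 * g x).
have E : (fun x => f x + g x) = (fun x => f x + 1 * g x).
  by apply/funext => x; rewrite mul1r.
by rewrite E !rip_expand//; lra.
Qed.

Lemma Rdominated_cvg (F : nat -> R -> R) f g :
  (forall n, measurable_fun [set: R] (F n)) -> measurable_fun [set: R] f ->
  (forall x, F n x @[n --> \oo] --> f x) -> L1 g ->
  (forall n x, `|F n x| <= g x) ->
  \int[mu]_x F n x @[n --> \oo] --> \int[mu]_x f x.
Proof.
move=> mF mf Ff ig Fg.
have iF n : L1 (F n) by exact: L1_le (mF n) ig (Fg n).
have [] := @dominated_convergence _ _ _ mu setT measurableT
  (fun n => EFin \o F n) (EFin \o f) (EFin \o g) _ _ _ ig _.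
- by move=> n; exact: measurable_int (iF n).
- by apply/measurable_EFinP; exact: mf.
- by apply: aeW => x _; apply: cvg_EFin; [exact: nearW|exact: Ff].
- by apply: aeW => x n _ /=; rewrite lee_fin.
move=> if_ _ H; apply: fine_cvg; rewrite EFin_Rintegral//.
Qed.

Lemma L1_indic a b : L1 (\1_`[a, b] : R -> R).
Proof. exact: integrable_indic_itv. Qed.

Lemma measurable_indic_itv a b : measurable_fun [set: R] (\1_`[a, b] : R -> R).
Proof. exact: L1_meas (L1_indic a b). Qed.

Lemma indic_le1 (A : set R) x : `|\1_A x| <= 1 :> R.
Proof. by rewrite indicE; case: (_ \in _); rewrite ?normr1 ?normr0. Qed.

Lemma indic_itv a b (x : R) : (\1_`[a, b] x : R) = (a <= x <= b)%R%:R.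
Proof.
rewrite indicE; case: (boolP (a <= x <= b)) => H; first by rewrite mem_set//= in_itv.
by rewrite memNset//= in_itv/=; exact/negP.
Qed.

Lemma cvg_sqr0 (u : nat -> R) : u n @[n --> \oo] --> 0 -> u n ^+ 2 @[n --> \oo] --> 0.
Proof.
by move=> u0; rewrite -[X in _ --> X](mulr0 (0 : R)); apply: cvgM.
Qed.

Definition cutoff (M : R) f := fun x => \1_`[- M, M] x * f x.

Lemma cutoffE M f x : cutoff M f x = if `|x| <= M then f x else 0.
Proof. by rewrite /cutoff indic_itv -ler_norml; case: ifP => _; rewrite ?mul1r ?mul0r. Qed.

Lemma L2_cut M f : L2 f -> L2 (cutoff M f).
Proof. by move=> hf; apply: (L2_mulb hf (measurable_indic_itv _ _)) => x; exact: indic_le1. Qed.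

Lemma L2_indic a b : L2 (\1_`[a, b] : R -> R).
Proof.
split; first exact: measurable_indic_itv.
apply: (L1_le _ (L1_indic a b)); first by apply: measurable_funX; exact: measurable_indic_itv.
by move=> x; rewrite indicE; case: (_ \in _); rewrite ?expr1n ?expr0n ?normr1 ?normr0.
Qed.

Lemma L1_cut M f : L2 f -> L1 (cutoff M f).
Proof. by move=> hf; exact: L2_mul (L2_indic _ _) hf. Qed.

Lemma cutoff_cvg f x : cutoff n%:R f x @[n --> \oo] --> f x.
Proof.
apply: cvg_near_cst; near=> n; rewrite cutoffE ifT//.
near: n; exact: nbhs_infty_ger.
Unshelve. all: by end_near. Qed.

Lemma rip_sub_cut_cvg f : L2 f ->
  rip (fun x => f x - cutoff n%:R f x) (fun x => f x - cutoff n%:R f x) @[n --> \oo] --> 0.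
Proof.
move=> hf; have := @Rdominated_cvg (fun n x => (f x - cutoff n%:R f x) ^+ 2) (fun=> 0)
  (fun x => f x ^+ 2).
rewrite [X in _ --> X](_ : _ = 0); last by rewrite /Rintegral integral0.
under [X in _ -> _ -> _ -> _ -> _ -> cvg_to (fmap X _) _]eq_fun do
  under eq_Rintegral do rewrite expr2.
apply.
- by move=> n; apply/measurable_funX/measurable_funB; apply: L2_meas => //; exact: L2_cut.
- exact: measurable_cst.
- move=> x; apply: cvg_sqr0; rewrite -[X in _ --> X](subrr (f x)).
  by apply: cvgB; [exact: cvg_cst|exact: cutoff_cvg].
- exact: L2_sqr.
- move=> n x; rewrite cutoffE; case: ifP => _; first by rewrite subrr expr0n normr0 sqr_ge0.
  by rewrite subr0 ger0_norm ?sqr_ge0.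
Qed.

(** Continuity of translations in L^2, along sequences. The bound [B] keeps all translates of a
    compactly supported function in one compact set, which supplies a dominating function. *)
Definition transl_cont f := forall (u : nat -> R) B, (forall n, `|u n| <= B) ->
  u n @[n --> \oo] --> 0 ->
  rip (fun x => f (x + u n) - f x) (fun x => f (x + u n) - f x) @[n --> \oo] --> 0.

Lemma transl_cont_approx f : L2 f ->
  (forall e, 0 < e -> exists g, [/\ L2 g, transl_cont g &
    rip (fun x => f x - g x) (fun x => f x - g x) <= e]) -> transl_cont f.
Proof.
move=> hf H u B uB u0; apply/cvgrPdist_le => e e0.
(* Two uses of [rip_le2D] will give 2 (2 e/12 + 2 e/12) + 2 e/12 = 10 e/12. *)
have [g [hg tg fg]] := H (e / 12) ltac:(lra).
have := tg u B uB u0; move/cvgrPdist_le => /(_ (e / 12) ltac:(lra)).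
apply: filterS => n; rewrite !sub0r !normrN !ger0_norm ?rip_ge0// => gn.
have hfg := L2B hf hg; have hsfg := L2_shift (u n) hfg.
have hsg := L2B (L2_shift (u n) hg) hg.
have hgf := L2B hg hf.
have -> : (fun x => f (x + u n) - f x) =
  (fun x => ((f (x + u n) - g (x + u n)) + (g (x + u n) - g x)) + (g x - f x)).
  by apply/funext => x; ring.
have E1 : rip (fun x => f (x + u n) - g (x + u n)) (fun x => f (x + u n) - g (x + u n)) <= e / 12.
  by rewrite (rip_shift (u n) hfg hfg).
have E2 : rip (fun x => g x - f x) (fun x => g x - f x) <= e / 12.
  rewrite [X in X <= _](_ : _ = rip (fun x => f x - g x) (fun x => f x - g x))//.
  by apply: eq_Rintegral => x _; ring.
have := rip_le2D (L2D hsfg hsg) hgf.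
have := rip_le2D hsfg hsg.
by cbn beta in *; lra.
Qed.

Lemma transl_cont_continuous g M K : continuous g -> (forall x, `|g x| <= K) ->
  (forall x, M < `|x| -> g x = 0) -> transl_cont g.
Proof.
move=> cg gK gM u B uB u0.
have mg := continuous_measurable_fun cg.
have B0 : 0 <= B by exact: le_trans (uB 0%N).
have K0 : 0 <= K by exact: le_trans (gK 0).
have := @Rdominated_cvg (fun n x => (g (x + u n) - g x) ^+ 2) (fun=> 0)
  (fun x => (2 * K) ^+ 2 * \1_`[- (M + B), M + B] x).
rewrite [X in _ --> X](_ : _ = 0); last by rewrite /Rintegral integral0.
under [X in _ -> _ -> _ -> _ -> _ -> cvg_to (fmap X _) _]eq_fun do
  under eq_Rintegral do rewrite expr2.
apply.
- by move=> n; apply/measurable_funX/measurable_funB => //; exact: measurable_shift.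
- exact: measurable_cst.
- move=> x; apply: cvg_sqr0; rewrite -[X in _ --> X](subrr (g x)).
  apply: cvgB; last exact: cvg_cst.
  apply: (@cvg_comp _ _ _ (fun n => x + u n) g); last exact: cg.
  have H : x + u n @[n --> \oo] --> x + 0 by apply: cvgD => //; exact: cvg_cst.
  by rewrite addr0 in H.
- exact/L1Z/L1_indic.
- move=> n x; rewrite indic_itv -ler_norml; case: (lerP `|x| (M + B)) => xM.
    rewrite mulr1 normrX lerXn2r ?nnegrE ?mulr_ge0//.
    by rewrite (le_trans (ler_normB _ _))//; have := gK (x + u n); have := gK x; lra.
  rewrite !gM ?subrr ?expr0n ?normr0 ?mulr0//.
    by rewrite (le_lt_trans _ xM)// lerDl.
  have := ler_normB (x + u n) (u n); rewrite addrK; have := uB n; lra.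
Qed.

(** The projection onto [-K, K] when K >= 0, in a closed form whose continuity is immediate. *)
Definition clip (K y : R) := (`|y + K| - `|y - K|) / 2.

Lemma clip_id K y : `|y| <= K -> clip K y = y.
Proof.
rewrite ler_norml => /andP[yK Ky]; rewrite /clip ger0_norm ?ler0_norm; lra.
Qed.

Lemma clip_gt K y : 0 <= K -> K <= y -> clip K y = K.
Proof. by move=> K0 Ky; rewrite /clip !ger0_norm; lra. Qed.

Lemma clip_lt K y : 0 <= K -> y <= - K -> clip K y = - K.
Proof. by move=> K0 Ky; rewrite /clip !ler0_norm; lra. Qed.

Lemma clip_le K y : 0 <= K -> `|clip K y| <= K.
Proof.
move=> K0; rewrite /clip ler_norml.
case: (lerP 0 (y + K)) => H1; case: (lerP 0 (y - K)) => H2;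
  rewrite ?(ger0_norm H1) ?(ltr0_norm H1) ?(ger0_norm H2) ?(ltr0_norm H2); lra.
Qed.

Lemma clip_lip K y z : 0 <= K -> `|clip K y - clip K z| <= `|y - z|.
Proof.
move=> K0; rewrite /clip; apply/ler_normlP.
have := ler_norm (y - z); have := ler_norm (z - y); rewrite (distrC z y).
case: (lerP 0 (y + K)) => H1; case: (lerP 0 (y - K)) => H2;
case: (lerP 0 (z + K)) => H3; case: (lerP 0 (z - K)) => H4;
  rewrite ?(ger0_norm H1) ?(ltr0_norm H1) ?(ger0_norm H2) ?(ltr0_norm H2)
  ?(ger0_norm H3) ?(ltr0_norm H3) ?(ger0_norm H4) ?(ltr0_norm H4) => ? ?; split; lra.
Qed.

Lemma clip_continuous K g : continuous g -> continuous (fun x => clip K (g x)).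
Proof.
move=> cg x; rewrite /clip; apply: cvgM; last exact: cvg_cst.
apply: cvgB; apply: cvg_norm; [apply: cvgD|apply: cvgB]; try exact: cvg_cst; exact: cg.
Qed.

Lemma measurable_clip K g : measurable_fun [set: R] g ->
  measurable_fun [set: R] (fun x => clip K (g x)).
Proof.
move=> mg; apply: (measurableT_comp (continuous_measurable_fun (@clip_continuous K id _))) => //.
by move=> x; exact: cvg_id.
Qed.

Lemma div_succ_le (M e : R) : 0 <= M -> 0 < e -> 2 * M * (e / 8 / (M + 1)) <= e / 4.
Proof.
move=> M0 e0; have M1 : M + 1 != 0 by rewrite gt_eqF//; lra.
have -> : 2 * M * (e / 8 / (M + 1)) = (e / 4) * (M / (M + 1)) by field.
by rewrite ger_pMr ?divr_gt0// ler_pdivrMr; lra.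
Qed.

(** Density of continuous functions with compact support. [f] is cut off in space and in value to
    [fc n], which a continuous [g] approximates in L^1 on a compact set. Clipping [g] to [-M, M] and
    multiplying it by a plateau makes it bounded with compact support, and boundedness turns the L^1
    estimate into an L^2 one. *)
Lemma L2_transl_cont f : L2 f -> transl_cont f.
Proof.
move=> hf; apply: transl_cont_approx => // e e0.
pose fc n := cutoff n%:R (fun x => clip n%:R (f x)).
have fcf n x : `|f x - fc n x| <= `|f x|.
  rewrite /fc cutoffE; case: ifP => _; last by rewrite subr0.
  rewrite /clip.
  case: (lerP 0 (f x + n%:R)) => H1; case: (lerP 0 (f x - n%:R)) => H2;
  rewrite ?(ger0_norm H1) ?(ltr0_norm H1) ?(ger0_norm H2) ?(ltr0_norm H2);
  have : 0 <= n%:R :> R by []; case: (lerP 0 (f x)) => H3 Hn;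
  rewrite ?[in leRHS](ger0_norm H3) ?[in leRHS](ltr0_norm H3);
  apply/ler_normlP; split; lra.
have mclip n : measurable_fun [set: R] (fun x => clip n%:R (f x)).
  by apply: measurable_clip; exact: L2_meas.
have mfc n : measurable_fun [set: R] (fc n).
  by apply: measurable_funM => //; exact: measurable_indic_itv.
have mffc n : measurable_fun [set: R] (fun x => f x - fc n x).
  by apply: measurable_funB => //; exact: L2_meas.
have fc_cvg x : fc n x @[n --> \oo] --> f x.
  apply: cvg_near_cst; near=> n; rewrite /fc cutoffE ifT ?clip_id//.
    by near: n; exact: nbhs_infty_ger.
  by near: n; exact: nbhs_infty_ger.
have lim0 : rip (fun x => f x - fc n x) (fun x => f x - fc n x) @[n --> \oo] --> 0.
  have := @Rdominated_cvg (fun n x => (f x - fc n x) ^+ 2) (fun=> 0) (fun x => f x ^+ 2).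
  rewrite [X in _ --> X](_ : _ = 0); last by rewrite /Rintegral integral0.
  under [X in _ -> _ -> _ -> _ -> _ -> cvg_to (fmap X _) _]eq_fun do
    under eq_Rintegral do rewrite expr2.
  apply.
  - by move=> n; apply: measurable_funX.
  - exact: measurable_cst.
  - move=> x; apply: cvg_sqr0; rewrite -[X in _ --> X](subrr (f x)).
    by apply: cvgB; [exact: cvg_cst|exact: fc_cvg].
  - exact: L2_sqr.
  - by move=> n x; rewrite normrX -[leRHS](@ger0_norm R _ (sqr_ge0 _)) normrX lerXn2r ?nnegrE.
move/cvgrPdist_le : lim0 => /(_ (e / 4) ltac:(lra)) [n _ Hn].
have := Hn n (leqnn n) => /=; rewrite sub0r normrN ger0_norm ?rip_ge0// => {}Hn.
pose M := n%:R : R; have M0 : 0 <= M by [].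
have fcM x : `|fc n x| <= M.
  by rewrite /fc cutoffE; case: ifP => _; [exact: clip_le|rewrite normr0].
have L2fc : L2 (fc n).
  apply: (L2_le (mfc n) hf) => x; rewrite /fc cutoffE; case: ifP => _; last by rewrite normr0.
  have := @clip_lip M (f x) 0 M0; rewrite subr0.
  by rewrite (_ : clip M 0 = 0) ?subr0// clip_id// normr0.
pose E := `[- (M + 1), M + 1]%classic : set R.
have mE : measurable E by exact: measurable_itv.
have L1fc : L1 (fc n) by apply: L1_cut; apply: (L2_le (mclip n) hf) => x;
  have := @clip_lip M (f x) 0 M0; rewrite subr0 (_ : clip M 0 = 0) ?subr0// clip_id// normr0.
have EfinE : (mu E < +oo)%E.
  by rewrite lebesgue_measure_itv/= lte_fin; case: ifPn => _; rewrite ?ltry// -EFinB ltry.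
have iE : mu.-integrable E (EFin \o fc n) by apply: integrableS L1fc => //.
have [g_ [cg ig gcvg]] := approximation_continuous_integrable mE EfinE iE.
(* [div_succ_le] will convert this L^1 error, multiplied by 2 M, into e/4; the denominator is M + 1
   because [M] may be 0. *)
have e'0 : 0 < e / 8 / (M + 1) by rewrite !divr_gt0//; lra.
have := gcvg; move/fine_cvgP => [_ /cvgrPdist_le /(_ _ e'0)] [m _ Hm].
have {Hm} := Hm m (leqnn m) => /=; rewrite sub0r normrN ger0_norm; last first.
  by apply: fine_ge0; apply: integral_ge0 => x _; rewrite lee_fin.
set g := g_ m => Hm.
(* A continuous plateau: 1 on [-M, M], 0 beyond M + 1, affine in between. *)
pose hat (x : R) := clip 2^-1 (M + 2^-1 - `|x|) + 2^-1.
have hat01 x : 0 <= hat x <= 1.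
  have := @clip_le 2^-1 (M + 2^-1 - `|x|) ltac:(lra); rewrite ler_norml /hat => /andP[? ?].
  by apply/andP; split; lra.
have hat1 x : `|x| <= M -> hat x = 1.
  by move=> xM; rewrite /hat clip_gt; lra.
have hat0 x : M + 1 < `|x| -> hat x = 0.
  by move=> xM; rewrite /hat clip_lt; lra.
pose k x := hat x * clip M (g x).
have ck : continuous k.
  move=> x; apply: cvgM; last exact: (clip_continuous (cg m)).
  apply: cvgD; last exact: cvg_cst.
  apply: (@clip_continuous 2^-1 (fun x => M + 2^-1 - `|x|)) => y.
  by apply: cvgB; [exact: cvg_cst|apply: cvg_norm].
have kM x : `|k x| <= M.
  rewrite /k normrM -[leRHS]mul1r ler_pM//; last exact: clip_le.
  by have /andP[? ?] := hat01 x; rewrite ger0_norm.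
have k0 x : M + 1 < `|x| -> k x = 0 by move=> xM; rewrite /k hat0// mul0r.
have mk := continuous_measurable_fun ck.
have L2k : L2 k.
  apply: (L2_le mk (L2Z M (L2_indic (- (M + 1)) (M + 1)))) => x.
  rewrite indic_itv -ler_norml; case: (lerP `|x| (M + 1)) => xM; last by rewrite k0// normr0.
  by rewrite mulr1 (le_trans (kM x))// ler_norm.
exists k; split => //; first exact: transl_cont_continuous ck kM k0.
(* One factor of the square is at most 2 M; the other is at most |fc n - g|, since clipping is
   1-Lipschitz and fixes the values of [fc n]. *)
have fck x : (fc n x - k x) ^+ 2 <= 2 * M * (\1_E x * `|fc n x - g x|).
  rewrite indic_itv -ler_norml; case: (lerP `|x| (M + 1)) => xM; last first.
    rewrite mul0r mulr0 k0// /fc cutoffE ifF ?subr0 ?expr0n//.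
    by apply/negbTE; rewrite -ltNge; lra.
  rewrite mul1r.
  have H1 : `|fc n x - k x| <= 2 * M.
    by rewrite (le_trans (ler_normB _ _))//; have := fcM x; have := kM x; lra.
  have H2 : `|fc n x - k x| <= `|fc n x - g x|.
    rewrite /k; case: (lerP `|x| M) => xM'.
      by rewrite hat1// mul1r -{1}(clip_id (fcM x)) clip_lip.
    have -> : fc n x = 0 by rewrite /fc cutoffE ifF//; apply/negbTE; rewrite -ltNge.
    rewrite !sub0r !normrN normrM -[leRHS]mul1r ler_pM//.
      by have /andP[? ?] := hat01 x; rewrite ger0_norm.
    by have := @clip_lip M (g x) 0 M0; rewrite (_ : clip M 0 = 0) ?subr0// clip_id// normr0.
  by rewrite -real_normK ?num_real// expr2 ler_pM.
have L1E : L1 (fun x => \1_E x * `|fc n x - g x|).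
  have : mu.-integrable E (EFin \o (fun x => `|fc n x - g x|)).
    have H := @integrableB _ _ _ mu E _ _ _ iE (ig m).
    by have /integrable_norm := H mE.
  move=> H; have {H} := (@integrable_mkcond _ _ _ mu E _ mE).1 H.
  apply: eq_integrable => // x _ /=.
  by rewrite patchE indicE; case: ifP => _; rewrite ?mul1r ?mul0r.
have Hint : rip (fun x => fc n x - k x) (fun x => fc n x - k x) <=
    2 * M * \int[mu]_x (\1_E x * `|fc n x - g x|).
  rewrite -RintegralZl//; apply: le_Rintegral => //.
  - exact: (L2_mul (L2B L2fc L2k) (L2B L2fc L2k)).
  - exact: L1Z.
  - by move=> x _; rewrite -expr2.
have HE : \int[mu]_x (\1_E x * `|fc n x - g x|) <= e / 8 / (M + 1).
  apply: le_trans Hm; rewrite le_eqVlt; apply/orP; left; apply/eqP.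
  rewrite [RHS](_ : _ = \int[mu]_(x in E) `|fc n x - g x|)// [RHS]Rintegral_mkcond.
  apply: eq_Rintegral => x _; rewrite patchE indicE.
  by case: ifP => _; rewrite ?mul1r ?mul0r.
have H2M : 0 <= 2 * M by rewrite mulr_ge0.
have := rip_le2D (L2B hf L2fc) (L2B L2fc L2k).
rewrite [X in X <= _](_ : _ = rip (fun x => f x - k x) (fun x => f x - k x)); last first.
  by congr rip; apply/funext => x; ring.
move=> /le_trans; apply.
have := le_trans (le_trans Hint (ler_wpM2l H2M HE)) (div_succ_le M0 e0).
by move: Hn; clear; cbn beta; lra.
Unshelve. all: by end_near. Qed.

End Translation.

(** * Fubini's theorem for real integrals *)

Section Fubini.
Variable R : realType.
Implicit Types (f g h : R -> R) (F : R -> R -> R).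
Local Notation mu := (@lebesgue_measure R).

Definition meas2 F := measurable_fun [set: R * R] (fun p => F p.1 p.2).

Lemma meas2_x f : measurable_fun [set: R] f -> meas2 (fun x _ => f x).
Proof. by move=> mf; apply: (measurableT_comp mf); exact: measurable_fst. Qed.

Lemma meas2_y f : measurable_fun [set: R] f -> meas2 (fun _ y => f y).
Proof. by move=> mf; apply: (measurableT_comp mf); exact: measurable_snd. Qed.

Lemma meas2_M F G : meas2 F -> meas2 G -> meas2 (fun x y => F x y * G x y).
Proof. by move=> mF mG; exact: measurable_funM. Qed.

Lemma meas2_D F G : meas2 F -> meas2 G -> meas2 (fun x y => F x y + G x y).
Proof. by move=> mF mG; exact: measurable_funD. Qed.

Lemma meas2_comp f F : measurable_fun [set: R] f -> meas2 F -> meas2 (fun x y => f (F x y)).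
Proof. by move=> mf mF; exact: (measurableT_comp mf mF). Qed.

Lemma measurable_id_R : measurable_fun [set: R] (fun x : R => x).
Proof. exact: measurable_id. Qed.

Lemma measurable_cos_R : measurable_fun [set: R] (@cos R).
Proof. by apply: continuous_measurable_fun; exact: continuous_cos. Qed.

Lemma measurable_sin_R : measurable_fun [set: R] (@sin R).
Proof. by apply: continuous_measurable_fun; exact: continuous_sin. Qed.

Lemma measurable_comp_R f g : measurable_fun [set: R] f -> measurable_fun [set: R] g ->
  measurable_fun [set: R] (fun x => f (g x)).
Proof. by move=> mf mg; exact: (measurableT_comp mf mg). Qed.

Lemma meas2_xy : meas2 (fun x y : R => x * y).
Proof. by apply: meas2_M; [apply: meas2_x|apply: meas2_y]; exact: measurable_id_R. Qed.

Lemma meas2_cos : meas2 (fun x y : R => cos (x * y)).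
Proof. exact: meas2_comp measurable_cos_R meas2_xy. Qed.

Lemma meas2_sin : meas2 (fun x y : R => sin (x * y)).
Proof. exact: meas2_comp measurable_sin_R meas2_xy. Qed.

Lemma meas2_slice F x : meas2 F -> measurable_fun [set: R] (F x).
Proof.
move=> mF; have H := measurable_fun_pair (@measurable_cst _ _ R R setT x) (measurable_id_R).
exact: (measurableT_comp mF H).
Qed.

Lemma meas2_swap F : meas2 F -> meas2 (fun y x => F x y).
Proof.
move=> mF; have H := measurable_fun_pair (@measurable_snd _ _ R R) (@measurable_fst _ _ R R).
exact: (measurableT_comp mF H).
Qed.

Lemma ge0_measurable_Rint F : meas2 F -> (forall x y, 0 <= F x y) ->
  measurable_fun [set: R] (fun x => \int[mu]_y F x y).
Proof.
move=> mF F0; have mG : measurable_fun [set: R * R] (fun p => (F p.1 p.2)%:E).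
  by apply/measurable_EFinP.
have := @measurable_fun_fubini_tonelli_F _ _ _ _ R mu _ mG (fun p => F0 p.1 p.2).
by move=> H; apply: (measurableT_comp (@fine_measurable R setT measurableT) H).
Qed.

(** Adding [g] makes the integrand nonnegative, and then measurability of the partial integral is
    part of Tonelli's theorem. *)
Lemma measurable_Rint F g : meas2 F -> L1 g -> (forall x y, `|F x y| <= g y) ->
  measurable_fun [set: R] (fun x => \int[mu]_y F x y).
Proof.
move=> mF hg Fg.
have mg := L1_meas hg.
have hF x : L1 (F x) by apply: (L1_le (meas2_slice x mF) hg (Fg x)).
have -> : (fun x => \int[mu]_y F x y) = (fun x => \int[mu]_y (F x y + g y) - \int[mu]_y g y).
  by apply/funext => x; rewrite (RintegralD measurableT (hF x) hg) addrK.
apply: measurable_funB; last exact: measurable_cst.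
apply: ge0_measurable_Rint; first by apply: meas2_D => //; exact: meas2_y.
move=> x y; have := ler_norm (- F x y); rewrite normrN; have := Fg x y; lra.
Qed.

Lemma RFubini F : meas2 F -> (forall x, L1 (F x)) -> (forall y, L1 (fun x => F x y)) ->
  L1 (fun x => \int[mu]_y `|F x y|) ->
  L1 (fun y => \int[mu]_x F x y) /\
  \int[mu]_x \int[mu]_y F x y = \int[mu]_y \int[mu]_x F x y.
Proof.
move=> mF hx hy hxy.
have mG : measurable_fun [set: R * R] (fun p => (F p.1 p.2)%:E) by exact/measurable_EFinP.
have iG : (mu \x mu)%E.-integrable setT (fun p : R * R => (F p.1 p.2)%:E).
  apply/(integrable12ltyP mu mu mG) => /=.
  move/integrableP: hxy => [_]; apply: le_lt_trans.
  rewrite le_eqVlt; apply/orP; left; apply/eqP; apply: eq_integral => x _ /=.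
  rewrite ger0_norm; last exact: Rintegral_ge0.
  by rewrite EFin_Rintegral//; exact: L1_norm.
(* With the variables exchanged, the partial integral of Fubini's theorem is the one over [x], whose
   integrability is claimed. *)
have mG' : measurable_fun [set: R * R] (fun p => (F p.2 p.1)%:E).
  by apply/measurable_EFinP; exact: (meas2_swap mF).
have iG' : (mu \x mu)%E.-integrable setT (fun p : R * R => (F p.2 p.1)%:E).
  apply/(integrable21ltyP mu mu mG') => /=.
  exact: ((integrable12ltyP mu mu mG).1 iG).
have := Fubini iG; have := integrable_fubini_F iG'; rewrite /fubini_F /=.
under [X in mu.-integrable _ X]eq_fun => y do rewrite -(EFin_Rintegral (hy y))//.
move=> H1 H2; split => //; congr fine.
rewrite -[RHS](_ : (\int[mu]_y \int[mu]_x (F x y)%:E)%E = _).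
  by rewrite -H2; apply: eq_integral => x _; rewrite (EFin_Rintegral (hx x) measurableT).
by apply: eq_integral => y _; rewrite (EFin_Rintegral (hy y) measurableT).
Qed.

End Fubini.

(** * Taylor bounds for sine and cosine *)

Section TrigBounds.
Variable R : realType.
Implicit Types x s : R.

(** Each bound below integrates an earlier one: sin x <= x gives the bound for cos to order 2 and
    then for sin to order 3; 1 - x <= cos x gives the bound for sin to order 2 and then for cos to
    order 3. *)
Lemma ge0_of_derive_ge0 (f f' : R -> R) : f 0 = 0 ->
  (forall x, is_derive x (1 : R) f (f' x)) ->
  (forall x, 0 <= x -> 0 <= f' x) -> forall x, 0 <= x -> 0 <= f x.
Proof.
move=> f0 df f'0 x x0; rewrite -f0.
apply: (@ger0_derive1_ndecr _ f 0 x) => //.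
- by move=> y; rewrite in_itv/= => /andP[y0 _]; rewrite derive1E derive_val f'0// ltW.
- apply: continuous_subspaceT => y; apply: differentiable_continuous.
  by apply/derivable1_diffP; exact: ex_derive.
Qed.

Lemma sin_le_id x : 0 <= x -> sin x <= x.
Proof.
move=> x0; rewrite -subr_ge0; move: x x0.
apply: (@ge0_of_derive_ge0 (fun x => x - sin x) (fun x => 1 - cos x)).
- by rewrite sin0 subr0.
- by move=> x _; rewrite subr_ge0 cos_le1.
Qed.

Lemma cos_ge_sqr x : 0 <= x -> 1 - x ^+ 2 / 2 <= cos x.
Proof.
move=> x0; rewrite -subr_ge0; move: x x0.
apply: (@ge0_of_derive_ge0 (fun x => cos x - (1 - x ^+ 2 / 2)) (fun x => x - sin x)).
- by rewrite cos0 expr0n/=; lra.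
- by move=> x; apply: is_derive_eq; rewrite /GRing.scale/=; field.
- by move=> x x0; rewrite subr_ge0 sin_le_id.
Qed.

Lemma cos_ge_id x : 0 <= x -> 1 - x <= cos x.
Proof.
move=> x0; rewrite -subr_ge0; move: x x0.
apply: (@ge0_of_derive_ge0 (fun x => cos x - (1 - x)) (fun x => 1 - sin x)).
- by rewrite cos0; lra.
- by move=> x; apply: is_derive_eq; rewrite /GRing.scale/=; ring.
- by move=> x x0; rewrite subr_ge0 sin_le1.
Qed.

Lemma sin_ge_cube x : 0 <= x -> x - x ^+ 3 / 6 <= sin x.
Proof.
move=> x0; rewrite -subr_ge0; move: x x0.
apply: (@ge0_of_derive_ge0 (fun x => sin x - (x - x ^+ 3 / 6))
  (fun x => cos x - (1 - x ^+ 2 / 2))).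
- by rewrite sin0 expr0n/=; lra.
- by move=> x; apply: is_derive_eq; rewrite /GRing.scale/=; field.
- by move=> x x0; rewrite subr_ge0 cos_ge_sqr.
Qed.

Lemma sin_ge_sqr x : 0 <= x -> x - x ^+ 2 / 2 <= sin x.
Proof.
move=> x0; rewrite -subr_ge0; move: x x0.
apply: (@ge0_of_derive_ge0 (fun x => sin x - (x - x ^+ 2 / 2)) (fun x => cos x - (1 - x))).
- by rewrite sin0 expr0n/=; lra.
- by move=> x; apply: is_derive_eq; rewrite /GRing.scale/=; field.
- by move=> x x0; rewrite subr_ge0 cos_ge_id.
Qed.

Lemma cos_le_cube x : 0 <= x -> cos x <= 1 - x ^+ 2 / 2 + x ^+ 3 / 6.
Proof.
move=> x0; rewrite -subr_ge0; move: x x0.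
apply: (@ge0_of_derive_ge0 (fun x => 1 - x ^+ 2 / 2 + x ^+ 3 / 6 - cos x)
  (fun x => sin x - (x - x ^+ 2 / 2))).
- by rewrite cos0 !expr0n/=; lra.
- by move=> x; apply: is_derive_eq; rewrite /GRing.scale/=; field.
- by move=> x x0; rewrite subr_ge0 sin_ge_sqr.
Qed.

Lemma cosN_norm x : cos x = cos `|x|.
Proof. by case: (lerP 0 x) => x0; rewrite ?(ger0_norm x0) ?(ltr0_norm x0)// cosN. Qed.

End TrigBounds.

(** * Fejer's kernel *)

Section FejerKernel.
Variable R : realType.
Implicit Types (f g h : R -> R).
Local Notation mu := (@lebesgue_measure R).

Definition hat (s : R) : R := \1_`[-1, 1] s * (1 - `|s|).

Lemma hatE s : hat s = if `|s| <= 1 then 1 - `|s| else 0.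
Proof. by rewrite /hat indic_itv -ler_norml; case: ifP => _; rewrite ?mul1r ?mul0r. Qed.

Lemma hat_ge0 s : 0 <= hat s.
Proof. by rewrite hatE; case: ifP => //; rewrite subr_ge0. Qed.

Lemma hat_le1 s : `|hat s| <= 1.
Proof.
by rewrite ger0_norm ?hat_ge0// hatE; case: ifP => // _; rewrite gerBl.
Qed.

Lemma hatN s : hat (- s) = hat s. Proof. by rewrite !hatE normrN. Qed.

Lemma measurable_hat : measurable_fun [set: R] hat.
Proof.
apply: measurable_funM; first exact: measurable_indic_itv.
by apply: measurable_funB => //; exact: measurable_normr.
Qed.

Lemma hat_indic s : `|hat s| <= \1_`[-1, 1] s.
Proof.
have := hat_le1 s; rewrite /hat indic_itv; case: (_ <= _ <= _) => //=.
by rewrite mul0r normr0.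
Qed.

Lemma L1_hat : L1 hat.
Proof. exact: L1_le measurable_hat (L1_indic _ _) hat_indic. Qed.

Lemma L1_hat_cos z : L1 (fun s => hat s * cos (s * z)).
Proof.
apply: (L1_le _ (L1_indic (-1) 1)).
  apply: measurable_funM; first exact: measurable_hat.
  have mz : measurable_fun [set: R] (fun s : R => s * z) by exact: measurable_funM.
  exact: (measurable_comp_R (@measurable_cos_R R) mz).
move=> s; rewrite normrM -[leRHS]mulr1 ler_pM ?cos_max//; exact: hat_indic.
Qed.

(** Fejer's kernel 2 (1 - cos z) / z^2, introduced as the transform of the triangle function so that
    z = 0 needs no separate definition. *)
Definition fejer (z : R) : R := \int[mu]_s (hat s * cos (s * z)).

Lemma meas2_hat_cos : meas2 (fun z s : R => hat s * cos (s * z)).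
Proof.
apply: meas2_M; first by apply: meas2_y; exact: measurable_hat.
by apply: meas2_swap; exact: meas2_cos.
Qed.

Lemma measurable_fejer : measurable_fun [set: R] fejer.
Proof.
apply: (measurable_Rint meas2_hat_cos (L1_indic (-1) 1)) => z s.
rewrite normrM -[leRHS]mulr1 ler_pM ?cos_max//; exact: hat_indic.
Qed.

Lemma Rintegral_FTC2 f (G : R -> R) (a b : R) : a < b -> continuous f ->
  (forall x, is_derive x (1 : R) G (f x)) -> \int[mu]_(x in `[a, b]) f x = G b - G a.
Proof.
move=> ab cf dG; rewrite /Rintegral (@continuous_FTC2 _ f G)//.
- exact: continuous_subspaceT.
- have cG x : {for x, continuous G}.
    by apply: differentiable_continuous; apply/derivable1_diffP; exact: ex_derive.
  by split; [move=> x _; exact: ex_derive|apply: cvg_at_right_filter; exact: cG|apply: cvg_at_left_filter; exact: cG].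
- by move=> x _; rewrite derive1E; exact: derive_val.
Qed.

Lemma Rintegral_indic_mul f a b :
  \int[mu]_x (\1_`[a, b] x * f x) = \int[mu]_(x in `[a, b]) f x.
Proof.
rewrite [RHS]Rintegral_mkcond; apply: eq_Rintegral => x _.
by rewrite patchE indicE; case: ifP => _; rewrite ?mul1r ?mul0r.
Qed.

Lemma Rintegral_indic (a b : R) : a < b -> \int[mu]_x \1_`[a, b] x = b - a.
Proof.
move=> ab; rewrite /Rintegral integral_indic// setIT.
have E : mu `[a, b]%classic = (b - a)%:E by rewrite lebesgue_measure_itv/= lte_fin ab -EFinB.
exact: (congr1 fine E).
Qed.

(** Once multiplied by z^2, the integrand has an explicit antiderivative without denominators on
    each of [-1, 0] and [0, 1], where the triangle is affine. *)
Lemma fejer_sqr z : fejer z * z ^+ 2 = 2 * (1 - cos z).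
Proof.
pose g1 (s : R) := (1 - s) * cos (s * z) * z ^+ 2.
pose g2 (s : R) := (1 + s) * cos (s * z) * z ^+ 2.
have c1 : continuous (fun s : R => cos (s * z)).
  move=> s; apply: (@cvg_comp _ _ _ (fun s : R => s * z) cos); last exact: continuous_cos.
  by apply: cvgM; [exact: cvg_id|exact: cvg_cst].
have cg1 : continuous g1.
  move=> s; apply: cvgM; last exact: cvg_cst.
  by apply: cvgM; [apply: cvgB; [exact: cvg_cst|exact: cvg_id]|exact: c1].
have cg2 : continuous g2.
  move=> s; apply: cvgM; last exact: cvg_cst.
  by apply: cvgM; [apply: cvgD; [exact: cvg_cst|exact: cvg_id]|exact: c1].
have i1 : \int[mu]_(s in `[0, 1]) g1 s = 1 - cos z.
  have d1 (s : R) : is_derive s (1 : R)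
      (fun s => (1 - s) * sin (s * z) * z - cos (s * z)) (g1 s).
    by apply: is_derive_eq; rewrite /g1 /GRing.scale/=; ring.
  rewrite (Rintegral_FTC2 ltr01 cg1 d1) subrr !mul0r mul1r sin0 cos0 mulr0 mul0r.
  by rewrite !sub0r opprK addrC.
have i2 : \int[mu]_(s in `[-1, 0]) g2 s = 1 - cos z.
  have d2 (s : R) : is_derive s (1 : R)
      (fun s => (1 + s) * sin (s * z) * z + cos (s * z)) (g2 s).
    by apply: is_derive_eq; rewrite /g2 /GRing.scale/=; ring.
  rewrite (Rintegral_FTC2 _ cg2 d2) ?ltrN10// subrr !mul0r mulN1r sin0 cos0 cosN.
  by rewrite mulr0 mul0r !add0r.
pose h (s : R) := (1 - `|s|) * cos (s * z) * z ^+ 2.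
have ch : continuous h.
  move=> s; apply: cvgM; last exact: cvg_cst.
  by apply: cvgM; [apply: cvgB; [exact: cvg_cst|exact: norm_continuous]|exact: c1].
have ih : mu.-integrable `[-1, 1] (EFin \o h).
  by apply: continuous_compact_integrable; [exact: segment_compact|exact: continuous_subspaceT].
have -> : fejer z * z ^+ 2 = \int[mu]_(s in `[-1, 1]) h s.
  rewrite /fejer -RintegralZr//; last exact: L1_hat_cos.
  by rewrite -Rintegral_indic_mul; apply: eq_Rintegral => s _; rewrite /h /hat; ring.
have := @Rintegral_itvB _ h (BLeft (-1)) (BRight 1) 0 ih; rewrite !bnd_simp => /(_ _ _)/eqP.
rewrite subr_eq => /(_ _ _)/eqP ->; [|lra..].
rewrite Rintegral_itv_obnd_cbnd; last first.
  by apply: integrableS ih => // s /=; rewrite !in_itv/= => /andP[? ?]; apply/andP; split; lra.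
rewrite mulr2n mulrDl mul1r -{1}i1 -i2; congr (_ + _).
  apply: eq_Rintegral => s; rewrite inE/= in_itv/= => /andP[s0 _].
  by rewrite /h /g1 ger0_norm.
apply: eq_Rintegral => s; rewrite inE/= in_itv/= => /andP[_ s0].
by rewrite /h /g2 ler0_norm// opprK.
Qed.

Lemma fejer_ge0 z : 0 <= fejer z.
Proof.
have [->|z0] := eqVneq z 0.
  by apply: Rintegral_ge0 => s _; rewrite mulr0 cos0 mulr1 hat_ge0.
have := fejer_sqr z; have := cos_le1 z => H1 H2.
have : 0 <= fejer z * z ^+ 2 by rewrite H2; lra.
by rewrite pmulr_lge0// exprn_even_gt0.
Qed.

Lemma L1_oneDsqrV : L1 (fun x : R => (oneDsqr x)^-1).
Proof.
have mf : measurable_fun [set: R] (fun x : R => (oneDsqr x)^-1).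
  by apply: continuous_measurable_fun; exact: continuous_oneDsqrV.
apply/integrableP; split; first exact/measurable_EFinP.
have f0 (x : R) : 0 <= (oneDsqr x)^-1 by rewrite invr_ge0 (le_trans ler01 (oneDsqr_ge1 _)).
under eq_integral => x _ do rewrite /= ger0_norm//.
rewrite ge0_symfun_integralT//=.
- rewrite (_ : [set x | _] = `[0, +oo[%classic); last first.
    by apply/seteqP; split => x/=; rewrite in_itv/= andbT.
  by rewrite integral0y_oneDsqr -EFinM ltry.
- exact: continuous_oneDsqrV.
- by move=> x/=; rewrite /oneDsqr sqrrN.
Qed.

Lemma fejer_le_hat z : `|fejer z| <= \int[mu]_s hat s.
Proof.
rewrite (le_trans (le_normr_Rintegral _ _))//; first exact: L1_hat_cos.
apply: le_Rintegral => //; [exact: L1_norm (L1_hat_cos z)|exact: L1_hat|].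
move=> s _; rewrite normrM (ger0_norm (hat_ge0 s)) -[leRHS]mulr1.
by rewrite ler_wpM2l ?hat_ge0 ?cos_max.
Qed.

Lemma L1_fejer : L1 fejer.
Proof.
pose K := \int[mu]_s hat s.
have K0 : 0 <= K by apply: Rintegral_ge0 => s _; exact: hat_ge0.
(* In fejer z (1 + z^2) the first term is at most [K], and the second, 2 (1 - cos z), at most 4. *)
apply: (L1_le measurable_fejer (L1Z (K + 4) L1_oneDsqrV)) => z.
rewrite ger0_norm ?fejer_ge0// ler_pdivlMr ?oneDsqr_gt0// /oneDsqr mulrDr mulr1.
rewrite fejer_sqr lerD//; first by rewrite (le_trans (ler_norm _))// fejer_le_hat.
by have := cos_geN1 z; lra.
Qed.

(** For |s| <= 1 and 0 <= z <= 1 one has cos (s z) >= 1/2, so [fejer] is at least half the integral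
    of [hat] on [0, 1]; elsewhere it is nonnegative. *)
Lemma fejer_integral_gt0 : 0 < \int[mu]_z fejer z.
Proof.
pose K := \int[mu]_s hat s.
have Kgt0 : 0 < K.
  apply: (@lt_le_trans _ _ (\int[mu]_s (2^-1 * \1_`[0, 2^-1] s))).
    rewrite RintegralZl//; last exact: L1_indic.
    by rewrite Rintegral_indic; lra.
  apply: le_Rintegral => //; [exact/L1Z/L1_indic|exact: L1_hat|].
  move=> s _; rewrite indic_itv hatE; case: (boolP (0 <= s <= 2^-1)) => [/andP[s0 s1]|_].
    by rewrite ger0_norm// ifT ?mulr1; lra.
  by rewrite mulr0; case: ifP => //; rewrite subr_ge0.
have Kcos (z : R) : 0 <= z <= 1 -> K / 2 <= fejer z.
  move=> /andP[z0 z1]; rewrite /K mulrC -RintegralZl//; last exact: L1_hat.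
  apply: le_Rintegral => //; [exact/L1Z/L1_hat|exact: L1_hat_cos|].
  move=> s _; rewrite hatE; case: ifPn => [s1|_]; last by rewrite mulr0 mul0r.
  rewrite mulrC ler_wpM2l ?subr_ge0//.
  have : `|s * z| <= 1 by rewrite normrM mulr_ile1// ger0_norm.
  move=> H; rewrite cosN_norm; apply: le_trans (cos_ge_sqr (normr_ge0 _)).
  by have := normr_ge0 (s * z); move: (`|s * z|) H => y; nra.
apply: (@lt_le_trans _ _ (\int[mu]_s (K / 2 * \1_`[0, 1] s))).
  rewrite RintegralZl//; last exact: L1_indic.
  by rewrite Rintegral_indic// subr0 mulr1 divr_gt0.
apply: le_Rintegral => //; [exact/L1Z/L1_indic|exact: L1_fejer|].
move=> z _; rewrite indic_itv; case: (boolP (0 <= z <= 1)) => [/Kcos|_].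
  by rewrite mulr1.
by rewrite mulr0 fejer_ge0.
Qed.

End FejerKernel.

(** * Autocorrelations *)

Section Correlation.
Variable R : realType.
Implicit Types (f g h T : R -> R).
Local Notation mu := (@lebesgue_measure R).

Lemma ge0_integral_opp (h : R -> \bar R) : measurable_fun [set: R] h ->
  (forall x, (0 <= h x)%E) -> (\int[mu]_x h (- x)%R = \int[mu]_x h x)%E.
Proof.
move=> mh h0.
pose phi : measurableTypeR R -> measurableTypeR R := fun x => - x.
have mphi : measurable_fun [set: measurableTypeR R] phi by exact: oppr_measurable.
have E := @ge0_integral_pushforward _ _ _ _ R phi mphi mu
  setT h measurableT mh (fun x _ => h0 x).
rewrite preimage_setT in E; rewrite -[LHS]E.
by apply: eq_measure_integral => /= A mA _; exact: lebesgue_measureN.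
Qed.

Lemma L1_opp f : L1 f -> L1 (fun x => f (- x)).
Proof.
move=> /[dup] /L1_meas mf /integrableP[_ iff].
have mg : measurable_fun [set: R] (fun x : R => f (- x)).
  exact: (measurable_comp_R mf (@oppr_measurable R setT)).
apply/integrableP; split; first exact/measurable_EFinP.
rewrite -[X in (X < _)%E](_ : (\int[mu]_x `|(f x)%:E| = _)%E)//.
by rewrite -(@ge0_integral_opp (fun x => `|(f x)%:E|%E))//; exact/measurableT_comp/measurable_EFinP.
Qed.

Lemma Rintegral_opp f : L1 f -> \int[mu]_x f (- x) = \int[mu]_x f x.
Proof.
have ge0 g : (forall x, 0 <= g x) -> L1 g -> \int[mu]_x g (- x) = \int[mu]_x g x.
  move=> g0 hg; apply: EFin_inj; rewrite !EFin_Rintegral//; last exact: L1_opp.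
  by apply: ge0_integral_opp => //; exact: measurable_int hg.
move=> hf; have hn := L1_norm hf; have hd := L1D hf hn.
have E : f = fun x => (f x + `|f x|) - `|f x| by apply/funext => x; rewrite addrK.
have P x : 0 <= f x + `|f x| by have := ler_norm (- f x); rewrite normrN; lra.
rewrite E (RintegralB measurableT (L1_opp hd) (L1_opp hn)) (RintegralB measurableT hd hn).
by rewrite (ge0 (fun x => f x + `|f x|))// (ge0 (fun x => `|f x|)).
Qed.

Lemma Rintegral_odd f : L1 f -> (forall x, f (- x) = - f x) -> \int[mu]_x f x = 0.
Proof.
move=> hf fN; have := Rintegral_opp hf.
have -> : \int[mu]_x f (- x) = \int[mu]_x (-1 * f x).
  by apply: eq_Rintegral => x _; rewrite fN mulN1r.
by rewrite RintegralZl//; lra.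
Qed.

Definition corr f g z := \int[mu]_x (f x * g (x + z)).

Lemma corr_rip f g z : corr f g z = rip f (fun x => g (x + z)). Proof. by []. Qed.

Lemma corr_le f z : L2 f -> `|corr f f z| <= rip f f.
Proof.
move=> hf; have hz := L2_shift z hf.
have := rip_CS hf hz; rewrite (rip_shift z hf hf) -expr2 => H.
by rewrite -(@ler_pXn2r _ 2) ?nnegrE ?rip_ge0// real_normK ?num_real.
Qed.

(** Reduces continuity of the autocorrelation at 0 to continuity of translations in L^2. *)
Lemma corr_sub f z : L2 f ->
  rip f f - corr f f z = 2^-1 * rip (fun x => f (x + z) - f x) (fun x => f (x + z) - f x).
Proof.
move=> hf; have hz := L2_shift z hf.
have -> : (fun x => f (x + z) - f x) = (fun x => f (x + z) + -1 * f x).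
  by apply/funext => x; rewrite mulN1r.
rewrite rip_expand// (rip_shift z hf hf) corr_rip ripC; lra.
Qed.

Lemma meas2_add f : measurable_fun [set: R] f -> meas2 (fun x z : R => f (x + z)).
Proof.
move=> mf; apply: meas2_comp => //.
by apply: meas2_D; [apply: meas2_x|apply: meas2_y]; exact: measurable_id_R.
Qed.

Lemma Rintegral_shiftl f b : L1 f -> \int[mu]_x f (b + x) = \int[mu]_x f x.
Proof.
by move=> hf; rewrite -(Rintegral_shift b hf); apply: eq_Rintegral => x _; rewrite addrC.
Qed.

Lemma L1_shiftl f b : L1 f -> L1 (fun x => f (b + x)).
Proof. by move=> /(L1_shift b); under eq_fun do rewrite addrC. Qed.

(** The weight [T] will be a cosine, a sine, or the constant 1, which yields integrability of
    [corr f g]. *)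
Lemma corr_Fubini f g T : L1 f -> L2 f -> L1 g -> L2 g ->
  measurable_fun [set: R] T -> (forall z, `|T z| <= 1) ->
  L1 (fun z => corr f g z * T z) /\
  \int[mu]_x (f x * \int[mu]_z (g (x + z) * T z)) = \int[mu]_z (corr f g z * T z).
Proof.
move=> f1 f2 g1 g2 mT T1.
pose F x z := f x * (g (x + z) * T z).
have mF : meas2 F.
  apply: meas2_M; first by apply: meas2_x; exact: L1_meas.
  by apply: meas2_M; [apply: meas2_add; exact: L1_meas|exact: meas2_y].
have hgT x : L1 (fun z => g (x + z) * T z).
  have := L1_mulb (L1_shiftl x g1) mT T1.
  by under eq_fun do rewrite mulrC.
have hx x : L1 (F x) by exact: L1Z.
have hz z : L1 (fun x => F x z).
  have := L1Z (T z) (L2_mul f2 (L2_shift z g2)).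
  by rewrite /F; under eq_fun do rewrite mulrC -mulrA.
have Fn x : \int[mu]_z `|F x z| <= `|f x| * \int[mu]_z `|g z|.
  rewrite -(Rintegral_shiftl x (L1_norm g1)) -RintegralZl//; last exact: (L1_shiftl x (L1_norm g1)).
  apply: le_Rintegral => //; [exact: L1_norm|exact/L1Z/(L1_shiftl x (L1_norm g1))|].
  move=> z _; rewrite /F normrM ler_wpM2l// normrM -[leRHS]mulr1 ler_wpM2l//.
have hxz : L1 (fun x => \int[mu]_z `|F x z|).
  apply: (L1_le (g := fun x => (\int[mu]_z `|g z|) * `|f x|)); last first.
  - by move=> x; rewrite ger0_norm ?(le_trans (Fn x)) 1?mulrC//; exact: Rintegral_ge0.
  - exact/L1Z/L1_norm.
  - apply: ge0_measurable_Rint => //.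
    exact: (meas2_comp (@normr_measurable R setT) mF).
have [H1 H2] := RFubini mF hx hz hxz.
have E z : \int[mu]_x F x z = corr f g z * T z.
  rewrite /corr -RintegralZr//; last exact: L2_mul f2 (L2_shift z g2).
  by apply: eq_Rintegral => x _; rewrite /F mulrA.
split; first by move: H1; under eq_fun do rewrite E.
transitivity (\int[mu]_z \int[mu]_x F x z); last by apply: eq_Rintegral => z _; exact: E.
by rewrite -H2; apply: eq_Rintegral => x _; rewrite -RintegralZl//; exact: hgT.
Qed.

Definition cosT f (xi : R) := \int[mu]_x (f x * cos (x * xi)).
Definition sinT f (xi : R) := \int[mu]_x (f x * sin (x * xi)).

Lemma measurable_cos_mul xi : measurable_fun [set: R] (fun x : R => cos (x * xi)).
Proof.
have mz : measurable_fun [set: R] (fun s : R => s * xi) by exact: measurable_funM.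
exact: (measurable_comp_R (@measurable_cos_R R) mz).
Qed.

Lemma measurable_sin_mul xi : measurable_fun [set: R] (fun x : R => sin (x * xi)).
Proof.
have mz : measurable_fun [set: R] (fun s : R => s * xi) by exact: measurable_funM.
exact: (measurable_comp_R (@measurable_sin_R R) mz).
Qed.

Lemma L1_mulbr f (b : R -> R) K : L1 f -> measurable_fun [set: R] b ->
  (forall x, `|b x| <= K) -> L1 (fun x => f x * b x).
Proof.
by move=> hf mb bK; have := L1_mulb hf mb bK; under eq_fun do rewrite mulrC.
Qed.

Lemma L1_cosT f xi : L1 f -> L1 (fun x => f x * cos (x * xi)).
Proof. by move=> hf; apply: (L1_mulbr hf (measurable_cos_mul xi)) => x; exact: cos_max. Qed.

Lemma L1_sinT f xi : L1 f -> L1 (fun x => f x * sin (x * xi)).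
Proof. by move=> hf; apply: (L1_mulbr hf (measurable_sin_mul xi)) => x; exact: sin_max. Qed.

(** The transform of [corr f g] is conj(F) G, where F and G are the transforms of the real functions
    [f] and [g]. This is its real part; [corr_sinT] is the opposite of its imaginary part. *)
Lemma corr_cosT f g xi : L1 f -> L2 f -> L1 g -> L2 g ->
  L1 (fun z => corr f g z * cos (z * xi)) /\
  cosT f xi * cosT g xi + sinT f xi * sinT g xi = \int[mu]_z (corr f g z * cos (z * xi)).
Proof.
move=> f1 f2 g1 g2.
have [H <-] := corr_Fubini f1 f2 g1 g2 (measurable_cos_mul xi) (fun z => cos_max (z * xi)).
split=> //; have gc := L1_cosT xi g1; have gs := L1_sinT xi g1.
have E x : \int[mu]_z (g (x + z) * cos (z * xi)) =
    cos (x * xi) * cosT g xi + sin (x * xi) * sinT g xi.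
  have h1 : L1 (fun y => cos (x * xi) * (g y * cos (y * xi)) + sin (x * xi) * (g y * sin (y * xi))).
    by apply: L1D; exact: L1Z.
  rewrite /cosT /sinT -!RintegralZl// -RintegralD//; [|exact: L1Z|exact: L1Z].
  rewrite -(Rintegral_shiftl x h1); apply: eq_Rintegral => z _.
  have -> : z * xi = (x + z) * xi - x * xi by ring.
  by rewrite cosB; ring.
rewrite /cosT -RintegralZr//; last exact: L1_cosT.
rewrite [X in _ + X](_ : _ = \int[mu]_x (f x * sin (x * xi) * sinT g xi)); last first.
  by rewrite RintegralZr//; exact: L1_sinT.
rewrite -RintegralD//; last 2 first.
- have := L1Z (cosT g xi) (L1_cosT xi f1); by under eq_fun do rewrite mulrC.
- have := L1Z (sinT g xi) (L1_sinT xi f1); by under eq_fun do rewrite mulrC.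
by apply: eq_Rintegral => x _; rewrite E /cosT; ring.
Qed.

Lemma corr_sinT f g xi : L1 f -> L2 f -> L1 g -> L2 g ->
  L1 (fun z => corr f g z * sin (z * xi)) /\
  cosT f xi * sinT g xi - sinT f xi * cosT g xi = \int[mu]_z (corr f g z * sin (z * xi)).
Proof.
move=> f1 f2 g1 g2.
have [H <-] := corr_Fubini f1 f2 g1 g2 (measurable_sin_mul xi) (fun z => sin_max (z * xi)).
split=> //; have gc := L1_cosT xi g1; have gs := L1_sinT xi g1.
have E x : \int[mu]_z (g (x + z) * sin (z * xi)) =
    cos (x * xi) * sinT g xi - sin (x * xi) * cosT g xi.
  have h1 : L1 (fun y => cos (x * xi) * (g y * sin (y * xi)) - sin (x * xi) * (g y * cos (y * xi))).
    by apply: L1B; exact: L1Z.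
  rewrite /cosT /sinT -!RintegralZl// -RintegralB//; [|exact: L1Z|exact: L1Z].
  rewrite -(Rintegral_shiftl x h1); apply: eq_Rintegral => z _.
  have -> : z * xi = (x + z) * xi - x * xi by ring.
  by rewrite sinB; ring.
rewrite [X in X - _](_ : _ = \int[mu]_x (f x * cos (x * xi) * sinT g xi)); last first.
  by rewrite RintegralZr//; exact: L1_cosT.
rewrite [X in _ - X](_ : _ = \int[mu]_x (f x * sin (x * xi) * cosT g xi)); last first.
  by rewrite RintegralZr//; exact: L1_sinT.
rewrite -RintegralB//; last 2 first.
- have := L1Z (sinT g xi) (L1_cosT xi f1); by under eq_fun do rewrite mulrC.
- have := L1Z (cosT g xi) (L1_sinT xi f1); by under eq_fun do rewrite mulrC.
by apply: eq_Rintegral => x _; rewrite E; ring.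
Qed.

Lemma L1_corr f g : L1 f -> L2 f -> L1 g -> L2 g -> L1 (corr f g).
Proof.
move=> f1 f2 g1 g2.
have [] := @corr_Fubini f g (fun=> 1) f1 f2 g1 g2 (measurable_cst _) _.
  by move=> z; rewrite normr1.
by under eq_fun do rewrite mulr1.
Qed.

(** An exchange of integrals. The factor [hat (xi / B)] is what makes the double integral absolutely
    convergent, [r z * T (z * xi)] having no decay in xi. *)
Lemma hat_weight r (T : R -> R) B : 0 < B -> L1 r -> measurable_fun [set: R] T ->
  (forall x, `|T x| <= 1) ->
  L1 (fun xi => hat (xi / B) * \int[mu]_z (r z * T (z * xi))) /\
  \int[mu]_xi (hat (xi / B) * \int[mu]_z (r z * T (z * xi))) =
  \int[mu]_z (r z * \int[mu]_xi (hat (xi / B) * T (z * xi))).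
Proof.
move=> B0 hr mT T1.
have hB : L1 (fun xi => hat (xi / B)).
  have := L1_affine 0 (_ : 0 < B^-1) (@L1_hat R).
  by rewrite invr_gt0 => /(_ B0); under eq_fun do rewrite addr0 mulrC.
have mTz z : measurable_fun [set: R] (fun xi => T (z * xi)).
  have mz : measurable_fun [set: R] (fun s : R => z * s) by exact: measurable_funM.
  exact: (measurable_comp_R mT mz).
have mTxi xi : measurable_fun [set: R] (fun z => T (z * xi)).
  have mz : measurable_fun [set: R] (fun s : R => s * xi) by exact: measurable_funM.
  exact: (measurable_comp_R mT mz).
have mrT : meas2 (fun xi z : R => r z * T (z * xi)).
  apply: meas2_M; first by apply: meas2_y; exact: L1_meas.
  by apply: meas2_swap; apply: meas2_comp => //; exact: meas2_xy.
pose F (xi z : R) := hat (xi / B) * (r z * T (z * xi)).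
have mF : meas2 F by apply: meas2_M => //; apply: meas2_x; exact: L1_meas.
have hrT xi : L1 (fun z => r z * T (z * xi)) by apply: (L1_mulbr hr (mTxi xi)) => z.
have hx xi : L1 (F xi) by exact: L1Z.
have hhT z : L1 (fun xi => hat (xi / B) * T (z * xi)) by apply: (L1_mulbr hB (mTz z)) => xi.
have hz z : L1 (fun xi => F xi z).
  by have := L1Z (r z) (hhT z); rewrite /F; under eq_fun do rewrite mulrCA.
have Fn xi : \int[mu]_z `|F xi z| <= hat (xi / B) * \int[mu]_z `|r z|.
  rewrite -RintegralZl//; last exact: L1_norm.
  apply: le_Rintegral => //; [exact: L1_norm|exact/L1Z/L1_norm|].
  move=> z _; rewrite /F normrM (ger0_norm (hat_ge0 _)) ler_wpM2l ?hat_ge0//.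
  by rewrite normrM -[leRHS]mulr1 ler_wpM2l.
have hxz : L1 (fun xi => \int[mu]_z `|F xi z|).
  apply: (L1_le (g := fun xi => (\int[mu]_z `|r z|) * hat (xi / B))); last first.
  - by move=> x; rewrite ger0_norm ?(le_trans (Fn x)) 1?mulrC//; exact: Rintegral_ge0.
  - exact/L1Z.
  - apply: ge0_measurable_Rint => //.
    exact: (meas2_comp (@normr_measurable R setT) mF).
have [H1 H2] := RFubini mF hx hz hxz.
have E xi : \int[mu]_z F xi z = hat (xi / B) * \int[mu]_z (r z * T (z * xi)).
  by rewrite /F RintegralZl//; exact: hrT.
split.
  apply: (L1_le (g := fun xi => (\int[mu]_z `|r z|) * hat (xi / B))).
  - apply: measurable_funM; first exact: L1_meas.
    apply: (measurable_Rint mrT (L1_norm hr)) => xi z.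
    by rewrite normrM -[leRHS]mulr1 ler_wpM2l.
  - exact: L1Z.
  - move=> xi; rewrite normrM (ger0_norm (hat_ge0 _)) mulrC ler_wpM2r ?hat_ge0//.
    rewrite (le_trans (le_normr_Rintegral _ (hrT xi)))//.
    apply: le_Rintegral => //; [exact: L1_norm|exact: L1_norm|].
    by move=> z _; rewrite normrM -[leRHS]mulr1 ler_wpM2l.
transitivity (\int[mu]_xi \int[mu]_z F xi z); first by apply: eq_Rintegral => xi _; rewrite E.
rewrite H2; apply: eq_Rintegral => z _; rewrite -RintegralZl//; last exact: hhT.
by apply: eq_Rintegral => xi _; rewrite /F mulrCA.
Qed.

Lemma hat_dilate_cos B z : 0 < B -> \int[mu]_xi (hat (xi / B) * cos (z * xi)) = B * fejer (B * z).
Proof.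
move=> B0; have h : L1 (fun xi => hat (xi / B) * cos (z * xi)).
  have := L1_affine 0 (_ : 0 < B^-1) (L1_hat_cos (B * z)).
  rewrite invr_gt0 => /(_ B0); under eq_fun do rewrite addr0.
  congr L1; apply/funext => x; congr (hat _ * cos _); first by rewrite mulrC.
  by have := gt_eqF B0 => /negbT ?; field.
rewrite (Rintegral_affine 0 B0 h) /fejer; congr (_ * _); apply: eq_Rintegral => s _.
have := gt_eqF B0 => /negbT ?.
by congr (hat _ * cos _); field.
Qed.

Lemma hat_dilate_sin B z : 0 < B -> \int[mu]_xi (hat (xi / B) * sin (z * xi)) = 0.
Proof.
move=> B0; apply: Rintegral_odd => [|x]; last by rewrite mulNr hatN mulrN sinN mulrN.
have hB : L1 (fun xi => hat (xi / B)).
  have := L1_affine 0 (_ : 0 < B^-1) (@L1_hat R).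
  by rewrite invr_gt0 => /(_ B0); under eq_fun do rewrite addr0 mulrC.
have mz : measurable_fun [set: R] (fun s : R => z * s) by exact: measurable_funM.
apply: (L1_mulbr hB (measurable_comp_R (@measurable_sin_R R) mz)) => x; exact: sin_max.
Qed.

(** The dilates of [fejer] concentrate at 0, where the autocorrelation is [rip f f]. Rescaling z
    moves the dilation onto [corr f f], and [rip f f * fejer z] dominates. *)
Lemma corr_fejer_cvg f : L1 f -> L2 f ->
  \int[mu]_z (corr f f z * (n.+1%:R * fejer (n.+1%:R * z))) @[n --> \oo] -->
  rip f f * \int[mu]_z fejer z.
Proof.
move=> f1 f2; have hr := L1_corr f1 f2 f1 f2.
have mr := L1_meas hr.
have mrn n : measurable_fun [set: R] (fun z : R => corr f f (z / n.+1%:R)).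
  have mz : measurable_fun [set: R] (fun s : R => s / n.+1%:R) by exact: measurable_funM.
  exact: (measurable_comp_R mr mz).
have hn n : L1 (fun z => corr f f (z / n.+1%:R) * fejer z).
  by apply: (L1_mulb (@L1_fejer R) (mrn n)) => z; exact: corr_le.
have E n : \int[mu]_z (corr f f z * (n.+1%:R * fejer (n.+1%:R * z))) =
    \int[mu]_z (corr f f (z / n.+1%:R) * fejer z).
  have n0 : 0 < n.+1%:R :> R by rewrite ltr0n.
  have n1 : n.+1%:R != 0 :> R by rewrite gt_eqF.
  rewrite (Rintegral_affine 0 n0 (hn n)) -RintegralZl//; last exact: (L1_affine 0 n0 (hn n)).
  apply: eq_Rintegral => z _; rewrite addr0.
  have -> : n.+1%:R * z / n.+1%:R = z by field.
  by ring.
under eq_fun do rewrite E.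
rewrite -RintegralZl//; last exact: L1_fejer.
apply: (@Rdominated_cvg _ _ _ (fun z => rip f f * fejer z)).
- by move=> n; exact: L1_meas.
- by apply: L1_meas; apply: L1Z; exact: L1_fejer.
- move=> z; apply: cvgM; last exact: cvg_cst.
  have -> : (fun n => corr f f (z / n.+1%:R)) = (fun n => rip f f -
      2^-1 * rip (fun x => f (x + z / n.+1%:R) - f x) (fun x => f (x + z / n.+1%:R) - f x)).
    by apply/funext => n; rewrite -corr_sub// subKr.
  rewrite -[X in _ --> X]subr0 -[X in _ --> _ - X](mulr0 2^-1).
  apply: cvgB; first exact: cvg_cst.
  apply: cvgM; first exact: cvg_cst.
  apply: (L2_transl_cont f2 (B := `|z|)).
    move=> n; rewrite normrM ler_piMr// ger0_norm ?invr_ge0// invf_le1 ?ler1n//.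
  rewrite -[X in _ --> X](mulr0 z); apply: cvgM; first exact: cvg_cst.
  exact: cvg_harmonic.
- by apply: L1Z; exact: L1_fejer.
- move=> n z; rewrite normrM (ger0_norm (fejer_ge0 _)) ler_wpM2r ?fejer_ge0//; exact: corr_le.
Qed.

End Correlation.

(** * Square integrable complex functions *)

Section ComplexL2.
Variable R : realType.
Implicit Types (f g h : R -> R[i]) (a b : R) (c : R[i]).
Local Notation mu := (@lebesgue_measure R).
Local Notation Re := (@complex.Re R).
Local Notation Im := (@complex.Im R).

Lemma Re_add (x y : R[i]) : Re (x + y) = Re x + Re y. Proof. by case: x; case: y. Qed.
Lemma Im_add (x y : R[i]) : Im (x + y) = Im x + Im y. Proof. by case: x; case: y. Qed.
Lemma Re_opp (x : R[i]) : Re (- x) = - Re x. Proof. by case: x. Qed.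
Lemma Im_opp (x : R[i]) : Im (- x) = - Im x. Proof. by case: x. Qed.
Lemma Re_mul (x y : R[i]) : Re (x * y) = Re x * Re y - Im x * Im y.
Proof. by case: x; case: y. Qed.
Lemma Im_mul (x y : R[i]) : Im (x * y) = Re x * Im y + Im x * Re y.
Proof. by case: x; case: y. Qed.

Lemma complex_eq (x y : R[i]) : Re x = Re y -> Im x = Im y -> x = y.
Proof. by case: x; case: y => ? ? ? ? /= -> ->. Qed.

Definition sqn (z : R[i]) : R := Re z ^+ 2 + Im z ^+ 2.

Lemma sqn_ge0 z : 0 <= sqn z. Proof. by rewrite addr_ge0 ?sqr_ge0. Qed.

Lemma normc_sqr (z : R[i]) : Normc.normc z ^+ 2 = sqn z.
Proof. by case: z => a b /=; rewrite sqr_sqrtr// addr_ge0 ?sqr_ge0. Qed.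

Lemma sqnM (x y : R[i]) : sqn (x * y) = sqn x * sqn y.
Proof. by rewrite /sqn Re_mul Im_mul; ring. Qed.

Lemma sqnN (x : R[i]) : sqn (- x) = sqn x.
Proof. by rewrite /sqn Re_opp Im_opp !sqrrN. Qed.

Lemma sqn_real (x : R) : sqn x%:C = x ^+ 2.
Proof. by rewrite /sqn /= expr0n addr0. Qed.

Definition CL1 f := L1 (Re \o f) /\ L1 (Im \o f).
Definition CL2 f := L2 (Re \o f) /\ L2 (Im \o f).

Lemma is_L2P f : is_L2 f <-> CL2 f.
Proof. by split=> -[/L2P ? /L2P ?]. Qed.

Lemma L2_eq (f g : R -> R) : f =1 g -> L2 f -> L2 g.
Proof. by move=> /funext ->. Qed.

Lemma L1_eq (f g : R -> R) : f =1 g -> L1 f -> L1 g.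
Proof. by move=> /funext ->. Qed.

Lemma CL2D f g : CL2 f -> CL2 g -> CL2 (fun x => f x + g x).
Proof.
move=> [f1 f2] [g1 g2]; split.
  by apply: L2_eq (L2D f1 g1) => x; rewrite /= Re_add.
by apply: L2_eq (L2D f2 g2) => x; rewrite /= Im_add.
Qed.

Lemma CL1D f g : CL1 f -> CL1 g -> CL1 (fun x => f x + g x).
Proof.
move=> [f1 f2] [g1 g2]; split.
  by apply: L1_eq (L1D f1 g1) => x; rewrite /= Re_add.
by apply: L1_eq (L1D f2 g2) => x; rewrite /= Im_add.
Qed.

Definition cbounded (b : R -> R[i]) K :=
  [/\ measurable_fun [set: R] (Re \o b), measurable_fun [set: R] (Im \o b) &
    forall x, `|Re (b x)| <= K /\ `|Im (b x)| <= K].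

Lemma CL2_mulb f (b : R -> R[i]) K : CL2 f -> cbounded b K -> CL2 (fun x => b x * f x).
Proof.
move=> [f1 f2] [m1 m2 bK].
have B1 x : `|Re (b x)| <= K by case: (bK x).
have B2 x : `|Im (b x)| <= K by case: (bK x).
split.
  apply: (L2_eq (f := fun x => Re (b x) * Re (f x) - Im (b x) * Im (f x))) => [x|].
    by rewrite /= Re_mul.
  by apply: L2B; [exact: (L2_mulb f1 m1 B1)|exact: (L2_mulb f2 m2 B2)].
apply: (L2_eq (f := fun x => Re (b x) * Im (f x) + Im (b x) * Re (f x))) => [x|].
  by rewrite /= Im_mul.
by apply: L2D; [exact: (L2_mulb f2 m1 B1)|exact: (L2_mulb f1 m2 B2)].
Qed.

Lemma CL1_mulb f (b : R -> R[i]) K : CL1 f -> cbounded b K -> CL1 (fun x => b x * f x).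
Proof.
move=> [f1 f2] [m1 m2 bK].
have B1 x : `|Re (b x)| <= K by case: (bK x).
have B2 x : `|Im (b x)| <= K by case: (bK x).
split.
  apply: (L1_eq (f := fun x => Re (b x) * Re (f x) - Im (b x) * Im (f x))) => [x|].
    by rewrite /= Re_mul.
  by apply: L1B; [exact: (L1_mulb f1 m1 B1)|exact: (L1_mulb f2 m2 B2)].
apply: (L1_eq (f := fun x => Re (b x) * Im (f x) + Im (b x) * Re (f x))) => [x|].
  by rewrite /= Im_mul.
by apply: L1D; [exact: (L1_mulb f2 m1 B1)|exact: (L1_mulb f1 m2 B2)].
Qed.

Lemma cbounded_cst c : cbounded (fun=> c) (Num.max `|Re c| `|Im c|).
Proof.
split; [exact: measurable_cst|exact: measurable_cst|move=> x].
by rewrite !le_max !lexx orbT.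
Qed.

Lemma CL2Z c f : CL2 f -> CL2 (fun x => c * f x).
Proof. by move=> hf; exact: CL2_mulb hf (cbounded_cst c). Qed.

Lemma CL1Z c f : CL1 f -> CL1 (fun x => c * f x).
Proof. by move=> hf; exact: CL1_mulb hf (cbounded_cst c). Qed.

Lemma CL2N f : CL2 f -> CL2 (fun x => - f x).
Proof. by move=> /(CL2Z (-1)); under eq_fun do rewrite mulN1r. Qed.

Lemma CL2B f g : CL2 f -> CL2 g -> CL2 (fun x => f x - g x).
Proof. by move=> hf /CL2N; exact: CL2D. Qed.

Lemma CL2_0 : CL2 (fun _ => 0).
Proof. by split; exact: L2_0. Qed.

Lemma CL2_shift b f : CL2 f -> CL2 (fun x => f (x + b)).
Proof. by move=> [h1 h2]; split; [exact: (L2_shift b h1)|exact: (L2_shift b h2)]. Qed.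

Lemma CL1_shift b f : CL1 f -> CL1 (fun x => f (x + b)).
Proof. by move=> [h1 h2]; split; [exact: (L1_shift b h1)|exact: (L1_shift b h2)]. Qed.

(** The real part of the Hermitian product, which is all that the energy estimates need. *)
Definition ip f g := rip (Re \o f) (Re \o g) + rip (Im \o f) (Im \o g).
Definition nsq f := ip f f.

Lemma ipC f g : ip f g = ip g f.
Proof. by rewrite /ip ripC [X in _ + X]ripC. Qed.

Lemma ip_congl f f' g : f =1 f' -> ip f g = ip f' g. Proof. by move=> /funext ->. Qed.
Lemma nsq_eq f g : f =1 g -> nsq f = nsq g. Proof. by move=> /funext ->. Qed.

Lemma ipDl f g h : CL2 f -> CL2 g -> CL2 h -> ip (fun x => f x + g x) h = ip f h + ip g h.
Proof.
move=> [f1 f2] [g1 g2] [h1 h2]; rewrite /ip addrACA -(ripDl f1 g1 h1) -(ripDl f2 g2 h2).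
by congr (rip _ _ + rip _ _); apply/funext => x /=; rewrite ?Re_add ?Im_add.
Qed.

Lemma ipZl (a : R) f h : CL2 f -> CL2 h -> ip (fun x => a%:C * f x) h = a * ip f h.
Proof.
move=> [f1 f2] [h1 h2]; rewrite /ip mulrDr -(ripZl a f1 h1) -(ripZl a f2 h2).
by congr (rip _ _ + rip _ _); apply/funext => x /=; rewrite ?Re_mul ?Im_mul /= ?mul0r ?subr0 ?addr0.
Qed.

Lemma ip_shift f g b : CL2 f -> CL2 g ->
  ip (fun x => f (x + b)) (fun x => g (x + b)) = ip f g.
Proof.
by move=> [f1 f2] [g1 g2]; rewrite /ip -(rip_shift b f1 g1) -(rip_shift b f2 g2).
Qed.

Lemma nsq_ge0 f : 0 <= nsq f. Proof. by rewrite addr_ge0 ?rip_ge0. Qed.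

Lemma L1_sqn f : CL2 f -> L1 (fun x => sqn (f x)).
Proof. by move=> [f1 f2]; apply: L1D; exact: L2_sqr. Qed.

Lemma nsqE f : CL2 f -> nsq f = \int[mu]_x sqn (f x).
Proof.
move=> [f1 f2]; rewrite /nsq /ip /rip.
rewrite -(RintegralD measurableT (L2_mul f1 f1) (L2_mul f2 f2)).
by apply: eq_Rintegral => x _; rewrite /sqn /= !expr2.
Qed.

Lemma nsq_le f g : CL2 f -> CL2 g -> (forall x, sqn (f x) <= sqn (g x)) -> nsq f <= nsq g.
Proof.
move=> hf hg fg; rewrite !nsqE//; apply: (le_Rintegral measurableT (L1_sqn hf) (L1_sqn hg)) => x _.
exact: fg.
Qed.

Lemma nsq_expand f g (t : R) : CL2 f -> CL2 g ->
  nsq (fun x => f x + t%:C * g x) = nsq f + 2 * t * ip f g + t ^+ 2 * nsq g.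
Proof.
move=> [f1 f2] [g1 g2]; rewrite /nsq /ip.
rewrite (_ : _ \o _ = fun x => (Re \o f) x + t * (Re \o g) x); last first.
  by apply/funext => x /=; rewrite Re_add Re_mul /= mul0r subr0.
rewrite (_ : Im \o _ = fun x => (Im \o f) x + t * (Im \o g) x); last first.
  by apply/funext => x /=; rewrite Im_add Im_mul /= mul0r addr0.
rewrite !rip_expand//; ring.
Qed.

Lemma ip_CS f g : CL2 f -> CL2 g -> ip f g ^+ 2 <= nsq f * nsq g.
Proof.
move=> hf hg; apply: quadratic_discr; first exact: nsq_ge0.
by move=> t; rewrite -nsq_expand// nsq_ge0.
Qed.

Definition nrm f := Num.sqrt (nsq f).

Lemma nrm_ge0 f : 0 <= nrm f. Proof. exact: sqrtr_ge0. Qed.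
Lemma nrm_sqr f : nrm f ^+ 2 = nsq f. Proof. by rewrite sqr_sqrtr// nsq_ge0. Qed.
Lemma nrm_eq f g : f =1 g -> nrm f = nrm g. Proof. by move=> /funext ->. Qed.

Lemma nrmD f g : CL2 f -> CL2 g -> nrm (fun x => f x + g x) <= nrm f + nrm g.
Proof.
move=> hf hg; rewrite -(@ler_pXn2r _ 2) ?nnegrE ?addr_ge0 ?nrm_ge0// sqrrD !nrm_sqr.
rewrite (nsq_eq (g := fun x => f x + 1%:C * g x)); last by move=> x; rewrite mul1r.
rewrite nsq_expand// expr1n mul1r mulr1 lerD2r lerD2l -[leRHS]mulr_natl ler_pM2l//.
rewrite (le_trans (ler_norm _))// -(@ler_pXn2r _ 2) ?nnegrE ?mulr_ge0 ?nrm_ge0//.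
by rewrite real_normK ?num_real// exprMn !nrm_sqr ip_CS.
Qed.

Lemma nsqM c f : CL2 f -> nsq (fun x => c * f x) = sqn c * nsq f.
Proof.
move=> hf; rewrite !nsqE//; last exact: CL2Z.
by rewrite -RintegralZl//; [apply: eq_Rintegral => x _; rewrite sqnM|exact: L1_sqn].
Qed.

Lemma nrmN f : CL2 f -> nrm (fun x => - f x) = nrm f.
Proof.
move=> hf; rewrite (nrm_eq (g := fun x => -1 * f x)); last by move=> x; rewrite mulN1r.
by rewrite /nrm nsqM// sqnN sqn_real expr1n mul1r.
Qed.

Lemma nrmZ (a : R) f : CL2 f -> nrm (fun x => a%:C * f x) = `|a| * nrm f.
Proof.
by move=> hf; rewrite /nrm nsqM// sqn_real sqrtrM ?sqr_ge0// sqrtr_sqr.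
Qed.

Lemma nrmB f g : CL2 f -> CL2 g -> nrm (fun x => f x - g x) <= nrm f + nrm g.
Proof. by move=> hf hg; rewrite -(nrmN hg); exact: nrmD hf (CL2N hg). Qed.

Lemma nrm_shift b f : CL2 f -> nrm (fun x => f (x + b)) = nrm f.
Proof. by move=> hf; rewrite /nrm /nsq ip_shift. Qed.

Lemma nrm_le f g : CL2 f -> CL2 g -> (forall x, sqn (f x) <= sqn (g x)) -> nrm f <= nrm g.
Proof. by move=> hf hg fg; rewrite ler_wsqrtr// nsq_le. Qed.

Lemma nrm_distr f g : CL2 f -> CL2 g -> `|nrm f - nrm g| <= nrm (fun x => f x - g x).
Proof.
move=> hf hg; have hfg := CL2B hf hg.
apply/ler_normlP; rewrite opprB; split; rewrite lerBlDr.
  rewrite -(nrmN hfg); apply: le_trans (nrmD (CL2N hfg) hf).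
  by rewrite le_eqVlt; apply/orP; left; apply/eqP; apply: nrm_eq => x; ring.
apply: le_trans (nrmD hfg hg).
by rewrite le_eqVlt; apply/orP; left; apply/eqP; apply: nrm_eq => x; ring.
Qed.

Lemma nrm_sum (I : Type) (s : seq I) (F : I -> R -> R[i]) :
  (forall i, CL2 (F i)) -> CL2 (fun x => \sum_(i <- s) F i x) /\
  nrm (fun x => \sum_(i <- s) F i x) <= \sum_(i <- s) nrm (F i).
Proof.
move=> hF; elim: s => [|i s [h1 h2]].
  under [X in CL2 X]eq_fun do rewrite big_nil; split; first exact: CL2_0.
  rewrite big_nil (nrm_eq (g := fun=> 0%:C * 0)); last by move=> x; rewrite big_nil mul0r.
  by rewrite (nrmZ 0 CL2_0) normr0 mul0r.
under [X in CL2 X]eq_fun do rewrite big_cons; split; first exact: CL2D.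
rewrite (nrm_eq (g := fun x => F i x + \sum_(i <- s) F i x)); last by move=> x; rewrite big_cons.
by rewrite big_cons (le_trans (nrmD _ _))// lerD2l.
Qed.

End ComplexL2.

(** * Plancherel's formula *)

Section Plancherel.
Variable R : realType.
Implicit Types (f g h : R -> R[i]).
Local Notation mu := (@lebesgue_measure R).
Local Notation Re := (@complex.Re R).
Local Notation Im := (@complex.Im R).

Definition FT f (xi : R) := cintegral setT (fun x => f x * cexp (- ('i%C * (x * xi)%:C))).

Lemma cexp_imag (y : R) : cexp (- ('i%C * y%:C)) = cos y -i* sin y.
Proof.
have -> : - ('i%C * y%:C) = 0 -i* y by apply: complex_eq => /=; ring.
by rewrite /cexp /= expR0 cosN sinN; apply: complex_eq => /=; ring.
Qed.

Lemma FT_Re f xi : CL1 f -> Re (FT f xi) = cosT (Re \o f) xi + sinT (Im \o f) xi.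
Proof.
move=> [h1 h2]; rewrite /FT /cintegral /= /cosT /sinT -RintegralD//; [|exact: L1_cosT|exact: L1_sinT].
by apply: eq_Rintegral => x _; rewrite Re_mul cexp_imag /=; ring.
Qed.

Lemma FT_Im f xi : CL1 f -> Im (FT f xi) = cosT (Im \o f) xi - sinT (Re \o f) xi.
Proof.
move=> [h1 h2]; rewrite /FT /cintegral /= /cosT /sinT -RintegralB//; [|exact: L1_cosT|exact: L1_sinT].
by apply: eq_Rintegral => x _; rewrite Im_mul cexp_imag /=; ring.
Qed.

(** By [corr_sinT] the cross term is the sine transform of a correlation; being odd in xi, it
    disappears when integrated against the even function [hat]. *)
Lemma FT_sqn f xi : CL1 f -> sqn (FT f xi) =
  (cosT (Re \o f) xi * cosT (Re \o f) xi + sinT (Re \o f) xi * sinT (Re \o f) xi) +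
  (cosT (Im \o f) xi * cosT (Im \o f) xi + sinT (Im \o f) xi * sinT (Im \o f) xi) +
  2 * (cosT (Re \o f) xi * sinT (Im \o f) xi - sinT (Re \o f) xi * cosT (Im \o f) xi).
Proof.
move=> h; rewrite /sqn (FT_Re xi h) (FT_Im xi h).
move: (cosT _ xi) (sinT _ xi) (cosT _ xi) (sinT _ xi) => c1 s1 c2 s2.
ring.
Qed.

Lemma measurable_cosT (f : R -> R) : L1 f -> measurable_fun [set: R] (cosT f).
Proof.
move=> hf; apply: (measurable_Rint (F := fun xi x => f x * cos (x * xi)) _ (L1_norm hf)).
  by apply: meas2_M; [apply: meas2_y; exact: L1_meas|apply: meas2_swap; exact: meas2_cos].
by move=> xi x; rewrite normrM -[leRHS]mulr1 ler_wpM2l ?cos_max.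
Qed.

Lemma measurable_sinT (f : R -> R) : L1 f -> measurable_fun [set: R] (sinT f).
Proof.
move=> hf; apply: (measurable_Rint (F := fun xi x => f x * sin (x * xi)) _ (L1_norm hf)).
  by apply: meas2_M; [apply: meas2_y; exact: L1_meas|apply: meas2_swap; exact: meas2_sin].
by move=> xi x; rewrite normrM -[leRHS]mulr1 ler_wpM2l ?sin_max.
Qed.

(* Its value is 2 pi, but only its positivity matters. *)
Definition kappa : R := \int[mu]_z fejer z.

Lemma kappa_gt0 : 0 < kappa. Proof. exact: fejer_integral_gt0. Qed.

Lemma FT_hat f n : CL1 f -> CL2 f ->
  L1 (fun xi => hat (xi / n.+1%:R) * sqn (FT f xi)) /\
  \int[mu]_xi (hat (xi / n.+1%:R) * sqn (FT f xi)) =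
  \int[mu]_z (corr (Re \o f) (Re \o f) z * (n.+1%:R * fejer (n.+1%:R * z))) +
  \int[mu]_z (corr (Im \o f) (Im \o f) z * (n.+1%:R * fejer (n.+1%:R * z))).
Proof.
move=> [a1 b1] [a2 b2]; have B0 : 0 < n.+1%:R :> R by rewrite ltr0n.
have key (h a b c : R) : h * (a + b + 2 * c) = (h * a + h * b) + 2 * (h * c) by ring.
have [A1 A2] := hat_weight B0 (L1_corr a1 a2 a1 a2) (@measurable_cos_R R) (@cos_max R).
have [B1 B2] := hat_weight B0 (L1_corr b1 b2 b1 b2) (@measurable_cos_R R) (@cos_max R).
have [C1 C2] := hat_weight B0 (L1_corr a1 a2 b1 b2) (@measurable_sin_R R) (@sin_max R).
pose a xi := hat (xi / n.+1%:R) * \int[mu]_z (corr (Re \o f) (Re \o f) z * cos (z * xi)).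
pose b xi := hat (xi / n.+1%:R) * \int[mu]_z (corr (Im \o f) (Im \o f) z * cos (z * xi)).
pose c xi := hat (xi / n.+1%:R) * \int[mu]_z (corr (Re \o f) (Im \o f) z * sin (z * xi)).
have E xi : hat (xi / n.+1%:R) * sqn (FT f xi) = (a xi + b xi) + 2 * c xi.
  rewrite /a /b /c.
  have [_ <-] := corr_cosT xi a1 a2 a1 a2.
  have [_ <-] := corr_cosT xi b1 b2 b1 b2.
  have [_ <-] := corr_sinT xi a1 a2 b1 b2.
  by rewrite (FT_sqn _ (conj a1 b1)); exact: key.
have A : L1 a by exact: A1.
have B : L1 b by exact: B1.
have C : L1 c by exact: C1.
have c0 : \int[mu]_xi c xi = 0.
  rewrite C2 -[RHS](mulr0 (\int[mu]_z (corr (Re \o f) (Im \o f) z))).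
  rewrite -(RintegralZr 0 measurableT (L1_corr a1 a2 b1 b2)).
  by apply: eq_Rintegral => z _; rewrite hat_dilate_sin.
have a0 : \int[mu]_xi a xi =
    \int[mu]_z (corr (Re \o f) (Re \o f) z * (n.+1%:R * fejer (n.+1%:R * z))).
  by rewrite A2; apply: eq_Rintegral => z _; rewrite hat_dilate_cos.
have b0 : \int[mu]_xi b xi =
    \int[mu]_z (corr (Im \o f) (Im \o f) z * (n.+1%:R * fejer (n.+1%:R * z))).
  by rewrite B2; apply: eq_Rintegral => z _; rewrite hat_dilate_cos.
rewrite -a0 -b0; clear a0 b0 A1 B1 C1 A2 B2 C2.
move: a b c E A B C c0 => a b c E A B C c0.
split; first exact: (L1_eq (fun xi => esym (E xi)) (L1D (L1D A B) (L1Z 2 C))).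
transitivity (\int[mu]_xi ((a xi + b xi) + 2 * c xi)).
  by apply: eq_Rintegral => xi _; exact: E.
rewrite (RintegralD measurableT (L1D A B) (L1Z 2 C)) (RintegralD measurableT A B).
by rewrite (RintegralZl 2 measurableT C) c0 mulr0 addr0.
Qed.

Lemma hat_nondecreasing (xi : R) m n : (m <= n)%N -> hat (xi / m.+1%:R) <= hat (xi / n.+1%:R).
Proof.
move=> mn; have m0 : 0 < m.+1%:R :> R by rewrite ltr0n.
have n0 : 0 < n.+1%:R :> R by rewrite ltr0n.
have mnR : m.+1%:R <= n.+1%:R :> R by rewrite ler_nat.
have H : `|xi / n.+1%:R| <= `|xi / m.+1%:R|.
  by rewrite !normrM ler_wpM2l// !normfV !normr_nat lef_pV2 ?posrE.
rewrite [leLHS]hatE; case: ifP => [xm|_]; last exact: hat_ge0.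
by rewrite hatE ifT ?(le_trans H)// lerD2l lerN2.
Qed.

Lemma hat_cvg (xi : R) : hat (xi / n.+1%:R) @[n --> \oo] --> (1 : R).
Proof.
have H : xi / n.+1%:R @[n --> \oo] --> (0 : R).
  rewrite -[X in _ --> X](mulr0 xi); apply: cvgM; first exact: cvg_cst.
  exact: cvg_harmonic.
have : 1 - `|xi / n.+1%:R| @[n --> \oo] --> (1 : R).
  rewrite -[X in _ --> X]subr0; apply: cvgB; first exact: cvg_cst.
  by rewrite -[X in _ --> X](@normr0 R R); exact: cvg_norm.
apply: cvg_trans; apply: near_eq_cvg; near=> n; rewrite hatE ifT//.
near: n; move/cvgrPdist_le : H => /(_ 1 ltr01).
by apply: filterS => n; rewrite sub0r normrN.
Unshelve. all: by end_near. Qed.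

(** The integrals of |FT f|^2 weighted by [hat (xi / n.+1%:R)] tend to [kappa * nsq f] by
    [corr_fejer_cvg]. The weights increase to 1, so monotone convergence gives the value of the full
    integral and its finiteness at once. *)
Theorem plancherel f : CL1 f -> CL2 f -> CL2 (FT f) /\ nsq (FT f) = kappa * nsq f.
Proof.
move=> h1 h2; have [a1 b1] := h1; have [a2 b2] := h2.
have mRe : measurable_fun [set: R] (Re \o FT f).
  rewrite (_ : _ \o _ = fun xi => cosT (Re \o f) xi + sinT (Im \o f) xi); last first.
    by apply/funext => xi /=; exact: FT_Re.
  by apply: measurable_funD; [exact: measurable_cosT|exact: measurable_sinT].
have mIm : measurable_fun [set: R] (Im \o FT f).
  rewrite (_ : _ \o _ = fun xi => cosT (Im \o f) xi - sinT (Re \o f) xi); last first.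
    by apply/funext => xi /=; exact: FT_Im.
  by apply: measurable_funB; [exact: measurable_cosT|exact: measurable_sinT].
have mP : measurable_fun [set: R] (fun xi => sqn (FT f xi)).
  by apply: measurable_funD; exact: measurable_funX.
have lim : \int[mu]_xi (hat (xi / n.+1%:R) * sqn (FT f xi)) @[n --> \oo] --> kappa * nsq f.
  under eq_fun do rewrite (FT_hat _ h1 h2).2.
  rewrite /nsq /ip mulrDr ![kappa * _]mulrC.
  by apply: cvgD; exact: corr_fejer_cvg.
have intP : (\int[mu]_xi (sqn (FT f xi))%:E = (kappa * nsq f)%:E)%E.
  pose G n xi := (hat (xi / n.+1%:R) * sqn (FT f xi))%:E.
  have := @monotone_convergence _ _ _ mu setT measurableT G.
  have mG n : measurable_fun [set: R] (G n) by exact: (measurable_int mu (FT_hat n h1 h2).1).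
  have G0 n x : setT x -> (0 <= G n x)%E.
    by move=> _; rewrite lee_fin mulr_ge0 ?hat_ge0 ?sqn_ge0.
  have Gnd x : setT x -> {homo G ^~ x : n m / (n <= m)%N >-> (n <= m)%E}.
    by move=> _ m n mn; rewrite lee_fin ler_wpM2r ?sqn_ge0// hat_nondecreasing.
  move=> /(_ mG G0 Gnd).
  have -> : (\int[mu]_x limn (G^~ x) = \int[mu]_xi (sqn (FT f xi))%:E)%E.
    apply: eq_integral => x _; apply: cvg_lim => //; apply: cvg_EFin; first exact: nearW.
    rewrite -[X in _ --> X]mul1r; apply: cvgM; [exact: hat_cvg|exact: cvg_cst].
  move=> ->; apply: cvg_lim => //.
  rewrite (_ : (fun n => _) = (fun n => (\int[mu]_xi (hat (xi / n.+1%:R) * sqn (FT f xi)))%:E)).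
    by apply: cvg_EFin => //; exact: nearW.
  by apply/funext => n; rewrite (EFin_Rintegral (FT_hat n h1 h2).1 measurableT).
have iP : L1 (fun xi => sqn (FT f xi)).
  apply/integrableP; split; first by apply/measurable_EFinP; exact: mP.
  by under eq_integral => x _ do rewrite /= ger0_norm ?sqn_ge0//; rewrite intP ltry.
have hF : CL2 (FT f).
  split; split=> //; apply: (L1_le _ iP) => [|xi]; try exact: measurable_funX.
    by rewrite ger0_norm ?sqr_ge0// lerDl sqr_ge0.
  by rewrite ger0_norm ?sqr_ge0// lerDr sqr_ge0.
by split=> //; rewrite nsqE// /Rintegral intP.
Qed.

End Plancherel.

(** * Fourier pairs *)

Section FourierPairs.
Variable R : realType.
Implicit Types (f g h : R -> R[i]).
Local Notation mu := (@lebesgue_measure R).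
Local Notation Re := (@complex.Re R).
Local Notation Im := (@complex.Im R).

Lemma L2norm_nrm f : CL2 f -> L2norm f = (nrm f)%:E.
Proof.
move=> hf; rewrite /L2norm unlock.
rewrite (_ : (\int[mu]_x _ = (nsq f)%:E)%E).
  by rewrite poweR_EFin /nrm powR12_sqrt ?nsq_ge0.
rewrite nsqE// EFin_Rintegral//; last exact: L1_sqn.
apply: eq_integral => x _.
have -> : (`|(Normc.normc (f x))%:E| `^ 2 = (`|Normc.normc (f x)| `^ 2)%:E)%E.
  by rewrite -poweR_EFin.
by rewrite powR_mulrn// real_normK ?num_real// normc_sqr.
Qed.

Lemma Re_realM (a : R) (z : R[i]) : Re (a%:C * z) = a * Re z.
Proof. by rewrite Re_mul /= mul0r subr0. Qed.

Lemma Im_realM (a : R) (z : R[i]) : Im (a%:C * z) = a * Im z.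
Proof. by rewrite Im_mul /= mul0r addr0. Qed.

Definition ccut (M : R) f := fun x => (\1_`[- M, M] x)%:C * f x.

Lemma Re_ccut M f : Re \o ccut M f = cutoff M (Re \o f).
Proof. by apply/funext => x /=; rewrite Re_mul /= mul0r subr0. Qed.

Lemma Im_ccut M f : Im \o ccut M f = cutoff M (Im \o f).
Proof. by apply/funext => x /=; rewrite Im_mul /= mul0r addr0. Qed.

Lemma CL2_ccut M f : CL2 f -> CL2 (ccut M f).
Proof. by move=> [h1 h2]; split; rewrite ?Re_ccut ?Im_ccut; exact: L2_cut. Qed.

Lemma CL1_ccut M f : CL2 f -> CL1 (ccut M f).
Proof. by move=> [h1 h2]; split; rewrite ?Re_ccut ?Im_ccut; exact: L1_cut. Qed.

Lemma cvg_nrm0 (F : nat -> R -> R[i]) : nsq (F n) @[n --> \oo] --> 0 -> nrm (F n) @[n --> \oo] --> 0.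
Proof.
move=> H; rewrite -[X in _ --> X](sqrtr0 R).
by apply: (cvg_comp _ _ H); exact: sqrt_continuous.
Qed.

Lemma nrm_sub_ccut_cvg f : CL2 f -> nrm (fun x => f x - ccut n%:R f x) @[n --> \oo] --> 0.
Proof.
move=> [h1 h2]; apply: cvg_nrm0; rewrite /nsq /ip.
have H1 := rip_sub_cut_cvg h1; have H2 := rip_sub_cut_cvg h2.
rewrite -[X in _ --> X]addr0.
have -> : (fun n => rip (Re \o (fun x => f x - ccut n%:R f x)) (Re \o (fun x => f x - ccut n%:R f x)) +
    rip (Im \o (fun x => f x - ccut n%:R f x)) (Im \o (fun x => f x - ccut n%:R f x))) =
  (fun n => rip (fun x => (Re \o f) x - cutoff n%:R (Re \o f) x) (fun x => (Re \o f) x - cutoff n%:R (Re \o f) x) +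
   rip (fun x => (Im \o f) x - cutoff n%:R (Im \o f) x) (fun x => (Im \o f) x - cutoff n%:R (Im \o f) x)).
  apply/funext => n; rewrite -Re_ccut -Im_ccut.
  by congr (rip _ _ + rip _ _); apply/funext => x /=; rewrite ?Re_add ?Re_opp ?Im_add ?Im_opp.
exact: cvgD.
Qed.

Lemma nrm_cvg (F : nat -> R -> R[i]) f : CL2 f -> (forall n, CL2 (F n)) ->
  nrm (fun x => f x - F n x) @[n --> \oo] --> 0 -> nrm (F n) @[n --> \oo] --> nrm f.
Proof.
move=> hf hF /cvgrPdist_le H; apply/cvgrPdist_le => e e0.
have := H e e0; apply: filterS => n; rewrite sub0r normrN ger0_norm ?nrm_ge0// => Hn.
exact: le_trans (nrm_distr hf (hF n)) Hn.
Qed.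

(** On [-n, n] powers of xi are bounded, so a pointwise bound by such powers can be integrated there
    without knowing that they are square integrable on the whole line. *)
Lemma nrm_le_ccut f K : CL2 f -> (forall n, nrm (ccut n%:R f) <= K) -> nrm f <= K.
Proof.
move=> hf HK; have := nrm_cvg hf (fun n => CL2_ccut n%:R hf) (nrm_sub_ccut_cvg hf).
move=> H; rewrite -(cvg_lim _ H)//; apply: limr_le; last exact: nearW.
by apply/cvg_ex; eexists; exact: H.
Qed.

Lemma nrm_squeeze0 (u v : nat -> R) : (forall n, 0 <= u n <= v n) ->
  v n @[n --> \oo] --> 0 -> u n @[n --> \oo] --> 0.
Proof. by move=> uv hv; apply: (squeeze_cvgr _ (cvg_cst 0) hv); exact: nearW. Qed.

Lemma fourier_truncE f (A xi : R) : fourier_trunc f A xi = FT (ccut A f) xi.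
Proof.
rewrite /fourier_trunc /FT /cintegral -!Rintegral_indic_mul.
by congr (_ +i* _); apply: eq_Rintegral => x _; rewrite /ccut -mulrA ?Re_realM ?Im_realM.
Qed.

(* The closure in L^2 of the graph of [FT] on L^1 and L^2 functions: unlike [is_fourier],
   it is visibly stable under translations. *)
Definition fpair f g := [/\ CL2 f, CL2 g & exists h : nat -> R -> R[i],
  [/\ forall n, CL1 (h n) /\ CL2 (h n), nrm (fun x => f x - h n x) @[n --> \oo] --> 0 &
      nrm (fun xi => g xi - FT (h n) xi) @[n --> \oo] --> 0]].

(** The truncations to [-n, n] are integrable and square integrable, and serve as the approximating
    sequence. *)
Lemma is_fourier_fpair f g : is_fourier f g -> fpair f g.
Proof.
move=> [/is_L2P hf /is_L2P hg H]; split=> //; exists (fun n => ccut n%:R f); split.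
- by move=> n; split; [exact: CL1_ccut|exact: CL2_ccut].
- exact: nrm_sub_ccut_cvg.
- have := (cvge_pinftyP _ _).1 H (fun n => n%:R) cvgr_idn.
  move/fine_cvg; apply: cvg_trans; apply: near_eq_cvg; apply: nearW => n.
  rewrite /= (_ : (fun xi => _) = (fun xi => g xi - FT (ccut n%:R f) xi)); last first.
    by apply/funext => xi; rewrite fourier_truncE.
  rewrite L2norm_nrm//; apply: CL2B => //.
  by have [] := plancherel (CL1_ccut n%:R hf) (CL2_ccut n%:R hf).
Qed.

Lemma fpair_norm f g : fpair f g -> nrm g = Num.sqrt (@kappa R) * nrm f.
Proof.
move=> [hf hg [h [hh hfh hgh]]].
have pl n := plancherel (hh n).1 (hh n).2.
have H1 := nrm_cvg hf (fun n => (hh n).2) hfh.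
have H2 := nrm_cvg hg (fun n => (pl n).1) hgh.
have H3 : nrm (FT (h n)) @[n --> \oo] --> Num.sqrt (@kappa R) * nrm f.
  rewrite (_ : (fun n => _) = (fun n => Num.sqrt (@kappa R) * nrm (h n))).
    by apply: cvgM => //; exact: cvg_cst.
  by apply/funext => n; rewrite /nrm (pl n).2 sqrtrM// ltW// kappa_gt0.
exact: cvg_unique H2 H3.
Qed.

Lemma cintegralD f g : CL1 f -> CL1 g ->
  cintegral setT (fun x => f x + g x) = cintegral setT f + cintegral setT g.
Proof.
move=> [f1 f2] [g1 g2]; apply: complex_eq; rewrite ?Re_add ?Im_add /=.
  rewrite -(RintegralD measurableT f1 g1).
  by apply: eq_Rintegral => x _; rewrite Re_add.
rewrite -(RintegralD measurableT f2 g2).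
by apply: eq_Rintegral => x _; rewrite Im_add.
Qed.

Lemma cintegralZ (c : R[i]) f : CL1 f ->
  cintegral setT (fun x => c * f x) = c * cintegral setT f.
Proof.
move=> [f1 f2]; apply: complex_eq; rewrite ?Re_mul ?Im_mul /=.
  rewrite -(RintegralZl (Re c) measurableT f1) -(RintegralZl (Im c) measurableT f2).
  rewrite -(RintegralB measurableT (L1Z _ f1) (L1Z _ f2)).
  by apply: eq_Rintegral => x _; rewrite Re_mul.
rewrite -(RintegralZl (Re c) measurableT f2) -(RintegralZl (Im c) measurableT f1).
rewrite -(RintegralD measurableT (L1Z _ f2) (L1Z _ f1)).
by apply: eq_Rintegral => x _; rewrite Im_mul.
Qed.

Lemma cintegral_shift b f : CL1 f ->
  cintegral setT (fun x => f (x + b)) = cintegral setT f.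
Proof.
move=> [f1 f2]; apply: complex_eq => /=; [exact: (Rintegral_shift b f1)|exact: (Rintegral_shift b f2)].
Qed.

Definition cis (y : R) : R[i] := cos y +i* sin y.

Lemma sqn_cis y : sqn (cis y) = 1. Proof. by rewrite /sqn /= cos2Dsin2. Qed.

Lemma cisD x y : cis (x + y) = cis x * cis y.
Proof. by rewrite /cis cosD sinD; apply: complex_eq => /=; ring. Qed.

Lemma cis0 : cis 0 = 1. Proof. by rewrite /cis cos0 sin0. Qed.

Lemma cisN y : cis (- y) = cos y -i* sin y. Proof. by rewrite /cis cosN sinN. Qed.

Lemma FT_cis f xi : FT f xi = cintegral setT (fun x => f x * cis (- (x * xi))).
Proof. by congr cintegral; apply/funext => x; rewrite cexp_imag -cisN. Qed.

Lemma CL1_FT f xi : CL1 f -> CL1 (fun x => f x * cis (- (x * xi))).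
Proof.
have hcis : cbounded (fun x => cis (- (x * xi))) 1.
  have m : measurable_fun [set: R] (fun x : R => - (x * xi)).
    by apply: measurableT_comp => //; exact: measurable_funM.
  split; last by move=> x; rewrite /cis /= cos_max sin_max.
  - exact: (measurable_comp_R (@measurable_cos_R R) m).
  - exact: (measurable_comp_R (@measurable_sin_R R) m).
by move=> hf; have := CL1_mulb hf hcis; under eq_fun do rewrite mulrC.
Qed.

#[local] Opaque cintegral.

Lemma FTD f g xi : CL1 f -> CL1 g -> FT (fun x => f x + g x) xi = FT f xi + FT g xi.
Proof.
move=> hf hg; rewrite !FT_cis -(cintegralD (CL1_FT xi hf) (CL1_FT xi hg)).
by congr cintegral; apply/funext => x; rewrite mulrDl.
Qed.

Lemma FTZ (c : R[i]) f xi : CL1 f -> FT (fun x => c * f x) xi = c * FT f xi.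
Proof.
move=> hf; rewrite !FT_cis -(cintegralZ c (CL1_FT xi hf)).
by congr cintegral; apply/funext => x; rewrite mulrA.
Qed.

Lemma FT_shift b f xi : CL1 f -> FT (fun x => f (x + b)) xi = cis (b * xi) * FT f xi.
Proof.
move=> hf; rewrite -(FTZ (cis (b * xi)) xi hf) !FT_cis.
rewrite -(cintegral_shift b (CL1_FT xi (CL1Z (cis (b * xi)) hf))).
congr cintegral; apply/funext => x.
rewrite [(x + b) * xi]mulrDl opprD cisD.
rewrite [RHS](_ : _ = f (x + b) * cis (- (x * xi)) * (cis (b * xi) * cis (- (b * xi)))); last by ring.
by rewrite -cisD subrr cis0 mulr1.
Qed.

#[global] Opaque FT.

Lemma cvgD0 (u v : nat -> R) : u n @[n --> \oo] --> 0 -> v n @[n --> \oo] --> 0 ->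
  u n + v n @[n --> \oo] --> 0.
Proof. by move=> hu hv; rewrite -[X in _ --> X](addr0 (0 : R)); exact: cvgD. Qed.

Lemma fpairD f1 g1 f2 g2 : fpair f1 g1 -> fpair f2 g2 ->
  fpair (fun x => f1 x + f2 x) (fun xi => g1 xi + g2 xi).
Proof.
move=> [hf1 hg1 [h1 [hh1 A1 B1]]] [hf2 hg2 [h2 [hh2 A2 B2]]].
split; [exact: CL2D|exact: CL2D|exists (fun n x => h1 n x + h2 n x); split].
- by move=> n; split; [exact: CL1D (hh1 n).1 (hh2 n).1|exact: CL2D (hh1 n).2 (hh2 n).2].
- apply: (@nrm_squeeze0 _ (fun n => nrm (fun x => f1 x - h1 n x) + nrm (fun x => f2 x - h2 n x))).
    move=> n; rewrite nrm_ge0/=.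
    rewrite (nrm_eq (g := fun x => (f1 x - h1 n x) + (f2 x - h2 n x))); last by move=> x; ring.
    by apply: nrmD; apply: CL2B => //; [exact: (hh1 n).2|exact: (hh2 n).2].
  exact: cvgD0 A1 A2.
- have P1 n := (plancherel (hh1 n).1 (hh1 n).2).1.
  have P2 n := (plancherel (hh2 n).1 (hh2 n).2).1.
  apply: (@nrm_squeeze0 _ (fun n => nrm (fun x => g1 x - FT (h1 n) x) + nrm (fun x => g2 x - FT (h2 n) x))).
    move=> n; rewrite nrm_ge0/=.
    rewrite (nrm_eq (g := fun x => (g1 x - FT (h1 n) x) + (g2 x - FT (h2 n) x))).
      by apply: nrmD; apply: CL2B.
    by move=> x; rewrite (FTD x (hh1 n).1 (hh2 n).1); ring.
  exact: cvgD0 B1 B2.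
Qed.

Lemma nrmZc c f : CL2 f -> nrm (fun x => c * f x) = Num.sqrt (sqn c) * nrm f.
Proof. by move=> hf; rewrite /nrm nsqM// sqrtrM ?sqn_ge0. Qed.

Lemma fpairZ c f g : fpair f g -> fpair (fun x => c * f x) (fun xi => c * g xi).
Proof.
move=> [hf hg [h [hh A B]]].
split; [exact: CL2Z|exact: CL2Z|exists (fun n x => c * h n x); split].
- by move=> n; split; [exact: CL1Z (hh n).1|exact: CL2Z (hh n).2].
- rewrite (_ : (fun n => _) = (fun n => Num.sqrt (sqn c) * nrm (fun x => f x - h n x))).
    by rewrite -[X in _ --> X](mulr0 (Num.sqrt (sqn c))); apply: cvgM => //; exact: cvg_cst.
  apply/funext => n; rewrite -nrmZc; last exact: CL2B hf (hh n).2.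
  by apply: nrm_eq => x; rewrite mulrBr.
- rewrite (_ : (fun n => _) = (fun n => Num.sqrt (sqn c) * nrm (fun x => g x - FT (h n) x))).
    by rewrite -[X in _ --> X](mulr0 (Num.sqrt (sqn c))); apply: cvgM => //; exact: cvg_cst.
  apply/funext => n; rewrite -nrmZc; last exact: CL2B hg (plancherel (hh n).1 (hh n).2).1.
  by apply: nrm_eq => x; rewrite mulrBr (FTZ c x (hh n).1).
Qed.

Lemma cbounded_cis b : cbounded (fun xi => cis (b * xi)) 1.
Proof.
have m : measurable_fun [set: R] (fun x : R => b * x) by exact: measurable_funM.
split; last by move=> x; rewrite /cis /= cos_max sin_max.
- exact: (measurable_comp_R (@measurable_cos_R R) m).
- exact: (measurable_comp_R (@measurable_sin_R R) m).
Qed.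

Lemma CL2_cis b f : CL2 f -> CL2 (fun xi => cis (b * xi) * f xi).
Proof. by move=> hf; exact: CL2_mulb hf (cbounded_cis b). Qed.

Lemma nrm_cis b f : CL2 f -> nrm (fun xi => cis (b * xi) * f xi) = nrm f.
Proof.
move=> hf; rewrite /nrm !nsqE//; last exact: CL2_cis.
by congr Num.sqrt; apply: eq_Rintegral => x _; rewrite sqnM sqn_cis mul1r.
Qed.

Lemma fpair_shift b f g : fpair f g ->
  fpair (fun x => f (x + b)) (fun xi => cis (b * xi) * g xi).
Proof.
move=> [hf hg [h [hh A B]]].
split; [exact: CL2_shift|exact: CL2_cis|exists (fun n x => h n (x + b)); split].
- by move=> n; split; [exact: CL1_shift (hh n).1|exact: CL2_shift (hh n).2].
- apply: cvg_trans A; apply: near_eq_cvg; apply: nearW => n.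
  by rewrite -[LHS](nrm_shift b)//; exact: CL2B hf (hh n).2.
- apply: cvg_trans B; apply: near_eq_cvg; apply: nearW => n.
  rewrite -[LHS](nrm_cis b); last exact: CL2B hg (plancherel (hh n).1 (hh n).2).1.
  by apply: nrm_eq => x; rewrite mulrBr (FT_shift b x (hh n).1).
Qed.

Lemma fpair_FT f : CL1 f -> CL2 f -> fpair f (FT f).
Proof.
move=> h1 h2; have [h3 _] := plancherel h1 h2; split=> //; exists (fun=> f).
have E g : CL2 g -> nrm (fun x => g x - g x) = 0.
  move=> hg; rewrite (nrm_eq (g := fun x => 0%:C * g x)); last by move=> x; rewrite subrr mul0r.
  by rewrite nrmZ// normr0 mul0r.
by split=> //; under eq_fun do rewrite E//; exact: cvg_cst.
Qed.

Lemma fpair_eq f f' g g' : f =1 f' -> g =1 g' -> fpair f g -> fpair f' g'.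
Proof. by move=> /funext -> /funext ->. Qed.

Lemma CL1_0 : CL1 (fun _ : R => 0 : R[i]).
Proof.
have H : L1 (fun _ : R => 0 : R) by apply: (L1_eq _ (L1Z 0 (@L1_fejer R))) => x; rewrite mul0r.
by split.
Qed.

Lemma fpair0 : fpair (fun _ : R => 0) (fun _ : R => 0).
Proof. by apply: fpair_eq (fpairZ 0 (fpair_FT CL1_0 (@CL2_0 R))) => x; rewrite mul0r. Qed.

Lemma fpairB f1 g1 f2 g2 : fpair f1 g1 -> fpair f2 g2 ->
  fpair (fun x => f1 x - f2 x) (fun xi => g1 xi - g2 xi).
Proof.
move=> H1 /(fpairZ (-1)) H2; apply: fpair_eq (fpairD H1 H2) => x; by rewrite mulN1r.
Qed.

Lemma fpair_sum (I : Type) (s : seq I) (F G : I -> R -> R[i]) :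
  (forall i, fpair (F i) (G i)) ->
  fpair (fun x => \sum_(i <- s) F i x) (fun xi => \sum_(i <- s) G i xi).
Proof.
move=> H; elim: s => [|i s IH].
  by apply: fpair_eq fpair0 => x; rewrite big_nil.
by apply: fpair_eq (fpairD (H i) IH) => x; rewrite big_cons.
Qed.

End FourierPairs.

(** * Smooth functions with their derivatives, and a bump function *)

Section Jets.
Variable R : realType.
Implicit Types (F G : nat -> R -> R).

(* Carrying all the derivatives along avoids computing with [derive1n]. *)
Definition jet F := forall n x, is_derive x (1 : R) (F n) (F n.+1 x).

Lemma jet_derive1n F : jet F -> forall n, derive1n n (F 0%N) = F n.
Proof.
move=> jF; elim=> [//|n IH]; rewrite derive1nS IH; apply/funext => x.
by rewrite derive1E; exact: (@derive_val _ _ _ _ _ _ _ (jF n x)).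
Qed.

Lemma jet_test F A : jet F -> (forall x, A < `|x| -> F 0%N x = 0) -> test_function (F 0%N).
Proof.
move=> jF FA; split; last by exists A.
by move=> n x; rewrite jet_derive1n//; exact: ex_derive.
Qed.

Lemma jet_continuous F n : jet F -> continuous (F n).
Proof.
move=> jF x; apply: differentiable_continuous; apply/derivable1_diffP.
exact: (@ex_derive _ _ _ _ _ _ _ (jF n x)).
Qed.

Lemma jet_affine F a b : jet F -> jet (fun n x => a ^+ n * F n (a * x + b)).
Proof.
move=> jF n x.
have d1 : is_derive x (1 : R) (fun x : R => a * x + b) a.
  by apply: is_derive_eq; rewrite /GRing.scale/=; ring.
have d2 := @is_derive1_comp _ (F n) (fun x : R => a * x + b) x _ _ (jF n _) d1.
have d3 := is_deriveZ (a ^+ n) d2.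
by apply: is_derive_eq d3 _; rewrite /GRing.scale/= exprS; ring.
Qed.

Lemma jetZ F c : jet F -> jet (fun n x => c * F n x).
Proof. by move=> jF n x; have := is_deriveZ c (jF n x). Qed.

(** Pascal's rule in the form used to differentiate Leibniz's formula once more; [a i j] stands for
    a product of derivatives of orders i and j. *)
Lemma leibniz_step (a : nat -> nat -> R) n :
  \sum_(i < n.+1) 'C(n, i)%:R * (a i.+1 (n - i)%N + a i (n - i).+1) =
  \sum_(i < n.+2) 'C(n.+1, i)%:R * a i (n.+1 - i)%N.
Proof.
rewrite [RHS]big_ord_recl /= bin0 subn0.
rewrite (eq_bigr (fun i : 'I_n.+1 => 'C(n, i.+1)%:R * a i.+1 (n - i)%N + 'C(n, i)%:R * a i.+1 (n - i)%N)
  (P := predT) (F1 := fun i : 'I_n.+1 => 'C(n.+1, bump 0 i)%:R * a (bump 0 i) (n.+1 - bump 0 i)%N)); last first.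
  by move=> i _; rewrite /bump/= add1n binS natrD mulrDl subSS.
rewrite big_split/= addrA [RHS]addrC.
under eq_bigr do rewrite mulrDr.
rewrite big_split/=; congr (_ + _).
rewrite big_ord_recl /= bin0 subn0; congr (_ + _).
rewrite [RHS]big_ord_recr /= bin_small// mul0r addr0.
by apply: eq_bigr => i _; rewrite /bump/= add1n -subSn// ?subSS.
Qed.

Lemma jetM F G : jet F -> jet G ->
  jet (fun n x => \sum_(i < n.+1) 'C(n, i)%:R * (F i x * G (n - i)%N x)).
Proof.
move=> jF jG n x.
rewrite -(leibniz_step (fun i j => F i x * G j x)).
have H (i : 'I_n.+1) : is_derive x (1 : R) (fun x => 'C(n, i)%:R * (F i x * G (n - i)%N x))
    ('C(n, i)%:R * (F i.+1 x * G (n - i)%N x + F i x * G (n - i).+1 x)).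
  have d := is_deriveZ ('C(n, i)%:R) (is_deriveM (jF i x) (jG (n - i)%N x)).
  by apply: is_derive_eq d _; rewrite /GRing.scale/=; ring.
have := is_derive_sum H.
by congr is_derive; apply/funext => y; rewrite fct_sumE.
Qed.

(** For y >= 1 every monomial of [q] is at most y^m with m = size q + 1, and y^m exp(-y) <= m! by
    the exponential series. *)
Lemma poly_exp_bound (q : {poly R}) : exists C : R, forall y, 1 <= y -> `|q.[y]| * expR (- y) <= C.
Proof.
exists ((\sum_(i < size q) `|q`_i|) * (size q).+1`!%:R) => y y1.
have y0 : 0 <= y by rewrite (le_trans ler01).
have H1 : `|q.[y]| <= (\sum_(i < size q) `|q`_i|) * y ^+ (size q).+1.
  rewrite horner_coef (le_trans (ler_norm_sum _ _ _))// mulr_suml; apply: ler_sum => i _.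
  rewrite normrM ler_wpM2l// normrX (ger0_norm y0); apply: ler_weXn2l => //.
  by rewrite ltnW// ltnS ltnW.
have H2 : y ^+ (size q).+1 * expR (- y) <= (size q).+1`!%:R.
  rewrite expRN ler_pdivrMr ?expR_gt0//.
  have := expR_ge1Dxn (size q) y0.
  have f0 : 0 < (size q).+1`!%:R :> R by rewrite ltr0n fact_gt0.
  rewrite -(ler_pM2l f0) mulrDr mulr1 mulrCA mulfV ?gt_eqF// mulr1 => H.
  by apply: le_trans H; rewrite lerDr ltW.
have S0 : 0 <= \sum_(i < size q) `|q`_i| by apply: sumr_ge0.
rewrite (le_trans (ler_wpM2r (expR_ge0 _) H1))// -mulrA ler_wpM2l//.
Qed.

(** The derivative of order n of exp(-1/x) for x > 0 is P_n(1/x) exp(-1/x) with P_(n+1) = X^2 (P_n -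
    P_n'). [flat n] extends it by 0 to x <= 0. *)
Fixpoint bump_poly n : {poly R} :=
  if n is m.+1 then 'X^2 * (bump_poly m - (bump_poly m)^`()) else 1.

Definition flat n (x : R) : R := if 0 < x then (bump_poly n).[x^-1] * expR (- x^-1) else 0.

Lemma flat0 n x : x <= 0 -> flat n x = 0.
Proof. by move=> x0; rewrite /flat ltNge x0. Qed.

(** Quadratic smallness at 0 is what makes the derivative there exist and vanish. The spare square
    comes from applying [poly_exp_bound] to X^2 P_n. *)
Lemma flat_sqr_bound n : exists C : R, 0 <= C /\ forall h : R, `|h| <= 1 -> `|flat n h| <= C * h ^+ 2.
Proof.
have [C HC] := poly_exp_bound ('X^2 * bump_poly n).
have C0 : 0 <= C.
  by apply: le_trans (HC 1 (lexx _)); rewrite mulr_ge0// expR_ge0.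
exists C; split=> // h h1; case: (lerP h 0) => h0.
  by rewrite flat0// normr0 mulr_ge0// sqr_ge0.
rewrite /flat h0 normrM (ger0_norm (expR_ge0 _)).
have hi : 1 <= h^-1 by rewrite invf_ge1//; move: h1; rewrite ger0_norm// ltW.
have := HC _ hi; rewrite hornerM hornerXn normrM (ger0_norm (sqr_ge0 _)) -mulrA exprVn.
by rewrite mulrC ler_pdivrMr ?exprn_gt0.
Qed.

Lemma is_derive_0_sqr_bound (f : R -> R) C : 0 <= C -> (forall h : R, `|h| <= 1 -> `|f h| <= C * h ^+ 2) ->
  is_derive (0 : R) (1 : R) f 0.
Proof.
move=> C0 fC; have f0 : f 0 = 0.
  by apply/eqP; rewrite -normr_le0 (le_trans (fC 0 _)) ?normr0// expr0n mulr0.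
apply/is_derive1_caratheodory; exists (fun z => f z / z); split.
- move=> z; rewrite f0 !subr0; have [->|z0] := eqVneq z 0; first by rewrite f0 mulr0.
  by rewrite divfK.
- apply/cvgrPdist_le => e e0; near=> z; rewrite f0 mul0r.
  rewrite sub0r normrN; have z1 : `|z| <= 1.
    by near: z; apply: (@nbhs0_le R R^o) ; exact: ltr01.
  have [->|z0] := eqVneq z 0; first by rewrite f0 mul0r normr0 ltW.
  rewrite normrM normfV ler_pdivrMr ?normr_gt0// (le_trans (fC z z1))//.
  rewrite -real_normK ?num_real// expr2 mulrA ler_wpM2r//.
  have : `|z| <= e / (C + 1).
    by near: z; apply: (@nbhs0_le R R^o); rewrite divr_gt0// ltr_wpDl.
  rewrite ler_pdivlMr ?ltr_wpDl// => H; apply: le_trans H.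
  by rewrite mulrC ler_wpM2l// lerDl.
- by rewrite f0 mul0r.
Unshelve. all: by end_near. Qed.

Lemma jet_flat : jet flat.
Proof.
move=> n x; case: (ltgtP x 0) => x0.
- rewrite flat0 ?ltW//; apply: (@near_eq_is_derive _ _ _ (fun=> 0)).
  by near=> y; rewrite flat0// ltW//; near: y; exact: lt_nbhsl.
- have xn0 : x != 0 by rewrite gt_eqF.
  have dV : is_derive x (1 : R) (fun y : R => y^-1) (- x ^- 2).
    by have := is_deriveV xn0 (is_derive_id x (1 : R)); rewrite /GRing.scale/= mulr1.
  have dN : is_derive x (1 : R) (fun y : R => - y^-1) (x ^- 2).
    by have := is_deriveN dV; rewrite opprK.
  have d1 := is_derive1_comp (is_derive_poly (bump_poly n) (x^-1)) dV.
  have d2 := @is_derive1_comp _ expR (fun y : R => - y^-1) x _ _ (is_derive_expR (- x^-1)) dN.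
  have d3 : is_derive x (1 : R) (fun y : R => (bump_poly n).[y^-1] * expR (- y^-1)) (flat n.+1 x).
    apply: is_derive_eq (is_deriveM d1 d2) _.
    rewrite /flat x0 /GRing.scale/= hornerM hornerXn hornerD hornerN exprVn.
    by move: ((bump_poly n).[x^-1]) (_^`().[x^-1]) (expR _) (x ^- 2) => u v w z; ring.
  apply: (@near_eq_is_derive _ _ _ (fun y : R => (bump_poly n).[y^-1] * expR (- y^-1))).
  near=> y; have y0 : 0 < y by near: y; exact: lt_nbhsr.
  by rewrite /flat y0.
- rewrite x0 flat0//; have [C [C0 HC]] := flat_sqr_bound n.
  exact: is_derive_0_sqr_bound C0 HC.
Unshelve. all: by end_near. Qed.

(** The product of [flat 0] at 1 + x and at 1 - x, normalised at 0. Each derivative is continuous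
    and vanishes for |x| >= 1, hence is bounded. *)
Lemma bump_jet : exists X : nat -> R -> R, [/\ jet X, X 0%N 0 = 1,
  forall n x, 1 <= `|x| -> X n x = 0 & forall n, exists K, forall x, `|X n x| <= K].
Proof.
pose Y n x := \sum_(i < n.+1) 'C(n, i)%:R *
  ((1 ^+ i * flat i (1 * x + 1)) * ((-1) ^+ (n - i)%N * flat (n - i)%N (-1 * x + 1))).
have jY : jet Y.
  exact: (jetM (jet_affine 1 1 jet_flat) (jet_affine (-1) 1 jet_flat)).
have Y0 n x : 1 <= `|x| -> Y n x = 0.
  rewrite ler_normr => /orP[x1|x1]; rewrite /Y big1// => i _.
    by rewrite [flat (n - i)%N _]flat0 ?mulr0//; lra.
  by rewrite [flat i _]flat0 ?mulr0 ?mul0r ?mulr0//; lra.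
have Y00 : 0 < Y 0%N 0.
  rewrite /Y big_ord1 bin0 !mulr0 !add0r subn0 !expr0 !mul1r /flat ltr01/= !hornerE.
  by do ?[apply: mulr_gt0|exact: expR_gt0|exact: ltr01].
exists (fun n x => (Y 0%N 0)^-1 * Y n x); split.
- exact: jetZ.
- by rewrite mulVf// gt_eqF.
- by move=> n x x1; rewrite (Y0 n x x1) mulr0.
- move=> n; have jZ := jetZ (Y 0%N 0)^-1 jY.
  have cn : continuous (fun x => `|(Y 0%N 0)^-1 * Y n x|).
    by move=> x; apply: cvg_norm; exact: (jet_continuous jZ).
  have [c _ Hc] := @EVT_max R (fun x => `|(Y 0%N 0)^-1 * Y n x|) (-1) 1 ltac:(lra)
    (continuous_subspaceT cn).
  exists `|(Y 0%N 0)^-1 * Y n c| => x; case: (lerP `|x| 1) => x1.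
    by apply: Hc; rewrite in_itv/= -ler_norml.
  by rewrite (Y0 n x (ltW x1)) mulr0 normr0.
Qed.

End Jets.

(** * Weak derivatives on the Fourier side *)

Section WeakDerivative.
Variable R : realType.
Implicit Types (f g h : R -> R[i]) (b : R -> R).
Local Notation mu := (@lebesgue_measure R).
Local Notation Re := (@complex.Re R).
Local Notation Im := (@complex.Im R).

Definition rmul b f := fun x => (b x)%:C * f x.

Lemma cbounded_real b K : measurable_fun [set: R] b -> (forall x, `|b x| <= K) ->
  cbounded (fun x => (b x)%:C) K.
Proof.
move=> mb bK; split; [exact: mb|exact: measurable_cst|move=> x; split; first exact: bK].
by rewrite /= normr0 (le_trans (normr_ge0 _) (bK 0)).
Qed.

Lemma CL2_rmul b K f : CL2 f -> measurable_fun [set: R] b -> (forall x, `|b x| <= K) ->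
  CL2 (rmul b f).
Proof. by move=> hf mb bK; exact: CL2_mulb hf (cbounded_real mb bK). Qed.

Lemma CL1_rmul b K f : CL1 f -> measurable_fun [set: R] b -> (forall x, `|b x| <= K) ->
  CL1 (rmul b f).
Proof. by move=> hf mb bK; exact: CL1_mulb hf (cbounded_real mb bK). Qed.

Lemma nrm_rmul b K f : CL2 f -> measurable_fun [set: R] b -> (forall x, `|b x| <= K) ->
  nrm (rmul b f) <= K * nrm f.
Proof.
move=> hf mb bK; have K0 : 0 <= K by exact: le_trans (normr_ge0 _) (bK 0).
rewrite -[X in X * _](ger0_norm K0) -nrmZ//.
apply: nrm_le; [exact: CL2_rmul hf mb bK|exact: CL2Z|] => x.
rewrite /rmul !sqnM !sqn_real ler_wpM2r ?sqn_ge0//.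
by rewrite -(real_normK (num_real (b x))) lerXn2r ?nnegrE.
Qed.

Lemma CL1_rmul_supp b K A f : CL2 f -> measurable_fun [set: R] b ->
  (forall x, `|b x| <= K) -> (forall x, A < `|x| -> b x = 0) -> CL1 (rmul b f).
Proof.
move=> hf mb bK bA.
have -> : rmul b f = rmul b (ccut A f).
  apply/funext => x; rewrite /rmul /ccut indic_itv -ler_norml.
  by case: (lerP `|x| A) => xA; [rewrite mul1r|rewrite bA// mul0r mul0r].
exact: CL1_rmul (CL1_ccut A hf) mb bK.
Qed.

(** The derivative of order m in x of e^(-i x xi). *)
Definition cisd (xi : R) (m : nat) (x : R) : R[i] := (0 -i* xi) ^+ m * cis (- (x * xi)).

Lemma cisd_jet xi : jet (fun m x => Re (cisd xi m x)) /\ jet (fun m x => Im (cisd xi m x)).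
Proof.
have dm (x : R) : is_derive x (1 : R) (fun x : R => - (x * xi)) (- xi).
  by apply: is_derive_eq; rewrite /GRing.scale/=; ring.
have dc (x : R) := @is_derive1_comp _ cos (fun x : R => - (x * xi)) x _ _ (is_derive_cos _) (dm x).
have ds (x : R) := @is_derive1_comp _ sin (fun x : R => - (x * xi)) x _ _ (is_derive_sin _) (dm x).
split=> m x; rewrite /cisd exprS; move: ((0 -i* xi) ^+ m) => -[p q].
- have E : (fun x => Re ((p +i* q) * cis (- (x * xi)))) =
    (fun x => p * (cos \o (fun x : R => - (x * xi))) x - q * (sin \o (fun x : R => - (x * xi))) x).
    by apply/funext => y; rewrite Re_mul.
  rewrite E; apply: is_derive_eq (is_deriveB (is_deriveZ p (dc x)) (is_deriveZ q (ds x))) _.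
  by rewrite /GRing.scale !Re_mul !Im_mul /=; ring.
- have E : (fun x => Im ((p +i* q) * cis (- (x * xi)))) =
    (fun x => p * (sin \o (fun x : R => - (x * xi))) x + q * (cos \o (fun x : R => - (x * xi))) x).
    by apply/funext => y; rewrite Im_mul.
  rewrite E; apply: is_derive_eq (is_deriveD (is_deriveZ p (ds x)) (is_deriveZ q (dc x))) _.
  by rewrite /GRing.scale !Im_mul !Re_mul /=; ring.
Qed.

#[local] Opaque cintegral.

Lemma cintegral_sum (I : Type) (s : seq I) (F : I -> R -> R[i]) : (forall i, CL1 (F i)) ->
  CL1 (fun x => \sum_(i <- s) F i x) /\
  cintegral setT (fun x => \sum_(i <- s) F i x) = \sum_(i <- s) cintegral setT (F i).
Proof.
move=> hF; elim: s => [|i s [IH1 IH2]].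
  have E : (fun x : R => \sum_(i <- [::]) F i x) = (fun x => 0 * 0 : R[i]).
    by apply/funext => x; rewrite big_nil mul0r.
  rewrite E big_nil; split; first exact: (CL1Z 0 (@CL1_0 R)).
  by rewrite (cintegralZ 0 (@CL1_0 R)) mul0r.
have E : (fun x => \sum_(j <- i :: s) F j x) = (fun x => F i x + \sum_(j <- s) F j x).
  by apply/funext => x; rewrite big_cons.
rewrite E big_cons (cintegralD (hF i) IH1) IH2; split=> //; exact: CL1D.
Qed.

(** The weak derivative is tested against the cut off exponential X_0(x) e^(-i x xi), whose
    derivative of order k is expanded by Leibniz's formula. Test functions are real, so its real
    part [P 0] and imaginary part [Q 0] are tested separately and then recombined. *)
Lemma weak_derivative_FT (X : nat -> R -> R) (A : R) (K : nat -> R) k f g (xi : R) :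
  jet X -> (forall n x, A < `|x| -> X n x = 0) -> (forall n x, `|X n x| <= K n) ->
  CL2 f -> CL2 g -> weak_derivative k f g ->
  \sum_(i < k.+1) ('C(k, i)%:R * (0 -i* xi) ^+ (k - i)) * FT (rmul (X i) f) xi =
  (-1) ^+ k * FT (rmul (X 0%N) g) xi.
Proof.
move=> jX XA XK hf hg wd; have [jR jI] := cisd_jet xi.
have mX n := continuous_measurable_fun (jet_continuous (n := n) jX).
have f1 n : CL1 (rmul (X n) f) := CL1_rmul_supp hf (mX n) (XK n) (XA n).
have g1 n : CL1 (rmul (X n) g) := CL1_rmul_supp hg (mX n) (XK n) (XA n).
pose P n x := \sum_(i < n.+1) 'C(n, i)%:R * (X i x * Re (cisd xi (n - i) x)).
pose Q n x := \sum_(i < n.+1) 'C(n, i)%:R * (X i x * Im (cisd xi (n - i) x)).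
have jP : jet P := jetM jX jR.
have jQ : jet Q := jetM jX jI.
have PA x : A < `|x| -> P 0%N x = 0.
  by move=> xA; rewrite /P big_ord1 XA// mul0r mulr0.
have QA x : A < `|x| -> Q 0%N x = 0.
  by move=> xA; rewrite /Q big_ord1 XA// mul0r mulr0.
have W n x : (P n x)%:C + 'i%C * (Q n x)%:C =
    \sum_(i < n.+1) ('C(n, i)%:R * (0 -i* xi) ^+ (n - i)) * ((X i x)%:C * cis (- (x * xi))).
  rewrite /P /Q !rmorph_sum mulr_sumr -big_split/=; apply: eq_bigr => i _.
  rewrite !rmorphM !rmorph_nat.
  transitivity ('C(n, i)%:R * (X i x)%:C * cisd xi (n - i) x); last by rewrite /cisd; ring.
  by rewrite [in RHS](complexE (cisd xi (n - i) x)); ring.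
have cP n : CL1 (fun x => f x * (P n x)%:C) /\ CL1 (fun x => f x * (Q n x)%:C) /\
    CL1 (fun x => g x * (P n x)%:C) /\ CL1 (fun x => g x * (Q n x)%:C).
  have cd m : cbounded (fun x => cisd xi m x) (`|Re ((0 -i* xi) ^+ m)| + `|Im ((0 -i* xi) ^+ m)|).
    split; first by apply: continuous_measurable_fun; exact: (jet_continuous jR).
      by apply: continuous_measurable_fun; exact: (jet_continuous jI).
    move=> x; rewrite /cisd; move: ((0 -i* xi) ^+ m) => -[p q]; rewrite Re_mul Im_mul /=.
    split; [apply: le_trans (ler_normB _ _) _|apply: le_trans (ler_normD _ _) _];
      by rewrite !normrM lerD// -[leRHS]mulr1 ler_wpM2l// ?cos_max ?sin_max.
  have H (h : R -> R[i]) (T : nat -> R -> R) (h1 : forall m, CL1 (rmul (X m) h))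
      (mT : forall m, measurable_fun [set: R] (T m))
      (bT : forall m x, `|T m x| <= `|Re ((0 -i* xi) ^+ m)| + `|Im ((0 -i* xi) ^+ m)|) :
      CL1 (fun x => h x * (\sum_(i < n.+1) 'C(n, i)%:R * (X i x * T (n - i)%N x))%:C).
    have E : (fun x => h x * (\sum_(i < n.+1) 'C(n, i)%:R * (X i x * T (n - i)%N x))%:C) =
        (fun x => \sum_(i < n.+1) 'C(n, i)%:R * rmul (T (n - i)%N) (rmul (X i) h) x).
      apply/funext => x; rewrite rmorph_sum mulr_sumr; apply: eq_bigr => i _.
      by rewrite !rmorphM rmorph_nat /rmul; ring.
    rewrite E; apply: (cintegral_sum _ _).1 => i.
    by apply: CL1Z; exact: CL1_rmul (h1 i) (mT _) (bT _).
  have mR m : measurable_fun [set: R] (fun x => Re (cisd xi m x)) by case: (cd m).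
  have mI m : measurable_fun [set: R] (fun x => Im (cisd xi m x)) by case: (cd m).
  have bR m x := ((let: And3 _ _ H := cd m in H) x).1.
  have bI m x := ((let: And3 _ _ H := cd m in H) x).2.
  split; first exact: (H f (fun m x => Re (cisd xi m x)) f1 mR bR).
  split; first exact: (H f (fun m x => Im (cisd xi m x)) f1 mI bI).
  split; first exact: (H g (fun m x => Re (cisd xi m x)) g1 mR bR).
  exact: (H g (fun m x => Im (cisd xi m x)) g1 mI bI).
have combine h n (h1 : forall m, CL1 (rmul (X m) h)) :
    CL1 (fun x => h x * (P n x)%:C) -> CL1 (fun x => h x * (Q n x)%:C) ->
    cintegral setT (fun x => h x * (P n x)%:C) + 'i%C * cintegral setT (fun x => h x * (Q n x)%:C) =
    \sum_(i < n.+1) ('C(n, i)%:R * (0 -i* xi) ^+ (n - i)) * FT (rmul (X i) h) xi.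
  move=> hP hQ; rewrite -(cintegralZ 'i%C hQ) -(cintegralD hP (CL1Z 'i%C hQ)).
  have -> : (fun x => h x * (P n x)%:C + 'i%C * (h x * (Q n x)%:C)) =
      (fun x => \sum_(i < n.+1) ('C(n, i)%:R * (0 -i* xi) ^+ (n - i)) * (rmul (X i) h x * cis (- (x * xi)))).
    apply/funext => x; rewrite mulrCA -mulrDr W mulr_sumr; apply: eq_bigr => i _.
    by rewrite /rmul; ring.
  have hX (i : 'I_n.+1) := CL1Z ('C(n, i)%:R * (0 -i* xi) ^+ (n - i)) (CL1_FT xi (h1 i)).
  rewrite (cintegral_sum _ hX).2; apply: eq_bigr => i _.
  by rewrite (cintegralZ _ (CL1_FT xi (h1 i))) FT_cis.
have [fP [fQ _]] := cP k; have [_ [_ [gP gQ]]] := cP 0%N.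
rewrite -(combine f k f1 fP fQ).
have wP := wd _ (jet_test jP PA); have wQ := wd _ (jet_test jQ QA).
rewrite (jet_derive1n jP) in wP; rewrite (jet_derive1n jQ) in wQ.
rewrite wP wQ mulrCA -mulrDr (combine g 0%N g1 gP gQ) big_ord1.
by rewrite bin0 expr0 !mul1r.
Qed.

Lemma rmul_cvg0 (b : nat -> R -> R) K f : CL2 f -> (forall n, measurable_fun [set: R] (b n)) ->
  (forall n x, `|b n x| <= K) -> (forall x, b n x @[n --> \oo] --> 0) ->
  nrm (rmul (b n) f) @[n --> \oo] --> 0.
Proof.
move=> hf mb bK b0; apply: cvg_nrm0.
have hb n : CL2 (rmul (b n) f) := CL2_rmul hf (mb n) (bK n).
under eq_fun do rewrite (nsqE (hb _)).
have -> : 0 = \int[mu]_x (0 : R) by rewrite /Rintegral integral0.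
apply: (@Rdominated_cvg _ _ _ (fun x => K ^+ 2 * sqn (f x))).
- by move=> n; exact: L1_meas (L1_sqn (hb n)).
- exact: measurable_cst.
- move=> x; rewrite -[X in _ --> X](mul0r (sqn (f x))).
  have -> : (fun n => sqn (rmul (b n) f x)) = (fun n => b n x ^+ 2 * sqn (f x)).
    by apply/funext => n; rewrite /rmul sqnM sqn_real.
  by apply: cvgM; [exact: cvg_sqr0|exact: cvg_cst].
- exact/L1Z/L1_sqn.
- move=> n x; rewrite ger0_norm ?sqn_ge0// /rmul sqnM sqn_real ler_wpM2r ?sqn_ge0//.
  by rewrite -(real_normK (num_real (b n x))) lerXn2r ?nnegrE// (le_trans _ (bK n x)).
Qed.

Lemma ler_add_cvg0 (x y : R) (v : nat -> R) :
  (forall n, x <= y + v n) -> v n @[n --> \oo] --> 0 -> x <= y.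
Proof.
move=> H v0; have H2 : y + v n @[n --> \oo] --> y + 0 by apply: cvgD => //; exact: cvg_cst.
rewrite addr0 in H2; rewrite -(cvg_lim _ H2)//; apply: limr_ge; last exact: nearW.
by apply/cvg_ex; eexists; exact: H2.
Qed.

(** The truncation makes the multiplier bounded: xi^j times a transform is not known beforehand to
    be square integrable. *)
Definition powcut (M : R) (j : nat) (xi : R) : R := \1_`[- M, M] xi * xi ^+ j.

Lemma powcut_le M j xi : 0 <= M -> `|powcut M j xi| <= M ^+ j.
Proof.
move=> M0; rewrite /powcut indic_itv -ler_norml; case: (lerP `|xi| M) => H.
  by rewrite mul1r normrX lerXn2r ?nnegrE.
by rewrite mul0r normr0 exprn_ge0.
Qed.

Lemma measurable_powcut M j : measurable_fun [set: R] (powcut M j).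
Proof. by apply: measurable_funM; [exact: measurable_indic_itv|exact: measurable_funX]. Qed.

Lemma powcut_cisd M j (xi : R) :
  (\1_`[- M, M] xi)%:C * (0 -i* xi) ^+ j = (0 -i* 1) ^+ j * (powcut M j xi)%:C :> R[i].
Proof.
have -> : 0 -i* xi = (0 -i* 1) * xi%:C :> R[i].
  by apply: complex_eq; rewrite ?Re_mul ?Im_mul /=; ring.
by rewrite exprMn /powcut rmorphM rmorphXn mulrCA.
Qed.

Lemma sqn_mi_exp j : sqn ((0 -i* 1) ^+ j : R[i]) = 1.
Proof.
elim: j => [|j IH]; first by rewrite expr0 /sqn /= expr1n expr0n addr0.
by rewrite exprS sqnM IH mulr1 /sqn /= expr0n sqrrN expr1n add0r.
Qed.

(** The cutoff is dilated to width n + 1, so that in [weak_derivative_FT] each derivative falling on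
    it gains a factor [a n]. Letting n go to infinity for fixed [M] leaves only the term xi^k fh.
    The constant depends on the bump function alone, neither on [M] nor on the order [k]. *)
Lemma weak_derivative_bound : exists2 C : R, 0 < C & forall k f g fh M, 0 <= M ->
  fpair f fh -> CL2 g -> weak_derivative k f g -> nrm (rmul (powcut M k) fh) <= C * nrm g.
Proof.
have [X [jX X00 X0 /choice [K XK]]] := bump_jet R.
have K0 i : 0 <= K i by exact: le_trans (normr_ge0 _) (XK i 0).
pose s := Num.sqrt (@kappa R); have s0 : 0 <= s by exact: sqrtr_ge0.
(* [s] comes from Plancherel's formula and [K 0] bounds the cutoff applied to [g]; the 1 ensures
   positivity. *)
exists (s * K 0%N + 1) => [|k f g fh M M0 ffh hg wd].
  by rewrite ltr_wpDl// mulr_ge0.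
have [hf hfh _] := ffh.
pose a n : R := n.+1%:R^-1.
have a0 n : 0 <= a n by rewrite invr_ge0.
have a1 n : a n <= 1 by rewrite invf_le1// ler1n.
pose Y n i x := a n ^+ i * X i (a n * x + 0).
have jY n : jet (Y n) := jet_affine (a n) 0 jX.
have YA n i x : n.+1%:R < `|x| -> Y n i x = 0.
  move=> xn; rewrite /Y X0 ?mulr0// addr0 normrM (ger0_norm (a0 n)) mulrC.
  by rewrite ler_pdivlMr// mul1r ltW.
have YK n i x : `|Y n i x| <= a n ^+ i * K i.
  by rewrite /Y normrM (ger0_norm (exprn_ge0 _ (a0 n))) ler_wpM2l// exprn_ge0.
have mY n i := continuous_measurable_fun (jet_continuous (n := i) (jY n)).
have f1 n i : CL1 (rmul (Y n i) f) := CL1_rmul_supp hf (mY n i) (YK n i) (YA n i).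
have f2 n i : CL2 (rmul (Y n i) f) := CL2_rmul hf (mY n i) (YK n i).
have g1 n i : CL1 (rmul (Y n i) g) := CL1_rmul_supp hg (mY n i) (YK n i) (YA n i).
have g2 n i : CL2 (rmul (Y n i) g) := CL2_rmul hg (mY n i) (YK n i).
have F2 n i : CL2 (FT (rmul (Y n i) f)) by case: (fpair_FT (f1 n i) (f2 n i)).
have G2 n i : CL2 (FT (rmul (Y n i) g)) by case: (fpair_FT (g1 n i) (g2 n i)).
have nF n i : nrm (FT (rmul (Y n i) f)) <= s * (a n ^+ i * K i * nrm f).
  by rewrite (fpair_norm (fpair_FT (f1 n i) (f2 n i))) ler_wpM2l// (nrm_rmul hf (mY n i) (YK n i)).
have nG n : nrm (FT (rmul (Y n 0%N) g)) <= s * K 0%N * nrm g.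
  rewrite (fpair_norm (fpair_FT (g1 n 0%N) (g2 n 0%N))) -mulrA ler_wpM2l//.
  by have := nrm_rmul hg (mY n 0%N) (YK n 0%N); rewrite expr0 mul1r.
pose T n := rmul (powcut M k) (FT (rmul (Y n 0%N) f)).
have T2 n : CL2 (T n) := CL2_rmul (F2 n 0%N) (measurable_powcut M k) (fun xi => powcut_le k xi M0).
(* The terms of Leibniz's formula in which the cutoff is differentiated at least once; [nU] shows
   that their norms sum to at most [a n] times a constant. *)
pose U n (i : 'I_k) xi := ('C(k, i.+1)%:R * (0 -i* 1) ^+ (k - i.+1)) *
  rmul (powcut M (k - i.+1)) (FT (rmul (Y n i.+1) f)) xi.
have U2 n i : CL2 (U n i).
  apply: CL2Z; exact: CL2_rmul (F2 n i.+1) (measurable_powcut M _) (fun xi => powcut_le _ xi M0).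
pose S := \sum_(i < k) 'C(k, i.+1)%:R * (M ^+ (k - i.+1) * (s * (K i.+1 * nrm f))).
have nU n : \sum_(i < k) nrm (U n i) <= a n * S.
  rewrite mulr_sumr; apply: ler_sum => i _.
  rewrite nrmZc; last first.
    exact: CL2_rmul (F2 n i.+1) (measurable_powcut M _) (fun xi => powcut_le _ xi M0).
  rewrite sqnM sqn_mi_exp mulr1 -[X in sqn X](rmorph_nat (real_complex R)) sqn_real sqrtr_sqr normr_nat.
  rewrite mulrCA ler_wpM2l//.
  apply: le_trans (nrm_rmul (F2 n i.+1) (measurable_powcut M _) (fun xi => powcut_le _ xi M0)) _.
  rewrite mulrCA ler_wpM2l ?exprn_ge0//.
  apply: le_trans (nF n i.+1) _; rewrite [leRHS]mulrCA ler_wpM2l// -mulrA.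
  rewrite ler_wpM2r ?mulr_ge0 ?nrm_ge0//.
  by rewrite exprS ler_piMr// exprn_ile1.
have ET n xi : (0 -i* 1) ^+ k * T n xi =
    (\1_`[- M, M] xi * (-1) ^+ k)%:C * FT (rmul (Y n 0%N) g) xi - \sum_(i < k) U n i xi.
  have := weak_derivative_FT xi (jY n) (YA n) (YK n) hf hg wd.
  rewrite big_ord_recl /= bin0 mul1r subn0 => /(congr1 (fun z => (\1_`[- M, M] xi)%:C * z)).
  rewrite mulrDr mulrA powcut_cisd mulr_sumr => H.
  rewrite rmorphM rmorphXn rmorphN rmorph1 -mulrA -H.
  rewrite [X in _ = _ + X - _](_ : _ = \sum_(i < k) U n i xi); last first.
    apply: eq_bigr => i _; rewrite /U /rmul /bump /= add1n.
    by rewrite mulrA mulrCA powcut_cisd; ring.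
  by rewrite addrK /T /rmul mulrA.
have nT n : nrm (T n) <= s * K 0%N * nrm g + a n * S.
  have -> : nrm (T n) = nrm (fun xi => (0 -i* 1) ^+ k * T n xi).
    by rewrite nrmZc// sqn_mi_exp sqrtr1 mul1r.
  rewrite (nrm_eq (ET n)).
  have bK xi : `|\1_`[- M, M] xi * (-1) ^+ k| <= 1 :> R.
    by rewrite normrM normrX normrN1 expr1n mulr1 indic_le1.
  have mb : measurable_fun [set: R] (fun xi => \1_`[- M, M] xi * (-1) ^+ k : R).
    by apply: measurable_funM => //; exact: measurable_indic_itv.
  have [SU1 SU2] := nrm_sum (index_enum 'I_k) (U2 n).
  apply: le_trans (nrmB (CL2_rmul (G2 n 0%N) mb bK) SU1) _.
  rewrite lerD//; last exact: le_trans SU2 (nU n).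
  apply: le_trans (nrm_rmul (G2 n 0%N) mb bK) _.
  by rewrite mul1r.
have lim_f : nrm (fun x => f x - rmul (Y n 0%N) f x) @[n --> \oo] --> 0.
  have := @rmul_cvg0 (fun n x => 1 - Y n 0%N x) (1 + K 0%N) f hf.
  have -> : (fun n => nrm (rmul (fun x => 1 - Y n 0%N x) f)) =
      (fun n => nrm (fun x => f x - rmul (Y n 0%N) f x)).
    apply/funext => n; apply: nrm_eq => x.
    by rewrite /rmul rmorphB rmorph1 mulrBl mul1r.
  apply.
  - by move=> n; apply: measurable_funB => //; exact: mY.
  - move=> n x; apply: le_trans (ler_normB _ _) _; rewrite normr1 lerD2l.
    by have := YK n 0%N x; rewrite expr0 mul1r.
  - move=> x; rewrite -[X in _ --> X](subrr (1 : R)); apply: cvgB; first exact: cvg_cst.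
    rewrite -[X in _ --> X]X00 /Y; under eq_fun do rewrite expr0 mul1r addr0.
    apply: (@cvg_comp _ _ _ (fun n => a n * x) (X 0%N)); last exact: (jet_continuous jX).
    have H : a n * x @[n --> \oo] --> 0 * x.
      by apply: cvgM; [exact: cvg_harmonic|exact: cvg_cst].
    by rewrite mul0r in H.
have lim_v : a n * S + M ^+ k * (s * nrm (fun x => f x - rmul (Y n 0%N) f x)) @[n --> \oo] --> 0.
  apply: cvgD0.
    by rewrite -[X in _ --> X](mul0r S); apply: cvgM; [exact: cvg_harmonic|exact: cvg_cst].
  rewrite -[X in _ --> X](mulr0 (M ^+ k)); apply: cvgM; first exact: cvg_cst.
  by rewrite -[X in _ --> X](mulr0 s); apply: cvgM; [exact: cvg_cst|exact: lim_f].
apply: (@le_trans _ _ (s * K 0%N * nrm g)); last first.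
  by rewrite ler_wpM2r ?nrm_ge0// lerDl.
apply: ler_add_cvg0 lim_v => n.
(* Replacing [fh] by the transform of the cut off [f] costs at most M^k times the norm of a
   transform that tends to 0 by Plancherel's formula. *)
have ffn := fpairB ffh (fpair_FT (f1 n 0%N) (f2 n 0%N)).
have [_ d2 _] := ffn.
have r2 := CL2_rmul d2 (measurable_powcut M k) (fun xi => powcut_le k xi M0).
rewrite addrA; apply: (@le_trans _ _ (nrm (T n) +
    nrm (rmul (powcut M k) (fun xi => fh xi - FT (rmul (Y n 0%N) f) xi)))).
  apply: le_trans (nrmD (T2 n) r2); rewrite le_eqVlt; apply/orP; left; apply/eqP.
  by apply: nrm_eq => xi; rewrite /T /rmul -mulrDr addrC subrK.
rewrite lerD//; apply: le_trans (nrm_rmul d2 (measurable_powcut M k) (fun xi => powcut_le k xi M0)) _.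
by rewrite (fpair_norm ffn).
Qed.

End WeakDerivative.

(** * Step functions and cell averages *)

Section Cells.
Variable R : realType.
Local Notation mu := (@lebesgue_measure R).
Local Notation Re := (@complex.Re R).
Local Notation Im := (@complex.Im R).
Variable dx : R.
Hypothesis dx_gt0 : 0 < dx.
Implicit Types (v : int -> R[i]) (f : R -> R[i]).

Definition cidx (x : R) : int := Num.floor (x / dx).

(** Half-open, so that the cells partition the line; cell averages are taken over closed intervals,
    and [integral_cell_sqn] passes from one to the other. *)
Definition cell (j : int) : set R := `[j%:~R * dx, (j + 1)%:~R * dx[%classic.

Lemma cellP j x : cell j x <-> cidx x = j.
Proof.
rewrite /cell /= in_itv/= /cidx -ler_pdivlMr// -ltr_pdivrMr//; split.
  by move=> h; apply: floor_def.
by move=> <-; exact: floor_itv.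
Qed.

Lemma cidx_shift (m : int) (x : R) : cidx (x + m%:~R * dx) = cidx x + m.
Proof. by rewrite /cidx mulrDl mulfK ?gt_eqF// floorDrz ?floor_int// intrKfloor. Qed.

Lemma measurable_cell j : measurable (cell j). Proof. exact: measurable_itv. Qed.

(* The cells are renumbered by [nat] because countable additivity is stated for sequences. *)
Definition ncell (n : nat) : set R :=
  if pickle_inv n is Some j then cell j else set0.

Lemma ncell_pickle j : ncell (pickle j) = cell j.
Proof. by rewrite /ncell pickleK_inv. Qed.

Lemma measurable_ncell n : measurable (ncell n).
Proof. by rewrite /ncell; case: pickle_inv => [j|]; [exact: measurable_cell|exact: measurable0]. Qed.

Lemma bigcup_ncell : \bigcup_n ncell n = [set: R].
Proof.
apply/seteqP; split=> [x _ //|x _]; exists (pickle (cidx x)); first exact: I.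
by rewrite ncell_pickle; apply/cellP.
Qed.

Lemma trivIset_ncell : trivIset setT ncell.
Proof.
apply/trivIsetP => m n _ _; rewrite /ncell.
case em : (pickle_inv m) => [i|]; last by rewrite set0I.
case en : (pickle_inv n) => [j|]; last by rewrite setI0.
move=> mn; apply/seteqP; split=> [x [/cellP ii /cellP ij]|x//].
have Ki := @pickle_invK int.
move: (Ki m) (Ki n); rewrite em en /= => h1 h2; move/eqP: mn; apply.
by rewrite -h1 -h2 -ii -ij.
Qed.

Lemma measurable_step d (T : measurableType d) (g : int -> T) :
  measurable_fun [set: R] (fun x => g (cidx x)).
Proof.
rewrite -bigcup_ncell; apply/measurable_fun_bigcup; first exact: measurable_ncell.
move=> n; rewrite /ncell; case: pickle_inv => [j|]; last exact: measurable_fun_set0.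
apply: (eq_measurable_fun (fun=> g j)); last exact: measurable_cst.
by move=> x; rewrite inE => /cellP ->.
Qed.

Lemma integral_cells (h : R -> \bar R) : measurable_fun [set: R] h -> (forall x, (0 <= h x)%E) ->
  (\int[mu]_x h x = \esum_(j in [set: int]) \int[mu]_(x in cell j) h x)%E.
Proof.
move=> mh h0; rewrite -bigcup_ncell ge0_integral_bigcup//.
- rewrite nneseries_esumT; last by move=> n; apply: integral_ge0.
  rewrite [RHS](_ : _ = \esum_(j in [set: int]) \int[mu]_(x in ncell (pickle j)) h x)%E; last first.
    by apply: eq_esum => j _; rewrite ncell_pickle.
  rewrite -(esum_image [set: int] pickle (fun n => \int[mu]_(x in ncell n) h x)%E); last first.
    by move=> i j _ _; apply: pcan_inj; exact: pickleK.
  rewrite [RHS]esum_mkcond; apply: eq_esum => n _; case: ifPn => //.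
  rewrite notin_setE => nn; rewrite /ncell; case en : (pickle_inv n) => [j|]; last by rewrite integral_set0.
  by exfalso; apply: nn; exists j => //; have := @pickle_invK int n; rewrite /ocancel en.
- exact: measurable_ncell.
- by rewrite bigcup_ncell.
- exact: trivIset_ncell.
Qed.

Lemma cell_measure j : mu (cell j) = dx%:E.
Proof.
rewrite /cell lebesgue_measure_itv/= lte_fin ltr_pM2r// ltr_int ltrDl ltr01 -EFinD; congr EFin.
by rewrite -mulrBl intrD addrC addKr mul1r.
Qed.

Definition st v (x : R) : R[i] := v (cidx x).

Lemma integral_sqn_st v : (\int[mu]_x (sqn (st v x))%:E =
  \esum_(j in [set: int]) (dx * Normc.normc (v j) ^+ 2)%:E)%E.
Proof.
rewrite integral_cells; first last.
- by move=> x; rewrite lee_fin sqn_ge0.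
- by apply/measurable_EFinP; exact: (measurable_step (fun j => sqn (v j))).
apply: eq_esum => j _; rewrite normc_sqr.
rewrite (eq_integral (cst (sqn (v j))%:E)); last by move=> x; rewrite inE => /cellP; rewrite /st => ->.
rewrite integral_cst; last exact: measurable_cell.
by have := cell_measure j; rewrite /cell => e; rewrite [X in (_ * X)%E]e -EFinM mulrC.
Qed.

Lemma sqrte_lty (x : \bar R) : (sqrte x < +oo)%E -> (x < +oo)%E.
Proof. by case: x => //= r _; rewrite ltry. Qed.

Lemma CL2_st v : (l2norm dx v < +oo)%E -> CL2 (st v).
Proof.
rewrite /l2norm -integral_sqn_st => h.
have mR : measurable_fun [set: R] (Re \o st v) := measurable_step (fun j => Re (v j)).
have mI : measurable_fun [set: R] (Im \o st v) := measurable_step (fun j => Im (v j)).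
have h0 : L1 (fun x => sqn (st v x)).
  apply/integrableP; split.
    by apply/measurable_EFinP; exact: (measurable_step (fun j => sqn (v j))).
  under eq_integral do rewrite /= ger0_norm ?sqn_ge0//.
  exact: sqrte_lty h.
split; split=> //.
- apply: (L1_le _ h0); first exact: measurable_funX.
  by move=> x /=; rewrite !ger0_norm ?sqn_ge0 ?sqr_ge0// /sqn lerDl sqr_ge0.
- apply: (L1_le _ h0); first exact: measurable_funX.
  by move=> x /=; rewrite !ger0_norm ?sqn_ge0 ?sqr_ge0// /sqn lerDr sqr_ge0.
Qed.

Lemma l2norm_st v : CL2 (st v) -> l2norm dx v = (nrm (st v))%:E.
Proof.
move=> h; rewrite /l2norm -integral_sqn_st /nrm (nsqE h) -EFin_Rintegral//.
exact: (L1_sqn h).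
Qed.

Lemma cell_average_E f j : cell_average dx f j =
  (dx^-1)%:C * cintegral setT (rmul \1_`[j%:~R * dx, (j + 1)%:~R * dx] f).
Proof.
rewrite /cell_average /cintegral -!Rintegral_indic_mul; congr (_ * (_ +i* _)).
  by apply: eq_Rintegral => x _; rewrite Re_realM.
by apply: eq_Rintegral => x _; rewrite Im_realM.
Qed.

(** Cauchy-Schwarz against the indicator. On a cell, where b - a = dx, it bounds the squared average
    by the average of the square. *)
Lemma Rintegral_indic_sqr (g : R -> R) a b : L2 g -> a < b ->
  (\int[mu]_x (\1_`[a, b] x * g x)) ^+ 2 <= (b - a) * \int[mu]_x (\1_`[a, b] x * g x ^+ 2).
Proof.
move=> hg ab.
have i2 x : (\1_`[a, b] x : R) * \1_`[a, b] x = \1_`[a, b] x.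
  by rewrite indicE; case: (_ \in _); rewrite ?mulr1 ?mulr0.
have h1 := L2_indic a b.
have h2 : L2 (fun x => \1_`[a, b] x * g x).
  exact: (L2_mulb hg (measurable_indic_itv a b) (indic_le1 _)).
have := rip_CS h1 h2; rewrite /rip.
under eq_Rintegral do rewrite mulrA i2.
rewrite -(Rintegral_indic ab).
under [X in _ <= X * _ -> _]eq_Rintegral do rewrite i2.
by under [X in _ <= _ * X -> _]eq_Rintegral do rewrite mulrACA i2 -expr2.
Qed.

Lemma integral_cell_sqn f j : CL2 f ->
  (\int[mu]_(x in cell j) (sqn (f x))%:E)%E =
  (\int[mu]_x (\1_`[j%:~R * dx, (j + 1)%:~R * dx] x * sqn (f x)))%:E.
Proof.
move=> hf; have h := L1_sqn hf.
rewrite Rintegral_indic_mul EFin_Rintegral; last by [].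
  rewrite /cell integral_itv_bndo_bndc//.
  by apply: measurable_funTS; apply/measurable_EFinP; exact: (L1_meas h).
by apply: integrableS h.
Qed.

Lemma cell_average_sqr f j : CL2 f ->
  ((dx * Normc.normc (cell_average dx f j) ^+ 2)%:E <= \int[mu]_(x in cell j) (sqn (f x))%:E)%E.
Proof.
move=> hf; rewrite integral_cell_sqn// lee_fin normc_sqr cell_average_E sqnM sqn_real.
have ab : j%:~R * dx < (j + 1)%:~R * dx by rewrite ltr_pM2r// ltr_int ltrDl ltr01.
have e : (j + 1)%:~R * dx - j%:~R * dx = dx by rewrite -mulrBl intrD addrC addKr mul1r.
have [hr hi] := hf.
have := Rintegral_indic_sqr hr ab; have := Rintegral_indic_sqr hi ab; rewrite e.
set A := `[_, _]%classic; set X := \int[mu]_x _; set Y := \int[mu]_x _.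
set Z := \int[mu]_x _; set W := \int[mu]_x _; move=> YI XR.
have E : \int[mu]_x (\1_A x * sqn (f x)) = W + Y.
  rewrite /W /Y -RintegralD//.
  - by apply: eq_Rintegral => x _; rewrite /sqn mulrDr.
  - exact: (L1_mulb (L2_sqr hr) (measurable_indic_itv _ _) (indic_le1 _)).
  - exact: (L1_mulb (L2_sqr hi) (measurable_indic_itv _ _) (indic_le1 _)).
rewrite E.
have -> : sqn (cintegral setT (rmul \1_A f)) = Z ^+ 2 + X ^+ 2.
  rewrite /sqn /cintegral /Z /X /=; congr (_ ^+ 2 + _ ^+ 2).
    by apply: eq_Rintegral => x _; rewrite Re_realM.
  by apply: eq_Rintegral => x _; rewrite Im_realM.
by rewrite mulrA expr2 mulrA divff ?gt_eqF// mul1r ler_pdivrMl// mulrDr lerD.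
Qed.

Lemma nrm_cell_average f : CL2 f ->
  CL2 (st (cell_average dx f)) /\ nrm (st (cell_average dx f)) <= nrm f.
Proof.
move=> hf; have h := L1_sqn hf.
have le : (\esum_(j in [set: int]) (dx * Normc.normc (cell_average dx f j) ^+ 2)%:E <=
    (nsq f)%:E)%E.
  rewrite nsqE// EFin_Rintegral//.
  rewrite integral_cells; first last.
  - by move=> x; rewrite lee_fin sqn_ge0.
  - by apply/measurable_EFinP; exact: (L1_meas h).
  by apply: le_esum => j _; exact: cell_average_sqr.
have hs : CL2 (st (cell_average dx f)).
  apply: CL2_st; rewrite /l2norm; move: le; case: (esum _ _) => [r|//|//] _ /=; by rewrite ?ltry.
split=> //; have := l2norm_st hs; rewrite /l2norm.
have f0 : (0 <= (nsq f)%:E)%E by rewrite lee_fin nsq_ge0.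
by move=> e; rewrite -lee_fin -e -[(nrm f)%:E]/(sqrte (nsq f)%:E) lee_sqrt.
Qed.

Lemma CL1_cell f j : CL2 f -> CL1 (rmul \1_`[j%:~R * dx, (j + 1)%:~R * dx] f).
Proof.
move=> hf; set a := j%:~R * dx; set b := (j + 1)%:~R * dx.
apply: (CL1_rmul_supp hf (measurable_indic_itv _ _) (indic_le1 _) (A := `|a| + `|b|)) => x.
rewrite indic_itv; case: (boolP (a <= x <= b)) => // /andP[ax xb].
rewrite real_ltNge ?num_real// => /negP[]; rewrite ler_norml.
have := ler_norm b; have := ler_norm (- a); rewrite normrN => h1 h2.
by apply/andP; split; [have := normr_ge0 b|have := normr_ge0 a]; lra.
Qed.

Lemma cell_averageD f g j : CL2 f -> CL2 g ->
  cell_average dx (fun x => f x + g x) j = cell_average dx f j + cell_average dx g j.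
Proof.
move=> hf hg; rewrite !cell_average_E -mulrDr -cintegralD; try exact: CL1_cell.
by congr (_ * cintegral _ _); apply/funext => x; rewrite /rmul mulrDr.
Qed.

Lemma cell_averageZ c f j : CL2 f ->
  cell_average dx (fun x => c * f x) j = c * cell_average dx f j.
Proof.
move=> hf; rewrite !cell_average_E mulrCA -(cintegralZ c); last exact: CL1_cell.
by congr (_ * cintegral _ _); apply/funext => x; rewrite /rmul mulrCA.
Qed.

Lemma cell_average_shift f j (m : int) : CL2 f ->
  cell_average dx (fun x => f (x + m%:~R * dx)) j = cell_average dx f (j + m).
Proof.
move=> hf; rewrite !cell_average_E.
rewrite -(cintegral_shift (m%:~R * dx) (CL1_cell (j + m) hf)).
congr (_ * cintegral _ _); apply/funext => x; rewrite /rmul; congr (_%:C * _).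
rewrite !indic_itv addrAC !(intrD, mulrDl) !lerD2r.
by rewrite -mulrDl.
Qed.

End Cells.

(** * Energy estimates for finite differences *)

Section Differences.
Variable R : realType.
Variable dx : R.
Hypothesis dx_gt0 : 0 < dx.
Implicit Types (f g u w : R -> R[i]) (m n : int).

Definition sh m f : R -> R[i] := fun x => f (x + m%:~R * dx).

Definition bdiff f : R -> R[i] := fun x => f x - sh (-1) f x.

Lemma CL2_sh m f : CL2 f -> CL2 (sh m f). Proof. exact: CL2_shift. Qed.

Lemma CL2_bdiff f : CL2 f -> CL2 (bdiff f).
Proof. by move=> hf; apply: CL2B => //; exact: CL2_sh. Qed.

Lemma CL2_iter_bdiff k f : CL2 f -> CL2 (iter k bdiff f).
Proof. by move=> hf; elim: k => //= k IH; exact: CL2_bdiff. Qed.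

Lemma shD m n f : sh m (sh n f) = sh (m + n) f.
Proof. by apply/funext => x; rewrite /sh -addrA -mulrDl -intrD. Qed.

Lemma sh0 f : sh 0 f = f.
Proof. by apply/funext => x; rewrite /sh mul0r addr0. Qed.

Lemma sh_bdiff m f : sh m (bdiff f) = bdiff (sh m f).
Proof.
by apply/funext => x; rewrite /bdiff (_ : sh (-1) (sh m f) = sh m (sh (-1) f))// !shD addrC.
Qed.

Lemma sh_iter_bdiff m k f : sh m (iter k bdiff f) = iter k bdiff (sh m f).
Proof. by elim: k => //= k <-; rewrite sh_bdiff. Qed.

Lemma nsq_sh m f : CL2 f -> nsq (sh m f) = nsq f.
Proof. by move=> hf; rewrite /nsq [LHS]ip_shift. Qed.

Lemma ip_sh m f g : CL2 f -> CL2 g -> ip (sh m f) g = ip f (sh (- m) g).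
Proof.
move=> hf hg; have := ip_shift (m%:~R * dx) hf (CL2_sh (- m) hg).
have -> : (fun x => sh (- m) g (x + m%:~R * dx)) = g; last by [].
by apply/funext => x; rewrite /sh intrN mulNr addrK.
Qed.

Lemma ipBl f g h : CL2 f -> CL2 g -> CL2 h ->
  ip (fun x => f x - g x) h = ip f h - ip g h.
Proof.
move=> hf hg hh.
rewrite (ip_congl (f' := fun x => f x + (-1)%:C * g x)) => [|x]; last first.
  by rewrite rmorphN1 mulN1r.
by rewrite ipDl ?ipZl ?mulN1r//; exact: CL2Z.
Qed.

(** Summation by parts: with S the translation by [dx], the adjoint of N = 1 - S^-1 is 1 - S = - S
    N. *)
Lemma ip_bdiff f g : CL2 f -> CL2 g -> ip (bdiff f) g = - ip (sh (-1) f) (bdiff g).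
Proof.
move=> hf hg; have h1 := CL2_sh (-1) hf; have h2 := CL2_sh (-1) hg.
rewrite (ipBl hf h1 hg) [X in _ = - X]ipC (ipBl hg h2 h1) opprB ![ip _ (sh (-1) f)]ipC.
by congr (_ - _); rewrite (ip_sh _ hf h2) shD subrr sh0.
Qed.

Lemma ip_iter_bdiff k f g : CL2 f -> CL2 g ->
  ip (iter k bdiff f) g = (-1) ^+ k * ip (sh (- k%:Z) f) (iter k bdiff g).
Proof.
elim: k f g => [|k IH] f g hf hg; first by rewrite expr0 mul1r /= oppr0 sh0.
rewrite iterSr IH ?exprS//; last exact: CL2_bdiff.
rewrite sh_bdiff ip_bdiff ?shD; [|exact: CL2_sh|exact: CL2_iter_bdiff].
by rewrite /= mulrN -mulN1r mulrA; congr (_ * ip (sh _ f) _); rewrite intS opprD.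
Qed.

Lemma nsq_bdiff f : CL2 f -> nsq (bdiff f) = 2 * (nsq f - ip (sh (-1) f) f).
Proof.
move=> hf; have h := CL2_sh (-1) hf.
rewrite /nsq ipBl//; last exact: CL2_bdiff.
rewrite ![ip _ (bdiff f)]ipC !ipBl// [ip f (sh _ _)]ipC [ip (sh _ _) (sh _ _)](nsq_sh _ hf) /nsq.
ring.
Qed.

(** Parallelogram law for [f] and its translate, which have equal norms: the difference falls short
    of 4 |f|^2 by the squared norm of the sum. *)
Lemma nsq_bdiff_le f : CL2 f -> nsq (bdiff f) <= 4 * nsq f.
Proof.
move=> hf; have h := CL2_sh (-1) hf.
have := nsq_ge0 (fun x => f x + sh (-1) f x).
have -> : nsq (fun x => f x + sh (-1) f x) = 2 * (nsq f + ip (sh (-1) f) f).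
  rewrite /nsq ipDl//; last exact: CL2D.
  rewrite ![ip _ (fun x => _ + _)]ipC !ipDl// [ip f (sh _ _)]ipC [ip (sh _ _) (sh _ _)](nsq_sh _ hf) /nsq.
  ring.
rewrite nsq_bdiff//; set a := nsq f; set b := ip _ _; lra.
Qed.

Lemma nsq_iter_bdiff k f : CL2 f -> nsq (iter k bdiff f) <= 4 ^+ k * nsq f.
Proof.
move=> hf; elim: k => [|k IH]; first by rewrite mul1r.
rewrite /= (le_trans (nsq_bdiff_le (CL2_iter_bdiff k hf)))// exprS -mulrA.
by rewrite ler_pM2l.
Qed.

Lemma iter_bdiffE k f x :
  iter k bdiff f x = \sum_(0 <= i < k.+1) ('C(k, i)%:R * (-1) ^+ i)%:C * sh (- i%:Z) f x.
Proof.
elim: k x => [|k IH] x.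
  by rewrite big_nat1 bin0 mul1r expr0 mul1r oppr0 sh0.
rewrite /= {1}/bdiff -[sh (-1) _ x]/(iter k bdiff f (x + (-1)%:~R * dx)) !IH [RHS]big_nat_recl//.
have -> : \sum_(0 <= i < k.+1) ('C(k, i)%:R * (-1) ^+ i)%:C * sh (- i%:Z) f x =
  ('C(k.+1, 0)%:R * (-1) ^+ 0)%:C * sh (- 0%:Z) f x +
  \sum_(0 <= i < k.+1) ('C(k, i.+1)%:R * (-1) ^+ i.+1)%:C * sh (- (i.+1)%:Z) f x.
  rewrite [X in _ = _ + X]big_nat_recr//= [X in _ = _ + (_ + (X%:R * _)%:C * _)]bin_small//.
  rewrite mul0r rmorph0 mul0r addr0.
  by rewrite [LHS]big_nat_recl// !bin0.
rewrite -addrA; congr (_ + _).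
rewrite -sumrB; apply: eq_bigr => i _.
rewrite binS natrD [in RHS]mulrDl rmorphD/= mulrDl; congr (_ + _).
have -> : sh (- i.+1%:Z) f x = sh (- i%:Z) f (x + (-1)%:~R * dx).
  by rewrite /sh -addrA -mulrDl -intrD; congr (f (x + _%:~R * dx)); rewrite intS opprD.
by set z := sh _ _ _; rewrite exprS mulN1r mulrN rmorphN/= mulNr.
Qed.

Variable p : nat.

(** The scheme's operator acting on functions of a real variable: offset p + 1 is the forward one,
    offset p the backward one. *)
Definition Dfun (a : int) f (x : R) : R[i] :=
  \sum_(0 <= k < (2 * p + 1).+1)
    ('C(2 * p + 1, k)%:R * (-1) ^+ k / dx ^+ (2 * p + 1))%:C * sh (a - k%:Z) f x.

Lemma DfunE a f x : Dfun a f x =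
  (dx ^- (2 * p + 1))%:C * sh a (iter (2 * p + 1) bdiff f) x.
Proof.
rewrite /Dfun {2}/sh iter_bdiffE big_distrr/=; apply: eq_bigr => i _.
rewrite mulrA -rmorphM/= [_^-1 * _]mulrC; congr (_ * _).
by rewrite -[RHS]/(sh a (sh _ f) x) shD.
Qed.

Lemma CL2_Dfun a f : CL2 f -> CL2 (Dfun a f).
Proof.
move=> hf; rewrite (funext (DfunE a f)).
by apply: CL2Z; apply: CL2_sh; exact: CL2_iter_bdiff.
Qed.

(** Of the 2p + 1 differences, p are moved to the right factor by parts, which leaves one difference
    between N^p f and a translate of it. *)
Lemma ip_Dfun a f : CL2 f ->
  ip (Dfun a f) f = dx ^- (2 * p + 1) * (-1) ^+ p *
    ip (bdiff (sh (a - p%:Z) (iter p bdiff f))) (iter p bdiff f).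
Proof.
move=> hf; rewrite (funext (DfunE a f)) ipZl//; last first.
  by apply: CL2_sh; exact: CL2_iter_bdiff.
rewrite -mulrA; congr (_ * _).
rewrite sh_iter_bdiff mul2n -addnn -addnA iterD.
rewrite ip_iter_bdiff//; last by apply: CL2_iter_bdiff; exact: CL2_sh.
congr (_ * ip _ _).
by rewrite sh_iter_bdiff shD addn1 -sh_iter_bdiff sh_bdiff addrC.
Qed.

(** Only p differences are estimated by the factor 4; the p + 1 that are kept are those of the
    dissipation in [ip_Dfun_upwind], whence 4^p = 2^(2p) in the CFL condition. *)
Lemma nsq_Dfun_le a f : CL2 f ->
  nsq (Dfun a f) <= (dx ^- (2 * p + 1)) ^+ 2 * (4 ^+ p * nsq (iter p.+1 bdiff f)).
Proof.
move=> hf; have h k := CL2_iter_bdiff k hf.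
rewrite (nsq_eq (DfunE a f)) nsqM; last exact: CL2_sh.
rewrite sqn_real nsq_sh// ler_wpM2l ?sqr_ge0// mul2n -addnn -addnA iterD addn1.
by apply: nsq_iter_bdiff.
Qed.

Lemma nsq_Dfun_le' a f : CL2 f ->
  nsq (Dfun a f) <= (dx ^- (2 * p + 1)) ^+ 2 * (4 ^+ (2 * p + 1) * nsq f).
Proof.
move=> hf; have h k := CL2_iter_bdiff k hf.
rewrite (nsq_eq (DfunE a f)) nsqM; last exact: CL2_sh.
by rewrite sqn_real nsq_sh// ler_wpM2l ?sqr_ge0// nsq_iter_bdiff.
Qed.

Definition upwind_offset : int := if odd p then p%:Z + 1 else p%:Z.

(** The parity rule makes up for the sign (-1)^p. With w = N^p f, the odd case leaves - <S w - w, w>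
    and the even case <w - S^-1 w, w>; both equal |w|^2 - <S w, w> = |N w|^2 / 2. *)
Lemma ip_Dfun_upwind f : CL2 f ->
  ip (Dfun upwind_offset f) f = dx ^- (2 * p + 1) * (nsq (iter p.+1 bdiff f) / 2).
Proof.
move=> hf; have h := CL2_iter_bdiff p hf; rewrite ip_Dfun// -mulrA; congr (_ * _).
rewrite /= nsq_bdiff// [RHS]mulrAC divff// mul1r.
rewrite /upwind_offset -signr_odd; case: (odd p) => /=.
  rewrite addrAC subrr add0r expr1 mulN1r ipBl ?shD ?subrr ?sh0; try exact: CL2_sh; try by [].
  by rewrite opprB (ip_sh 1 h h) ipC.
by rewrite subrr sh0 mul1r ipBl//; exact: CL2_sh.
Qed.

Lemma upwind_coercive f : CL2 f ->
  dx ^+ (2 * p + 1) / 2 ^+ (2 * p) * nsq (Dfun upwind_offset f) <=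
  2 * ip (Dfun upwind_offset f) f.
Proof.
move=> hf; rewrite ip_Dfun_upwind//.
have := nsq_Dfun_le upwind_offset hf; have := nsq_ge0 (iter p.+1 bdiff f).
set a := nsq (iter _ _ _); set b := nsq (Dfun _ _); set d := dx ^+ _.
have d0 : 0 < d by rewrite exprn_gt0.
have -> : (4 : R) ^+ p = 2 ^+ (2 * p) by rewrite exprM expr2 -natrM.
set t := 2 ^+ (2 * p); have t0 : 0 < t by rewrite exprn_gt0.
move=> a0 bl.
have -> : 2 * (d^-1 * (a / 2)) = d / t * (d^-1 ^+ 2 * (t * a)).
  by field; rewrite !gt_eqF.
by rewrite ler_wpM2l// divr_ge0 ?ltW.
Qed.

Definition cfun f (x : R) : R[i] := (2^-1)%:C * (Dfun (p%:Z + 1) f x + Dfun p%:Z f x).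

Lemma CL2_cfun f : CL2 f -> CL2 (cfun f).
Proof. by move=> hf; apply: CL2Z; apply: CL2D; exact: CL2_Dfun. Qed.

(** With w = N^p f, the forward and backward terms add up to a multiple of <S w - S^-1 w, w>, and S
    - S^-1 is skew-symmetric. *)
Lemma ip_cfun f : CL2 f -> ip (cfun f) f = 0.
Proof.
move=> hf; rewrite ipZl//; last by apply: CL2D; exact: CL2_Dfun.
rewrite ipDl//; try exact: CL2_Dfun.
have e : p%:Z + 1 - p%:Z = 1 by rewrite addrAC subrr add0r.
rewrite !ip_Dfun// -mulrDr e subrr sh0.
have h := CL2_iter_bdiff p hf.
rewrite !ipBl ?shD ?subrr ?sh0; try exact: CL2_sh; try by [].
by rewrite (ip_sh 1 h h) [ip _ (sh _ _)]ipC; set a := ip _ _; set b := ip _ _; rewrite addrA subrK subrr !mulr0.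
Qed.

(** With no dissipation to compare with, all 2p + 1 differences are estimated by the factor 4; the
    CFL condition has to absorb the whole of dx^-(4p+2). *)
Lemma nsq_cfun_le f : CL2 f ->
  nsq (cfun f) <= (dx ^- (2 * p + 1)) ^+ 2 * (4 ^+ (2 * p + 1) * nsq f).
Proof.
move=> hf; set K := _ * _; have K0 : 0 <= K.
  by rewrite mulr_ge0 ?sqr_ge0// mulr_ge0 ?nsq_ge0// exprn_ge0.
have h a : nrm (Dfun a f) <= Num.sqrt K by rewrite ler_wsqrtr// nsq_Dfun_le'.
suff : nrm (cfun f) <= Num.sqrt K by rewrite ler_sqrt.
rewrite nrmZ; last by apply: CL2D; exact: CL2_Dfun.
have := nrmD (CL2_Dfun (p%:Z + 1) hf) (CL2_Dfun p%:Z hf).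
have := h p%:Z; have := h (p%:Z + 1).
rewrite ger0_norm; last by rewrite invr_ge0.
by move=> h1 h2 h3; lra.
Qed.

End Differences.

(** * Difference operators on step functions and cell averages *)

Section Operators.
Variable R : realType.
Variables (dx : R) (p : nat).
Hypothesis dx_gt0 : 0 < dx.
Implicit Types (v : int -> R[i]) (f g : R -> R[i]).

Definition Dseq (a : int) v (j : int) : R[i] :=
  \sum_(0 <= k < (2 * p + 1).+1)
    ('C(2 * p + 1, k)%:R * (-1) ^+ k / dx ^+ (2 * p + 1))%:C * v (j + (a - k%:Z)).

Lemma D_forwardE v : D_forward p dx v = Dseq (p%:Z + 1) v.
Proof.
apply/funext => j; apply: eq_bigr => k _; congr (_ * v _).
ring.
Qed.

Lemma D_backwardE v : D_backward p dx v = Dseq p%:Z v.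
Proof. by apply/funext => j; apply: eq_bigr => k _; rewrite addrC. Qed.

Definition Dcentral v (j : int) : R[i] := (2^-1)%:C * (Dseq (p%:Z + 1) v j + Dseq p%:Z v j).

Lemma D_centralE v : D_central p dx v = Dcentral v.
Proof. by apply/funext => j; rewrite /D_central D_forwardE D_backwardE. Qed.

Lemma D_upwindE : D_upwind p dx = Dseq (upwind_offset p).
Proof.
apply/funext => v; rewrite /D_upwind /upwind_offset.
by case: (odd p); [exact: D_forwardE|exact: D_backwardE].
Qed.

Lemma Dfun_st a v x : Dfun dx p a (st dx v) x = st dx (Dseq a v) x.
Proof. by apply: eq_bigr => k _; rewrite /sh /st cidx_shift. Qed.

Lemma cfun_st v x : cfun dx p (st dx v) x = st dx (Dcentral v) x.
Proof. by rewrite /cfun !Dfun_st. Qed.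

Lemma DfunB a f g x : Dfun dx p a (fun y => f y - g y) x = Dfun dx p a f x - Dfun dx p a g x.
Proof. by rewrite /Dfun -sumrB; apply: eq_bigr => k _; rewrite -mulrBr. Qed.

Lemma cfunB f g x : cfun dx p (fun y => f y - g y) x = cfun dx p f x - cfun dx p g x.
Proof. by rewrite /cfun !DfunB -mulrBr addrACA -opprD. Qed.

Lemma cell_average_sum (I : Type) (s : seq I) (F : I -> R -> R[i]) j : (forall i, CL2 (F i)) ->
  CL2 (fun x => \sum_(i <- s) F i x) /\
  cell_average dx (fun x => \sum_(i <- s) F i x) j = \sum_(i <- s) cell_average dx (F i) j.
Proof.
move=> hF; elim: s => [|i s [IH1 IH2]].
  have E : (fun x : R => \sum_(i <- [::]) F i x) = (fun x => 0 * 0 : R[i]).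
    by apply/funext => x; rewrite big_nil mulr0.
  rewrite E cell_averageZ ?mul0r ?big_nil//; last exact: CL2_0.
  by split=> //; exact: CL2_0.
have -> : (fun x : R => \sum_(i0 <- i :: s) F i0 x) = (fun x => F i x + \sum_(i <- s) F i x).
  by apply/funext => x; rewrite big_cons.
by rewrite cell_averageD// big_cons IH2; split=> //; exact: CL2D.
Qed.

Lemma cell_average_Dfun a f j : CL2 f ->
  cell_average dx (Dfun dx p a f) j = Dseq a (cell_average dx f) j.
Proof.
move=> hf; rewrite /Dfun.
have h k : CL2 (sh dx (a - k%:Z) f) by exact: CL2_sh.
have [_ ->] := @cell_average_sum _ (index_iota 0 (2 * p + 1).+1)
  (fun k x => ('C(2 * p + 1, k)%:R * (-1) ^+ k / dx ^+ (2 * p + 1))%:C * sh dx (a - k%:Z) f x) j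
  (fun k => CL2Z _ (h k)).
by apply: eq_bigr => k _; rewrite cell_averageZ// cell_average_shift.
Qed.

Lemma cell_average_cfun f j : CL2 f ->
  cell_average dx (cfun dx p f) j = Dcentral (cell_average dx f) j.
Proof.
move=> hf; have h a := CL2_Dfun dx p a hf.
by rewrite /cfun cell_averageZ ?cell_averageD ?cell_average_Dfun//; exact: CL2D.
Qed.

End Operators.

(** * Symbols and consistency *)

Section Symbol.
Variable R : realType.
Implicit Types (x y s : R) (z : R[i]).

Local Notation normc := (@Normc.normc R).

Lemma sin_norm_case (P : R -> R -> Prop) : (forall x y, P x y -> P (- x) (- y)) ->
  (forall x, 0 <= x -> P x (sin x)) -> forall x, P x (sin x).
Proof.
move=> PN P0 x; case: (lerP 0 x) => x0; first exact: P0.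
by rewrite -[x]opprK sinN; apply: PN; apply: P0; rewrite oppr_ge0 ltW.
Qed.

Lemma norm_sin_le x : `|sin x| <= `|x|.
Proof.
apply: (@sin_norm_case (fun x y => `|y| <= `|x|)) => [{}x y|{}x x0]; first by rewrite !normrN.
have h1 := sin_le_id x0; have h2 := sin_ge_sqr x0.
rewrite (ger0_norm x0) ler_norml h1 andbT.
(* It remains to see that sin x >= -x: up to 4 because x - x^2/2 >= -x there, beyond because sin x
   >= -1. *)
case: (lerP x 4) => hx.
  have : x * x <= 4 * x by rewrite ler_wpM2r.
  by rewrite -expr2; lra.
by apply: le_trans (sin_geN1 x); lra.
Qed.

Lemma norm_sin_sub_sqr x : `|sin x - x| <= x ^+ 2 / 2.
Proof.
apply: (@sin_norm_case (fun x y => `|y - x| <= x ^+ 2 / 2)) => [{}x y|{}x x0].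
  by rewrite -opprD normrN sqrrN.
have h1 := sin_le_id x0; have h2 := sin_ge_sqr x0.
rewrite ler0_norm; lra.
Qed.

Lemma norm_sin_sub_cube x : `|sin x - x| <= `|x| ^+ 3 / 6.
Proof.
apply: (@sin_norm_case (fun x y => `|y - x| <= `|x| ^+ 3 / 6)) => [{}x y|{}x x0].
  by rewrite -opprD !normrN.
have h1 := sin_le_id x0; have h2 := sin_ge_cube x0.
rewrite (ger0_norm x0) ler0_norm; lra.
Qed.

Lemma norm_cos_sub1_sqr x : `|cos x - 1| <= x ^+ 2 / 2.
Proof.
have h1 := cos_ge_sqr (normr_ge0 x); have h2 := cos_le1 `|x|.
rewrite cosN_norm -[x ^+ 2]real_normK ?num_real// [ `|cos _ - 1|]ler0_norm; lra.
Qed.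

Lemma norm_cos_sub1_le x : `|cos x - 1| <= `|x|.
Proof.
have h1 := cos_ge_id (normr_ge0 x); have h2 := cos_le1 `|x|.
rewrite cosN_norm [ `|cos _ - 1|]ler0_norm; lra.
Qed.

Lemma norm_cos_sub_cube x : `|cos x - 1 + x ^+ 2 / 2| <= `|x| ^+ 3 / 6.
Proof.
have h1 := cos_ge_sqr (normr_ge0 x); have h2 := cos_le_cube (normr_ge0 x).
rewrite cosN_norm -[x ^+ 2]real_normK ?num_real// [ `|_ - _ + _|]ger0_norm; lra.
Qed.

Lemma normcE_sqn z : normc z = Num.sqrt (sqn z). Proof. by case: z. Qed.

Lemma normc_ge0 z : 0 <= normc z. Proof. by rewrite normcE_sqn sqrtr_ge0. Qed.

Lemma normc_le_ReIm z : normc z <= `|complex.Re z| + `|complex.Im z|.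
Proof.
rewrite -(@ler_pXn2r _ 2) ?nnegrE ?normc_ge0 ?addr_ge0// normc_sqr /sqn sqrrD.
rewrite !real_normK ?num_real// addrAC lerDl.
by rewrite mulrn_wge0 ?mulr_ge0.
Qed.

Lemma normcD_le z1 z2 : normc (z1 + z2) <= normc z1 + normc z2.
Proof. exact: le_normcD. Qed.

Lemma normc_cis y : normc (cis y) = 1. Proof. by rewrite normcE_sqn sqn_cis sqrtr1. Qed.

Lemma normc_real y : normc y%:C = `|y|.
Proof. by rewrite normcE_sqn sqn_real sqrtr_sqr. Qed.

Lemma normc_i : normc 'i%C = 1.
Proof. by rewrite normcE_sqn /sqn /= expr0n add0r expr1n sqrtr1. Qed.

(* [cis (- s) * (1 + i theta s)] is expanded with the second order Taylor
   formula in its first term and the first order one in its second term, so that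
   the remainder stays cubic even for large [s]. *)
Lemma theta_consistency (theta s : R) : 0 <= theta <= 1 ->
  normc (cis (- s) * (1 + 'i%C * (theta * s)%:C) - 1 + 'i%C * ((1 - theta) * s)%:C) <=
  `|2^-1 - theta| * s ^+ 2 + 2 * `|s| ^+ 3.
Proof.
move=> /andP[t0 t1]; apply: le_trans (normc_le_ReIm _) _.
have -> : complex.Re (cis (- s) * (1 + 'i%C * (theta * s)%:C) - 1 + 'i%C * ((1 - theta) * s)%:C)
  = (theta - 2^-1) * s ^+ 2 + (cos s - 1 + s ^+ 2 / 2) + theta * (s * (sin s - s)).
  by rewrite !(Re_add, Re_opp, Re_mul, Im_add, Im_mul) /= cosN sinN; field.
have -> : complex.Im (cis (- s) * (1 + 'i%C * (theta * s)%:C) - 1 + 'i%C * ((1 - theta) * s)%:C)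
  = - (sin s - s) + theta * (s * (cos s - 1)).
  by rewrite !(Im_add, Im_opp, Re_mul, Im_mul, Re_add) /= cosN sinN; ring.
have a1 := norm_cos_sub_cube s; have a2 := norm_sin_sub_cube s.
have a3 : `|theta * (s * (sin s - s))| <= `|s| ^+ 3 / 2.
  rewrite normrM (ger0_norm t0) -[X in _ <= X]mul1r ler_pM// normrM exprS -mulrA.
  by rewrite ler_wpM2l// real_normK ?num_real// norm_sin_sub_sqr.
have a4 : `|theta * (s * (cos s - 1))| <= `|s| ^+ 3 / 2.
  rewrite normrM (ger0_norm t0) -[X in _ <= X]mul1r ler_pM// normrM exprS -mulrA.
  by rewrite ler_wpM2l// real_normK ?num_real// norm_cos_sub1_sqr.
have a5 : `|(theta - 2^-1) * s ^+ 2| = `|2^-1 - theta| * s ^+ 2.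
  by rewrite normrM distrC (ger0_norm (sqr_ge0 s)).
have a6 : 0 <= `|s| ^+ 3 by rewrite exprn_ge0.
apply: le_trans (lerD (ler_normD _ _) (ler_normD _ _)) _.
apply: le_trans (lerD (lerD (ler_normD _ _) (lexx _)) (lexx _)) _.
rewrite normrN a5.
move: a1 a2 a3 a4 a6; set b1 := `|_|; set b2 := `|_|; set b3 := `|_|; set b4 := `|_|.
set c := `|s| ^+ 3; set e := `|_| * _; lra.
Qed.

(** Telescoping: q^(n+1) - x^(n+1) is q - x times n + 1 products of n factors q or x. *)
Lemma norm_exprB_le n (q x : R) : `|q| <= `|x| ->
  `|q ^+ n.+1 - x ^+ n.+1| <= n.+1%:R * (`|x| ^+ n * `|q - x|).
Proof.
move=> qx; elim: n => [|n IH]; first by rewrite !expr1 !mul1r.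
have -> : q ^+ n.+2 - x ^+ n.+2 = q * (q ^+ n.+1 - x ^+ n.+1) + x ^+ n.+1 * (q - x).
  by rewrite !mulrBr -!exprS -exprSr mulrC addrA subrK.
apply: le_trans (ler_normD _ _) _.
rewrite -[n.+2]addn1 natrD mulrDl mul1r; apply: lerD; last by rewrite normrM normrX.
rewrite normrM; apply: le_trans (ler_pM _ _ qx IH) _ => //.
by rewrite mulrCA [`|x| * (_ * _)]mulrA -exprS.
Qed.

Lemma cis_exp y n : cis y ^+ n = cis (n%:R * y).
Proof.
elim: n => [|n IH]; first by rewrite mul0r cis0.
by rewrite exprS IH -cisD -[n.+1]add1n natrD mulrDl mul1r.
Qed.

Lemma i_exp_odd p : 'i%C ^+ (2 * p + 1) = ((-1) ^+ p)%:C * 'i%C :> R[i].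
Proof. by rewrite exprD exprM sqr_i expr1 rmorphXn/= rmorphN1. Qed.

Variables (dx : R) (p : nat).
Hypothesis dx_gt0 : 0 < dx.

(** The Fourier symbol as the eigenvalue on e^(i x xi), read off at x = 0, so that [DfunE] gives its
    factored form. *)
Definition dsym (a : int) (xi : R) : R[i] := Dfun dx p a (fun x => cis (x * xi)) 0.

Definition csym (xi : R) : R[i] := (2^-1)%:C * (dsym (p%:Z + 1) xi + dsym p%:Z xi).

Lemma fpair_Dfun a f g : fpair f g -> fpair (Dfun dx p a f) (fun xi => dsym a xi * g xi).
Proof.
move=> h.
pose G k xi := ('C(2 * p + 1, k)%:R * (-1) ^+ k / dx ^+ (2 * p + 1))%:C *
   (cis ((a - k%:Z)%:~R * dx * xi) * g xi).
apply: (@fpair_eq _ _ _ (fun xi => \sum_(0 <= k < (2 * p + 1).+1) G k xi) _ _ _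
  (fpair_sum _ (fun k => fpairZ _ (fpair_shift _ h)))); first by [].
move=> xi; rewrite /dsym /Dfun big_distrl/=; apply: eq_bigr => k _.
by rewrite /G mulrA /sh add0r.
Qed.

Lemma fpair_cfun f g : fpair f g -> fpair (cfun dx p f) (fun xi => csym xi * g xi).
Proof.
move=> h; apply: fpair_eq (fpairZ _ (fpairD (fpair_Dfun (p%:Z + 1) h) (fpair_Dfun p%:Z h))).
  by [].
by move=> xi; rewrite /csym -mulrA mulrDl.
Qed.

(** The frequency as seen by the grid: up to a phase, i times it is the symbol of N / dx. *)
Definition sinc_freq (xi : R) : R := 2 * sin (xi * dx / 2) / dx.

Lemma iter_bdiff_cis n xi x :
  iter n (bdiff dx) (fun x => cis (x * xi)) x = (1 - cis (- (xi * dx))) ^+ n * cis (x * xi).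
Proof.
elim: n x => [|n IH] x; first by rewrite mul1r.
rewrite /= /bdiff /sh !IH exprS.
have -> : cis ((x + (-1)%:~R * dx) * xi) = cis (- (xi * dx)) * cis (x * xi).
  by rewrite -cisD; congr (cis _); ring.
by ring.
Qed.

Lemma one_sub_cis y : 1 - cis (- y) = (2 * sin (y / 2))%:C * 'i%C * cis (- (y / 2)).
Proof.
have -> : cis (- y) = cis (- (y / 2)) * cis (- (y / 2)).
  by rewrite -cisD -opprD -splitr.
have -> : 1 = cis (y / 2) * cis (- (y / 2)) by rewrite -cisD subrr cis0.
rewrite -mulrBl; congr (_ * _); rewrite cisN.
by apply: complex_eq => /=; rewrite /= ?(Re_add,Im_add,Re_opp,Im_opp,Re_mul,Im_mul) /=; ring.
Qed.

(** The phase measures how far the stencil is off centre. The coefficient a - (2p + 1)/2 is 1/2 for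
    the forward and -1/2 for the backward operator, and averaging the two phases gives the cosine of
    [csymE]. *)
Lemma dsymE a xi : dsym a xi =
  'i%C * (((-1) ^+ p)%:C * ((sinc_freq xi ^+ (2 * p + 1))%:C *
     cis ((a%:~R - (2 * p + 1)%:R / 2) * (xi * dx)))).
Proof.
rewrite /dsym DfunE /sh iter_bdiff_cis one_sub_cis !exprMn i_exp_odd cis_exp add0r.
have -> : (a%:~R - (2 * p + 1)%:R / 2) * (xi * dx) =
  (2 * p + 1)%:R * - (xi * dx / 2) + a%:~R * dx * xi by ring.
rewrite cisD exprVn -rmorphXn/= exprMn !rmorphM/=.
set A := (_ ^- _)%:C; set B := (2 ^+ _)%:C; set C := cis _; set D := cis _; set E := (sin _ ^+ _)%:C.
by ring.
Qed.

Lemma csymE xi : csym xi =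
  'i%C * (((-1) ^+ p)%:C * (sinc_freq xi ^+ (2 * p + 1) * cos (xi * dx / 2))%:C).
Proof.
rewrite /csym !dsymE -!mulrDr mulrCA; congr (_ * _); rewrite mulrCA; congr (_ * _).
rewrite mulrCA rmorphM/=; congr (_ * _).
have -> : ((p%:Z + 1)%:~R - (2 * p + 1)%:R / 2) * (xi * dx) = xi * dx / 2.
  by rewrite natrD natrM intrD/=; field.
have -> : ((p%:Z)%:~R - (2 * p + 1)%:R / 2) * (xi * dx) = - (xi * dx / 2).
  by rewrite natrD natrM; field.
rewrite cisN; apply: complex_eq; rewrite ?(Re_mul, Im_mul, Re_add, Im_add) /=; field => //.
Qed.

Lemma sinc_freq_le xi : `|sinc_freq xi| <= `|xi|.
Proof.
rewrite /sinc_freq normrM normfV (gtr0_norm dx_gt0) ler_pdivrMr// normrM.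
have := norm_sin_le (xi * dx / 2).
have n2 : `|2 : R| = 2 by rewrite gtr0_norm.
rewrite normrM [X in _ <= X * _]normrM (gtr0_norm dx_gt0) normfV n2.
by set u := `|sin _|; set w := `|xi| * dx; lra.
Qed.

Lemma sinc_freqB xi : sinc_freq xi - xi = 2 / dx * (sin (xi * dx / 2) - xi * dx / 2).
Proof. by rewrite /sinc_freq; field; rewrite gt_eqF. Qed.

(** The quadratic remainder of sine is enough at first order; [sinc_freqB_le2] takes the cubic one
    for the central scheme. Both hold for all frequencies, also those beyond 1 / dx. *)
Lemma sinc_freqB_le1 xi : `|sinc_freq xi - xi| <= dx * `|xi| ^+ 2.
Proof.
rewrite sinc_freqB normrM (gtr0_norm (divr_gt0 (ltr0n _ 2) dx_gt0)) real_normK ?num_real//.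
have := norm_sin_sub_sqr (xi * dx / 2).
set u := `|_ - _| => hu.
have h : 2 / dx * u <= 2 / dx * ((xi * dx / 2) ^+ 2 / 2).
  by rewrite ler_wpM2l// divr_ge0// ltW.
apply: le_trans h _.
have -> : 2 / dx * ((xi * dx / 2) ^+ 2 / 2) = dx * xi ^+ 2 / 4 by field; rewrite gt_eqF.
have : 0 <= dx * xi ^+ 2 by rewrite mulr_ge0 ?sqr_ge0// ltW.
by set w := dx * _; lra.
Qed.

Lemma sinc_freqB_le2 xi : `|sinc_freq xi - xi| <= dx ^+ 2 * `|xi| ^+ 3.
Proof.
rewrite sinc_freqB normrM (gtr0_norm (divr_gt0 (ltr0n _ 2) dx_gt0)).
have := norm_sin_sub_cube (xi * dx / 2).
rewrite normrM [X in _ <= (X * _) ^+ 3 / _ -> _]normrM (gtr0_norm dx_gt0) normfV [ `|2| ]gtr0_norm//.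
set u := `|_ - _| => hu; set w := `|xi| in hu *.
have h : 2 / dx * u <= 2 / dx * ((w * dx / 2) ^+ 3 / 6).
  by rewrite ler_wpM2l// divr_ge0// ltW.
apply: le_trans h _.
have -> : 2 / dx * ((w * dx / 2) ^+ 3 / 6) = dx ^+ 2 * w ^+ 3 / 24 by field; rewrite gt_eqF.
have : 0 <= dx ^+ 2 * w ^+ 3 by rewrite mulr_ge0 ?exprn_ge0 ?normr_ge0// ltW.
by set t := dx ^+ 2 * _; lra.
Qed.

(** The dispersion relation: (i xi)^(2p+1) = i omega(xi). *)
Definition omega (xi : R) : R := (-1) ^+ p * xi ^+ (2 * p + 1).

Lemma normc_sub_omega z xi :
  normc ('i%C * (((-1) ^+ p)%:C * z) - 'i%C * (omega xi)%:C) = normc (z - (xi ^+ (2 * p + 1))%:C).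
Proof.
have -> : (omega xi)%:C = ((-1) ^+ p)%:C * (xi ^+ (2 * p + 1))%:C by rewrite /omega rmorphM.
rewrite -mulrBr -mulrBr.
by rewrite !Normc.normcM normc_i normc_real normrX normrN1 expr1n !mul1r.
Qed.

(** The off-centre phase [b], with |b| <= |xi| dx, contributes 1 through cos b - 1 and 1 through sin
    b; replacing the frequency by [sinc_freq] contributes 2p + 1. This adds up to 2p + 3. *)
Lemma upwind_consistency xi :
  normc (dsym (upwind_offset p) xi - 'i%C * (omega xi)%:C) <=
  (2 * p + 3)%:R * (dx * `|xi| ^+ (2 * p + 2)).
Proof.
rewrite dsymE normc_sub_omega.
set b := _ * (xi * dx); set q := sinc_freq xi.
have hb : `|b| <= `|xi| * dx.
  rewrite /b normrM [ `|xi * dx|]normrM (gtr0_norm dx_gt0) ler_piMl//.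
    by rewrite mulr_ge0// ltW.
  rewrite /upwind_offset natrD natrM; case: (odd p) => /=.
    have -> : (p%:Z + 1)%:~R - (2 * p%:R + 1) / 2 = 2^-1 :> R by rewrite intrD/=; field.
    by rewrite ger0_norm//; lra.
  have -> : p%:~R - (2 * p%:R + 1) / 2 = - 2^-1 :> R by rewrite /=; field.
  by rewrite normrN ger0_norm//; lra.
have qx := sinc_freq_le xi; rewrite -/q in qx.
apply: le_trans (normc_le_ReIm _) _.
rewrite Re_add Im_add Re_opp Im_opp Re_realM Im_realM /= oppr0 addr0.
have n1 : `|q ^+ (2 * p + 1)| <= `|xi| ^+ (2 * p + 1).
  by rewrite normrX; apply: lerXn2r; rewrite ?nnegrE.
have h1 : `|q ^+ (2 * p + 1) * sin b| <= dx * `|xi| ^+ (2 * p + 2).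
  rewrite normrM; apply: le_trans (ler_pM _ _ n1 (le_trans (norm_sin_le b) hb)) _ => //.
  by rewrite mulrA -exprSr mulrC [(2 * p + 2)%N]addnS.
have h2 : `|q ^+ (2 * p + 1) * (cos b - 1)| <= dx * `|xi| ^+ (2 * p + 2).
  rewrite normrM; apply: le_trans (ler_pM _ _ n1 (le_trans (norm_cos_sub1_le b) hb)) _ => //.
  by rewrite mulrA -exprSr mulrC [(2 * p + 2)%N]addnS.
have h3 : `|q ^+ (2 * p + 1) - xi ^+ (2 * p + 1)| <= (2 * p + 1)%:R * (dx * `|xi| ^+ (2 * p + 2)).
  rewrite addn1; apply: le_trans (norm_exprB_le _ qx) _; rewrite ler_wpM2l//.
  apply: le_trans (ler_wpM2l _ (sinc_freqB_le1 xi)) _; first exact: exprn_ge0.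
  by rewrite mulrCA -exprD.
have -> : q ^+ (2 * p + 1) * cos b - xi ^+ (2 * p + 1) =
  q ^+ (2 * p + 1) * (cos b - 1) + (q ^+ (2 * p + 1) - xi ^+ (2 * p + 1)).
  by rewrite mulrBr mulr1 addrA subrK.
apply: le_trans (lerD (ler_normD _ _) (lexx _)) _.
apply: le_trans (lerD (lerD h2 h3) h1) _.
rewrite [X in _ <= X * _](_ : _ = 1 + (2 * p + 1)%:R + 1); first by rewrite !mulrDl !mul1r.
by rewrite !natrD; ring.
Qed.

(** The symbol is purely imaginary and its phase enters only through cos b - 1, which is quadratic;
    this is the gain of one order. The constant is 1 for the cosine plus 2p + 1 for the
    frequency. *)
Lemma central_consistency xi :
  normc (csym xi - 'i%C * (omega xi)%:C) <=
  (2 * p + 2)%:R * (dx ^+ 2 * `|xi| ^+ (2 * p + 3)).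
Proof.
set b := xi * dx / 2; set q := sinc_freq xi.
rewrite csymE normc_sub_omega -/q -/b.
have -> : (q ^+ (2 * p + 1) * cos b)%:C - (xi ^+ (2 * p + 1))%:C =
  (q ^+ (2 * p + 1) * cos b - xi ^+ (2 * p + 1))%:C by rewrite rmorphB.
rewrite normc_real.
have qx := sinc_freq_le xi; rewrite -/q in qx.
have n1 : `|q ^+ (2 * p + 1)| <= `|xi| ^+ (2 * p + 1).
  by rewrite normrX; apply: lerXn2r; rewrite ?nnegrE.
have hb : `|cos b - 1| <= dx ^+ 2 * `|xi| ^+ 2.
  apply: le_trans (norm_cos_sub1_sqr b) _; rewrite real_normK ?num_real// /b.
  have -> : (xi * dx / 2) ^+ 2 / 2 = dx ^+ 2 * xi ^+ 2 / 8 by field.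
  have : 0 <= dx ^+ 2 * xi ^+ 2 by rewrite mulr_ge0 ?sqr_ge0.
  by set w := dx ^+ 2 * _; lra.
have h2 : `|q ^+ (2 * p + 1) * (cos b - 1)| <= dx ^+ 2 * `|xi| ^+ (2 * p + 3).
  rewrite normrM; apply: le_trans (ler_pM _ _ n1 hb) _ => //.
  by rewrite mulrCA -exprD -addnA.
have h3 : `|q ^+ (2 * p + 1) - xi ^+ (2 * p + 1)| <=
    (2 * p + 1)%:R * (dx ^+ 2 * `|xi| ^+ (2 * p + 3)).
  rewrite addn1; apply: le_trans (norm_exprB_le _ qx) _; rewrite ler_wpM2l//.
  apply: le_trans (ler_wpM2l _ (sinc_freqB_le2 xi)) _; first exact: exprn_ge0.
  by rewrite mulrCA -exprD.
have -> : q ^+ (2 * p + 1) * cos b - xi ^+ (2 * p + 1) =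
  q ^+ (2 * p + 1) * (cos b - 1) + (q ^+ (2 * p + 1) - xi ^+ (2 * p + 1)).
  by rewrite mulrBr mulr1 addrA subrK.
apply: le_trans (ler_normD _ _) _; apply: le_trans (lerD h2 h3) _.
rewrite [X in _ <= X * _](_ : _ = 1 + (2 * p + 1)%:R); first by rewrite mulrDl mul1r.
by rewrite !natrD; ring.
Qed.

Lemma cexp_omega t xi :
  cexp (- (t%:C * ('i%C * xi%:C) ^+ (2 * p + 1))) = cis (- (t * omega xi)).
Proof.
rewrite exprMn i_exp_odd -rmorphXn/=.
have -> : t%:C * (((-1) ^+ p)%:C * 'i%C * (xi ^+ (2 * p + 1))%:C) = 'i%C * (t * omega xi)%:C.
  by rewrite /omega !rmorphM/=; ring.
by rewrite cexp_imag cisN.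
Qed.

End Symbol.

(** * Stability and convergence *)

Section Stability.
Variable R : realType.
(** [L] is the difference operator on functions and [D] the same operator on sequences. The
    hypotheses collect what the one-sided and the central scheme share, with [c] measuring the
    failure of contraction. *)
Variables (dx dt theta c : R) (L : (R -> R[i]) -> R -> R[i]) (D : (int -> R[i]) -> int -> R[i]).
Hypothesis dx_gt0 : 0 < dx.
Hypothesis dt_gt0 : 0 < dt.
Hypothesis theta01 : 0 <= theta <= 1.
Hypothesis c_ge0 : 0 <= c.
Hypothesis LCL2 : forall f, CL2 f -> CL2 (L f).
Hypothesis LB : forall f g x, L (fun y => f y - g y) x = L f x - L g x.
Hypothesis Lst : forall v x, L (st dx v) x = st dx (D v) x.
Hypothesis Lavg : forall f j, CL2 f -> cell_average dx (L f) j = D (cell_average dx f) j.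
Hypothesis L_ge0 : forall f, CL2 f -> 0 <= ip (L f) f.
Hypothesis L_bounded : exists2 K : R, 0 <= K & forall f, CL2 f -> nsq (L f) <= K * nsq f.
Hypothesis L_cfl : forall f, CL2 f ->
  (1 - 2 * theta) * dt * nsq (L f) <= 2 * ip (L f) f + c * nsq f.

Definition implicit_step f (x : R) : R[i] := f x + (theta * dt)%:C * L f x.
Definition explicit_step f (x : R) : R[i] := f x - ((1 - theta) * dt)%:C * L f x.

Lemma CL2_implicit f : CL2 f -> CL2 (implicit_step f).
Proof. by move=> hf; apply: CL2D => //; apply: CL2Z; exact: LCL2. Qed.

Lemma CL2_explicit f : CL2 f -> CL2 (explicit_step f).
Proof. by move=> hf; apply: CL2B => //; apply: CL2Z; exact: LCL2. Qed.

Lemma nsq_implicit f : CL2 f ->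
  nsq (implicit_step f) = nsq f + 2 * (theta * dt) * ip (L f) f + (theta * dt) ^+ 2 * nsq (L f).
Proof. by move=> hf; rewrite (nsq_expand _ hf (LCL2 hf)) (ipC f); ring. Qed.

Lemma nsq_explicit f : CL2 f -> nsq (explicit_step f) =
  nsq f - 2 * ((1 - theta) * dt) * ip (L f) f + ((1 - theta) * dt) ^+ 2 * nsq (L f).
Proof.
move=> hf; rewrite (nsq_eq (g := fun x => f x + (- ((1 - theta) * dt))%:C * L f x)).
  by rewrite (nsq_expand _ hf (LCL2 hf)) (ipC f); ring.
by move=> x; rewrite /explicit_step rmorphN mulNr.
Qed.

Lemma nrm_implicit f : CL2 f -> nrm f <= nrm (implicit_step f).
Proof.
move=> hf; apply: ler_wsqrtr; rewrite nsq_implicit//.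
case/andP: theta01 => t0 t1.
have h1 : 0 <= 2 * (theta * dt) * ip (L f) f.
  by rewrite !mulr_ge0 ?L_ge0// ltW.
have h2 : 0 <= (theta * dt) ^+ 2 * nsq (L f) by rewrite mulr_ge0 ?sqr_ge0 ?nsq_ge0.
lra.
Qed.

Lemma nsq_explicit_le f : CL2 f ->
  nsq (explicit_step f) <= (1 + c * dt) * nsq (implicit_step f).
Proof.
move=> hf; have h0 : nsq f <= nsq (implicit_step f).
  by rewrite -!nrm_sqr ler_sqr ?nnegrE ?nrm_ge0// nrm_implicit.
have h1 : c * dt * nsq f <= c * dt * nsq (implicit_step f).
  by rewrite ler_wpM2l// mulr_ge0// ltW.
have h2 := L_cfl hf; rewrite -(ler_pM2l dt_gt0) in h2.
rewrite mulrDl mul1r; apply: le_trans (lerD (lexx _) h1).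
rewrite nsq_explicit// nsq_implicit//.
move: h2; set a := nsq f; set b := ip _ _; set d := nsq _ => h2.
rewrite -subr_ge0.
have -> : a + 2 * (theta * dt) * b + (theta * dt) ^+ 2 * d + c * dt * a -
  (a - 2 * ((1 - theta) * dt) * b + ((1 - theta) * dt) ^+ 2 * d) =
  dt * (2 * b + c * a) - dt * ((1 - 2 * theta) * dt * d) by ring.
by rewrite subr_ge0.
Qed.

Lemma nrm_explicit_le f : CL2 f ->
  nrm (explicit_step f) <= (1 + c * dt) * nrm (implicit_step f).
Proof.
move=> hf; have k0 : 0 <= c * dt by rewrite mulr_ge0// ltW.
have k1 : 0 <= 1 + c * dt by rewrite addr_ge0.
rewrite -ler_sqr ?nnegrE ?nrm_ge0 ?mulr_ge0 ?nrm_ge0// exprMn !nrm_sqr.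
apply: le_trans (nsq_explicit_le hf) _; rewrite ler_wpM2r ?nsq_ge0//.
(* 1 + c dt >= 1 is at most its square, so no square root has to be expanded. *)
by rewrite expr2 ler_peMl// lerDl.
Qed.

(** A discrete Gronwall lemma. All source terms are given the largest growth factor instead of
    summing a geometric series, so that [c = 0] needs no separate treatment. *)
Lemma stable_recursion (a : nat -> R) (M : R) N : 0 <= M -> a 0%N <= 0 ->
  (forall n, (n < N)%N -> a n.+1 <= (1 + c * dt) * a n + dt * M) ->
  forall n, (n <= N)%N -> a n <= (1 + c * dt) ^+ n * (n%:R * dt) * M.
Proof.
move=> M0 a0 ha; elim=> [|n IH] nN; first by rewrite mul0r mulr0 mul0r.
have k0 : 0 <= c * dt by rewrite mulr_ge0// ltW.
have k1 : 0 <= 1 + c * dt by rewrite addr_ge0.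
apply: le_trans (ha n nN) _; have {}IH := IH (ltnW nN).
apply: le_trans (lerD (ler_wpM2l k1 IH) (lexx _)) _.
have q1 : 1 <= (1 + c * dt) ^+ n.+1 by rewrite exprn_ege1// lerDl.
rewrite !mulrA -exprS -[n.+1]addn1 natrD mulrDr !mulrDl lerD2l mulr1 addn1.
by rewrite -[X in _ <= X]mulrA ler_peMl// mulr_ge0// ltW.
Qed.

Lemma stability_factor (T : R) n : n%:R * dt <= T ->
  (1 + c * dt) ^+ n * (n%:R * dt) <= expR (c * T) * T.
Proof.
move=> nT; have k0 : 0 <= c * dt by rewrite mulr_ge0// ltW.
have k1 : 0 <= 1 + c * dt by rewrite addr_ge0.
apply: ler_pM => //; first by rewrite exprn_ge0.
  by rewrite mulr_ge0// ltW.
apply: (@le_trans _ _ (expR (c * dt) ^+ n)).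
  by apply: lerXn2r; rewrite ?nnegrE ?expR_ge0// expR_ge1Dx.
by rewrite -expRM_natl ler_expR mulrCA ler_wpM2l.
Qed.

(** The quantity followed in time is the norm of [implicit_step (W n)], the left-hand side of the
    scheme. Averaging commutes with [L] by [Lavg] and contracts norms, so the defect of [U] on the
    line controls the source term on the grid. *)
Lemma scheme_stability (T M : R) (N : nat) (U : nat -> R -> R[i]) (u0 : R -> R[i])
    (v : nat -> int -> R[i]) :
  0 <= M -> N%:R * dt <= T -> CL2 u0 -> (forall n, (n <= N)%N -> CL2 (U n)) ->
  nrm (fun x => U 0%N x - u0 x) = 0 ->
  (forall n, (n <= N)%N -> (l2norm dx (v n) < +oo)%E) ->
  (forall j, v 0%N j = cell_average dx u0 j) ->
  (forall n j, (n < N)%N ->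
     v n.+1 j + (theta * dt)%:C * D (v n.+1) j = v n j - ((1 - theta) * dt)%:C * D (v n) j) ->
  (forall n, (n < N)%N ->
     nrm (fun x => implicit_step (U n.+1) x - explicit_step (U n) x) <= dt * M) ->
  forall n, (n <= N)%N ->
    (l2norm dx (fun j => cell_average dx (U n) j - v n j)%R <= (expR (c * T) * T * M)%:E)%E.
Proof.
move=> M0 NT hu0 hU U0 hv v0 hs hd n nN.
pose W n := st dx (fun j => cell_average dx (U n) j - v n j).
have WE k : W k =1 (fun x => st dx (cell_average dx (U k)) x - st dx (v k) x) by [].
have hW k : (k <= N)%N -> CL2 (W k).
  move=> kN; apply: CL2B; last by apply: CL2_st => //; exact: hv.
  by have [] := nrm_cell_average dx_gt0 (hU _ kN).
rewrite l2norm_st//; last exact: hW.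
rewrite lee_fin -/(W n).
have LW k x : L (W k) x = st dx (D (cell_average dx (U k))) x - st dx (D (v k)) x.
  by rewrite -!Lst -LB.
have rec k : (k < N)%N -> nrm (implicit_step (W k.+1)) <=
    (1 + c * dt) * nrm (implicit_step (W k)) + dt * M.
  move=> kN; have hk := hU _ (ltnW kN); have hk1 := hU _ kN.
  pose E x := implicit_step (U k.+1) x - explicit_step (U k) x.
  have hE : CL2 E by apply: CL2B; [exact: CL2_implicit|exact: CL2_explicit].
  have [hS hSn] := nrm_cell_average dx_gt0 hE.
  rewrite (nrm_eq (g := fun x => explicit_step (W k) x + st dx (cell_average dx E) x)).
    apply: le_trans (nrmD _ hS) _; first by apply: CL2_explicit; exact: hW (ltnW kN).
    apply: lerD; first by apply: nrm_explicit_le; exact: hW (ltnW kN).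
    exact: le_trans hSn (hd _ kN).
  move=> x; rewrite /implicit_step /explicit_step !LW !WE /st.
  set j := cidx dx x.
  have hs' := hs k j kN.
  have EE : cell_average dx E j =
    cell_average dx (U k.+1) j + (theta * dt)%:C * D (cell_average dx (U k.+1)) j -
    (cell_average dx (U k) j - ((1 - theta) * dt)%:C * D (cell_average dx (U k)) j).
    rewrite -!Lavg//.
    have hL := LCL2 hk; have hL1 := LCL2 hk1.
    have -> : E = fun x => (U k.+1 x + (theta * dt)%:C * L (U k.+1) x) +
       ((-1) * U k x + ((1 - theta) * dt)%:C * L (U k) x).
      by apply/funext => y; rewrite /E /implicit_step /explicit_step mulN1r opprB [- _ + _]addrC.
    rewrite !cell_averageD ?cell_averageZ//; try (by apply: CL2Z); try (by apply: CL2D => //; apply: CL2Z).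
    by rewrite mulN1r opprB [- _ + _]addrC.
  rewrite EE.
  move: hs'; set a1 := v k.+1 j; set a2 := D (v k.+1) j; set a3 := v k j; set a4 := D (v k) j.
  set b1 := cell_average _ _ _; set b2 := D _ _; set b3 := cell_average _ _ _; set b4 := D _ _.
  set s := (_ * _)%:C; set t := (_ * _)%:C => h.
  have -> : a1 = a3 - t * a4 - s * a2 by rewrite -h addrK.
  ring.
have init : nrm (implicit_step (W 0)) <= 0.
  have h0 := hW 0%N isT.
  have nW : nrm (W 0%N) = 0.
    apply/eqP; rewrite eq_le nrm_ge0 andbT -U0.
    have [_] := nrm_cell_average dx_gt0 (CL2B (hU 0%N isT) hu0); apply: le_trans.
    rewrite le_eqVlt; apply/orP; left; apply/eqP; apply: nrm_eq => x; rewrite WE /st.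
    rewrite v0; set j := cidx _ _.
    rewrite (_ : (fun y => U 0%N y - u0 y) = (fun y => U 0%N y + (-1) * u0 y)); last first.
      by apply/funext => y; rewrite mulN1r.
    rewrite cell_averageD// ?cell_averageZ ?mulN1r//; [exact: hU|exact: CL2Z].
  (* [W 0] is null in norm only, so boundedness of [L] is what carries this over to [L (W 0)]. *)
  have nL : nrm (L (W 0%N)) = 0.
    have [K K0 /(_ _ h0)] := L_bounded.
    rewrite -[X in _ <= _ * X]nrm_sqr nW expr0n mulr0 -nrm_sqr => h.
    by apply/eqP; rewrite -sqrf_eq0 eq_le h sqr_ge0.
  apply: le_trans (nrmD h0 (CL2Z _ (LCL2 h0))) _.
  by rewrite nW nrmZ ?nL ?mulr0 ?addr0//; exact: LCL2.
apply: le_trans (nrm_implicit (hW _ nN)) _.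
apply: le_trans (stable_recursion (a := fun n => nrm (implicit_step (W n))) M0 init rec nN) _.
rewrite ler_wpM2r// stability_factor//; apply: le_trans NT.
by rewrite ler_pM2r// ler_nat.
Qed.

(** To be used with [h = dx] and [k = 2 * p + 2] for the one-sided scheme, [h = dx ^+ 2] and
    [k = 2 * p + 3] for the central one. *)
Variables (p k : nat) (S : R -> R[i]) (K h : R).
Hypothesis K_ge0 : 0 <= K.
Hypothesis h_ge0 : 0 <= h.
Hypothesis fpair_L : forall f g, fpair f g -> fpair (L f) (fun xi => S xi * g xi).
Hypothesis S_consistent : forall xi : R,
  Normc.normc (S xi - 'i%C * (omega p xi)%:C) <= K * (h * `|xi| ^+ k).

(* The Fourier multiplier taking the initial datum to the consistency defect between
   the times [t] and [t + dt]. *)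
Definition defect_factor (t xi : R) : R[i] :=
  cis (- (t * omega p xi)) * (cis (- (dt * omega p xi)) * (1 + (theta * dt)%:C * S xi) -
    (1 - ((1 - theta) * dt)%:C * S xi)).

Lemma defect_factor_le (t xi : R) : Normc.normc (defect_factor t xi) <=
  dt * ((dt * `|2^-1 - theta|) * `|xi| ^+ (4 * p + 2) + (K * (h * `|xi| ^+ k) +
    2 * (dt ^+ 2 * `|xi| ^+ (6 * p + 3)))).
Proof.
have [t0 t1] := andP theta01.
rewrite /defect_factor Normc.normcM normc_cis mul1r.
set w := omega p xi; set c1 := cis _.
have nw j : `|dt * w| ^+ j = dt ^+ j * `|xi| ^+ ((2 * p + 1) * j).
  by rewrite normrM (gtr0_norm dt_gt0) exprMn /w /omega normrM normrX normrN1 expr1n mul1r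
    normrX exprM.
(* The first part is the error of the theta-method in time for the exact symbol i w. The second is
   the error in space, times a convex combination of two numbers of modulus 1. *)
have -> : c1 * (1 + (theta * dt)%:C * S xi) - (1 - ((1 - theta) * dt)%:C * S xi) =
  (c1 * (1 + 'i%C * (theta * (dt * w))%:C) - 1 + 'i%C * ((1 - theta) * (dt * w))%:C) +
  dt%:C * ((S xi - 'i%C * w%:C) * (theta%:C * c1 + (1 - theta)%:C)).
  rewrite !rmorphM/=; set a := theta%:C; set b := (1 - theta)%:C; set d := dt%:C; set e := w%:C.
  set s := S xi; ring.
apply: le_trans (normcD_le _ _) _.
have h1 := theta_consistency (dt * w) theta01.
have h2 : Normc.normc (theta%:C * c1 + (1 - theta)%:C) <= 1.
  apply: le_trans (normcD_le _ _) _; rewrite Normc.normcM !normc_real normc_cis mulr1.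
  by rewrite !ger0_norm ?subr_ge0// addrC subrK.
have h3 : Normc.normc (dt%:C * ((S xi - 'i%C * w%:C) * (theta%:C * c1 + (1 - theta)%:C))) <=
    dt * (K * (h * `|xi| ^+ k)).
  rewrite !Normc.normcM normc_real (gtr0_norm dt_gt0) ler_pM2l// -[X in _ <= X]mulr1.
  by apply: ler_pM; rewrite ?normc_ge0//; exact: S_consistent.
apply: le_trans (lerD h1 h3) _.
rewrite -[(dt * w) ^+ 2]real_normK ?num_real// !nw.
have -> : ((2 * p + 1) * 2 = 4 * p + 2)%N by rewrite mulnDl mulnAC.
have -> : ((2 * p + 1) * 3 = 6 * p + 3)%N by rewrite mulnDl mulnAC.
rewrite le_eqVlt; apply/orP; left; apply/eqP; ring.
Qed.

(* The factor [a] makes the bound void when [a = 0], i.e. for [theta = 1/2], where the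
   derivative of order [j] need not be given. *)
Definition deriv_bound (fh : R -> R[i]) (a : R) (j : nat) (N : R) :=
  forall M, 0 <= M -> a * nrm (rmul (powcut M j) fh) <= a * N.

(** Multiplier bounds come in powers of |xi| and derivative bounds in powers of xi; absolute values
    link them without changing norms. *)
Lemma CL2_abs_powcut (fh : R -> R[i]) M j : 0 <= M -> CL2 fh ->
  CL2 (rmul (fun xi => `|powcut M j xi|) fh).
Proof.
move=> M0 hf; apply: (CL2_rmul (K := M ^+ j)) => //.
  apply: measurableT_comp => //; exact: measurable_powcut.
by move=> x; rewrite normr_id powcut_le.
Qed.

Lemma nrm_abs_powcut (fh : R -> R[i]) M j : 0 <= M -> CL2 fh ->
  nrm (rmul (fun xi => `|powcut M j xi|) fh) = nrm (rmul (powcut M j) fh).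
Proof.
move=> M0 hf; have h1 := CL2_abs_powcut j M0 hf.
have h2 : CL2 (rmul (powcut M j) fh).
  apply: (CL2_rmul (K := M ^+ j)) => //; first exact: measurable_powcut.
  by move=> x; rewrite powcut_le.
by apply/eqP; rewrite eq_le !nrm_le// => x;
  rewrite /rmul !sqnM !sqn_real real_normK ?num_real.
Qed.

Lemma defect_bound (t : R) (u0h U U' : R -> R[i]) (N1 N2 N3 : R) :
  CL2 u0h -> fpair U (fun xi => cis (- (t * omega p xi)) * u0h xi) ->
  fpair U' (fun xi => cis (- ((t + dt) * omega p xi)) * u0h xi) ->
  deriv_bound u0h (dt * `|2^-1 - theta|) (4 * p + 2) N1 ->
  deriv_bound u0h h k N2 -> deriv_bound u0h (dt ^+ 2) (6 * p + 3) N3 ->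
  nrm (fun x => implicit_step U' x - explicit_step U x) <=
  dt * ((Num.sqrt (@kappa R))^-1 *
    (dt * `|2^-1 - theta| * N1 + (K * (h * N2) + 2 * (dt ^+ 2 * N3)))).
Proof.
move=> hu hU hU' b1 b2 b3.
have sk : 0 < Num.sqrt (@kappa R) by rewrite sqrtr_gt0 kappa_gt0.
have hE : fpair (fun x => implicit_step U' x - explicit_step U x)
    (fun xi => defect_factor t xi * u0h xi).
  apply: fpair_eq (fpairB (fpairD hU' (fpairZ (theta * dt)%:C (fpair_L hU')))
    (fpairB hU (fpairZ ((1 - theta) * dt)%:C (fpair_L hU)))) => // xi.
  rewrite /defect_factor mulrDl opprD cisD.
  set a := (theta * dt)%:C; set b := (_ * dt)%:C; set c1 := cis _; set c2 := cis _.
  set s := S xi; set z := u0h xi; ring.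
have [_ hm _] := hE.
rewrite mulrCA mulrC ler_pdivlMr// mulrC -(fpair_norm hE).
(* On [-n, n] the bound of [defect_factor_le] compares the defect pointwise with a sum of three
   truncated powers, each of them square integrable. *)
apply: nrm_le_ccut => // n; set M := n%:R.
have M0 : 0 <= M by exact: ler0n.
pose P j := rmul (fun xi => `|powcut M j xi|) u0h.
have hP j : CL2 (P j) by exact: CL2_abs_powcut.
pose a1 := dt * (dt * `|2^-1 - theta|); pose a2 := dt * (K * h); pose a3 := dt * (2 * dt ^+ 2).
have A1 : 0 <= a1 by rewrite !mulr_ge0// ltW.
have A2 : 0 <= a2 by rewrite !mulr_ge0// ltW.
have A3 : 0 <= a3 by rewrite !mulr_ge0// ?exprn_ge0// ltW.
pose Q x := a1%:C * P (4 * p + 2)%N x + (a2%:C * P k x + a3%:C * P (6 * p + 3)%N x).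
have hQ : CL2 Q by apply: CL2D; [|apply: CL2D]; apply: CL2Z.
apply: (@le_trans _ _ (nrm Q)).
  apply: nrm_le => // [|x]; first exact: CL2_ccut.
  have := defect_factor_le t x; rewrite /ccut /Q /P /rmul; move: (defect_factor t x) => m dl.
  rewrite /powcut !normrM !normrX indic_itv.
  case: (boolP (_ <= _ <= _)) => _; last first.
    by rewrite mul0r /sqn /= expr0n addr0 addr_ge0 ?sqr_ge0.
  rewrite mul1r normr1 !mul1r !mulrA -!mulrDl -!rmorphM/= -!rmorphD/= !sqnM sqn_real.
  rewrite ler_wpM2r ?sqn_ge0// -normc_sqr; apply: lerXn2r; rewrite ?nnegrE ?normc_ge0//.
    by rewrite !addr_ge0// mulr_ge0// exprn_ge0.
  apply: le_trans dl _.
  rewrite /a1 /a2 /a3 le_eqVlt; apply/orP; left; apply/eqP; ring.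
apply: le_trans (nrmD (CL2Z _ (hP _)) (CL2D (CL2Z _ (hP _)) (CL2Z _ (hP _)))) _.
apply: le_trans (lerD (lexx _) (nrmD (CL2Z _ (hP _)) (CL2Z _ (hP _)))) _.
rewrite !nrmZ// (ger0_norm A1) (ger0_norm A2) (ger0_norm A3) /P !nrm_abs_powcut//.
have := b1 M M0; have := b2 M M0; have := b3 M M0.
set B1 := _ * nrm _ => i1; set B2 := _ * nrm _ => i2; set B3 := _ * nrm _ => i3.
have -> : a1 * nrm (rmul (powcut M (4 * p + 2)) u0h) +
  (a2 * nrm (rmul (powcut M k) u0h) + a3 * nrm (rmul (powcut M (6 * p + 3)) u0h)) =
  dt * (B3 + (K * B2 + 2 * B1)) by rewrite /a1 /a2 /a3 /B1 /B2 /B3; ring.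
rewrite ler_pM2l// !lerD// ler_wpM2l//.
Qed.

Lemma L2norm_deriv_ge0 j (f : R -> R[i]) : (0 <= L2norm_deriv j f)%E.
Proof.
by apply: le_ereal_inf_tmp => _ [g [/is_L2P hg _] <-]; rewrite L2norm_nrm// lee_fin nrm_ge0.
Qed.

(** Either the term is infinite and the error estimate void, or it is a real number. A finite
    infimum over weak derivatives inherits the bound that holds for each of them. *)
Lemma deriv_boundP (Cw a : R) j (f fh : R -> R[i]) : 0 < Cw ->
  (forall g M, 0 <= M -> CL2 g -> weak_derivative j f g ->
     nrm (rmul (powcut M j) fh) <= Cw * nrm g) -> 0 <= a ->
  (a%:E * L2norm_deriv j f)%E = +oo%E \/
  exists N : R, (a%:E * L2norm_deriv j f = (a * N)%:E)%E /\ deriv_bound fh a j (Cw * N).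
Proof.
move=> C0 hC; rewrite le_eqVlt => /predU1P[<-|a0].
  (* For [a = 0] the term is 0 even if the norm is infinite, so any real number serves as [N]. *)
  by right; exists 0; rewrite mul0e mul0r; split=> // M M0; rewrite !mul0r.
have := L2norm_deriv_ge0 j f; case E : (L2norm_deriv j f) => [r| |]// _; last first.
  by left; rewrite gt0_muley// lte_fin.
right; exists r; split=> // M M0; rewrite ler_pM2l// mulrC -ler_pdivrMr// -lee_fin -E.
apply: le_ereal_inf_tmp => _ [g [/is_L2P hg wg] <-].
by rewrite L2norm_nrm// lee_fin ler_pdivrMr// mulrC hC.
Qed.

Lemma ge0_sum3_pinfty (x y z : \bar R) : (0 <= x)%E -> (0 <= y)%E -> (0 <= z)%E ->
  [|| x == +oo, y == +oo | z == +oo]%E -> (x + y + z = +oo)%E.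
Proof. by case: x => //= x; case: y => //= y; case: z. Qed.

Lemma scheme_error (Cw T : R) (u0 : R -> R[i]) (u : R -> R -> R[i]) (v : nat -> int -> R[i]) :
  0 < Cw -> (forall k f g fh M, 0 <= M -> fpair f fh -> CL2 g -> weak_derivative k f g ->
    nrm (rmul (powcut M k) fh) <= Cw * nrm g) -> 0 < T ->
  exact_solution p T u0 u -> theta_scheme D T theta dx dt u0 v ->
  (linf_l2norm (nsteps T dt) dx (conv_error dx dt u v) <=
   (expR (c * T) * T * ((Num.sqrt (@kappa R))^-1 * Cw * (K + 2)))%:E *
   ((dt * `|2^-1 - theta|)%:E * L2norm_deriv (4 * p + 2) u0
    + h%:E * L2norm_deriv k u0 + (dt ^+ 2)%:E * L2norm_deriv (6 * p + 3) u0))%E.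
Proof.
move=> Cw0 hCw T0 [u0h /is_fourier_fpair fu0 fu] [v1 v2 v3].
have [hu0 hu0h _] := fu0.
have sk : 0 < Num.sqrt (@kappa R) by rewrite sqrtr_gt0 kappa_gt0.
set Cst := expR _ * _ * _.
have Cst0 : 0 < Cst.
  by rewrite !mulr_gt0 ?expR_gt0 ?invr_gt0// ltr_wpDl.
set a1 := dt * _; set a3 := dt ^+ 2.
have A1 : 0 <= a1 by rewrite mulr_ge0// ltW.
have A3 : 0 <= a3 by rewrite exprn_ge0// ltW.
have E1 := mule_ge0 (etrans (lee_fin 0 a1) A1) (L2norm_deriv_ge0 (4 * p + 2) u0).
have E2 := mule_ge0 (etrans (lee_fin 0 h) h_ge0) (L2norm_deriv_ge0 k u0).
have E3 := mule_ge0 (etrans (lee_fin 0 a3) A3) (L2norm_deriv_ge0 (6 * p + 3) u0).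
have W j : forall g M, 0 <= M -> CL2 g -> weak_derivative j u0 g ->
     nrm (rmul (powcut M j) u0h) <= Cw * nrm g by move=> g M M0; exact: hCw.
have [e1|[N1 [e1 b1]]] := deriv_boundP Cw0 (W (4 * p + 2)%N) A1.
  rewrite ge0_sum3_pinfty//; last by rewrite e1 eqxx.
  by rewrite gt0_muley ?leey// lte_fin.
have [e2|[N2 [e2 b2]]] := deriv_boundP Cw0 (W k) h_ge0.
  rewrite ge0_sum3_pinfty//; last by rewrite e2 eqxx orbT.
  by rewrite gt0_muley ?leey// lte_fin.
have [e3|[N3 [e3 b3]]] := deriv_boundP Cw0 (W (6 * p + 3)%N) A3.
  rewrite ge0_sum3_pinfty//; last by rewrite e3 eqxx !orbT.
  by rewrite gt0_muley ?leey// lte_fin.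
have i1 : 0 <= a1 * N1 by rewrite -lee_fin -e1.
have i2 : 0 <= h * N2 by rewrite -lee_fin -e2.
have i3 : 0 <= a3 * N3 by rewrite -lee_fin -e3.
rewrite e1 e2 e3 -!EFinD -EFinM.
pose M := (Num.sqrt (@kappa R))^-1 *
  (a1 * (Cw * N1) + (K * (h * (Cw * N2)) + 2 * (a3 * (Cw * N3)))).
have ME : M = (Num.sqrt (@kappa R))^-1 * Cw * (a1 * N1 + (K * (h * N2) + 2 * (a3 * N3))).
  by rewrite /M; ring.
have M0 : 0 <= M.
  rewrite ME !mulr_ge0 ?invr_ge0 ?(ltW sk) ?(ltW Cw0)// addr_ge0//.
  by rewrite addr_ge0// mulr_ge0.
have NT : (nsteps T dt)%:R * dt <= T.
  by rewrite -ler_pdivlMr// /nsteps truncn_le// ltW// divr_gt0.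
have tn n : (n <= nsteps T dt)%N -> 0 <= n%:R * dt <= T.
  move=> nN; apply/andP; split; first by rewrite mulr_ge0// ltW.
  apply: le_trans NT.
  by rewrite ler_pM2r// ler_nat.
have fU n : (n <= nsteps T dt)%N ->
    fpair (u (n%:R * dt)) (fun xi => cis (- (n%:R * dt * omega p xi)) * u0h xi).
  move=> /tn /fu /is_fourier_fpair; apply: fpair_eq => // xi.
  by rewrite cexp_omega.
have hU n : (n <= nsteps T dt)%N -> CL2 (u (n%:R * dt)) by move=> /fU [].
(* Both functions have the transform [u0h], so they agree almost everywhere, which for the norm is
   enough. *)
have U0 : nrm (fun x => u (0%:R * dt) x - u0 x) = 0.
  have := fpair_norm (fpairB (fU 0%N isT) fu0).
  rewrite (nrm_eq (g := fun=> 0 * 0)) => [|x]; last by rewrite mul0r mul0r oppr0 cis0 mul1r subrr mulr0.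
  rewrite nrmZc; last exact: CL2_0.
  rewrite [sqn 0](_ : _ = 0); last by rewrite /sqn /= expr0n addr0.
  rewrite sqrtr0 mul0r => /esym/eqP; rewrite mulf_eq0 gt_eqF//= => /eqP //.
apply: ge_ereal_sup => _ [n /= nN <-].
apply: le_trans (scheme_stability (U := fun n => u (n%:R * dt)) M0 NT hu0 hU U0 v1 v2 v3 _ nN) _.
  move=> m mN; apply: (defect_bound hu0h (fU m (ltnW mN)) _ b1 b2 b3).
  by have := fU _ mN; rewrite -[m.+1]addn1 natrD mulrDl mul1r.
(* K + 2 dominates the three coefficients 1, K and 2. *)
have key : a1 * N1 + (K * (h * N2) + 2 * (a3 * N3)) <= (K + 2) * (a1 * N1 + h * N2 + a3 * N3).
  have j1 : 0 <= K * (a1 * N1) by rewrite mulr_ge0.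
  have j3 : 0 <= K * (a3 * N3) by rewrite mulr_ge0.
  rewrite !mulrDr !mulrDl.
  move: i1 i2 i3 j1 j3; set x1 := a1 * N1; set x2 := h * N2; set x3 := a3 * N3.
  set y1 := K * x1; set y3 := K * x3; set y2 := K * x2; lra.
rewrite lee_fin ME /Cst -[X in _ <= X]mulrA -[X in _ <= _ * X]mulrA.
rewrite ler_wpM2l ?mulr_ge0 ?expR_ge0 ?(ltW T0)// ler_wpM2l//.
by rewrite mulr_ge0 ?invr_ge0 ?(ltW sk) ?(ltW Cw0).
Qed.

End Stability.

Theorem theorem1 (R : realType) (p : nat) (T theta : R) (T_gt0 : 0 < T)
    (theta01 : 0 <= theta <= 1) :
  (exists2 C : R, 0 < C &
    forall (u0 : R -> R[i]) (u : R -> R -> R[i]) (dx dt : R)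
        (v : nat -> int -> R[i]),
      in_sobolev (4 * p + 2) u0 ->
      (theta = 2^-1 -> in_sobolev (6 * p + 3) u0) ->
      exact_solution p T u0 u ->
      0 < dx -> 0 < dt ->
      theta_scheme (D_upwind p dx) T theta dx dt u0 v ->
      dt * (1 - 2 * theta) <= dx ^+ (2 * p + 1) / 2 ^+ (2 * p) ->
      (linf_l2norm (nsteps T dt) dx (conv_error dx dt u v) <=
       C%:E * ((dt * `|2^-1 - theta|)%:E * L2norm_deriv (4 * p + 2) u0
               + dx%:E * L2norm_deriv (2 * p + 2) u0
               + (dt ^+ 2)%:E * L2norm_deriv (6 * p + 3) u0))%E)
  /\
  (forall C0 : R, 0 < C0 ->
    exists2 C : R, 0 < C &
    forall (u0 : R -> R[i]) (u : R -> R -> R[i]) (dx dt : R)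
        (v : nat -> int -> R[i]),
      in_sobolev (4 * p + 2) u0 ->
      (theta = 2^-1 -> in_sobolev (6 * p + 3) u0) ->
      exact_solution p T u0 u ->
      0 < dx -> 0 < dt ->
      theta_scheme (D_central p dx) T theta dx dt u0 v ->
      dt * (1 - 2 * theta) <= 2 * C0 * (dx ^+ (4 * p + 2) / 2 ^+ (4 * p)) ->
      (linf_l2norm (nsteps T dt) dx (conv_error dx dt u v) <=
       C%:E * ((dt * `|2^-1 - theta|)%:E * L2norm_deriv (4 * p + 2) u0
               + (dx ^+ 2)%:E * L2norm_deriv (2 * p + 3) u0
               + (dt ^+ 2)%:E * L2norm_deriv (6 * p + 3) u0))%E).
Proof.
have [Cw Cw0 hCw] := weak_derivative_bound R.
have sk : 0 < Num.sqrt (@kappa R) by rewrite sqrtr_gt0 kappa_gt0.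
split.
  (* The constant of [scheme_error] with [c = 0] and the [K] of [upwind_consistency]. *)
  exists (expR (0 * T) * T * ((Num.sqrt (@kappa R))^-1 * Cw * ((2 * p + 3)%:R + 2))).
    by rewrite !mulr_gt0 ?expR_gt0 ?invr_gt0// ltr_wpDl.
  move=> u0 u dx dt v _ _ hu dx0 dt0 hv cfl; rewrite D_upwindE in hv.
  apply: (scheme_error (L := Dfun dx p (upwind_offset p)) (S := dsym dx p (upwind_offset p))
    dx0 dt0 theta01 (lexx 0) _ _ _ _ _ _ _ _ _ _ _ Cw0 hCw T_gt0 hu hv).
  - by move=> f; exact: CL2_Dfun.
  - by move=> f g x; exact: DfunB.
  - by move=> w x; exact: Dfun_st.
  - by move=> f j hf; exact: cell_average_Dfun.
  - move=> f hf; rewrite ip_Dfun_upwind// mulr_ge0 ?invr_ge0 ?exprn_ge0 ?(ltW dx0)//.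
    by rewrite divr_ge0 ?nsq_ge0.
  - exists ((dx ^- (2 * p + 1)) ^+ 2 * 4 ^+ (2 * p + 1)).
      by rewrite mulr_ge0 ?sqr_ge0 ?exprn_ge0.
    by move=> f hf; rewrite -mulrA nsq_Dfun_le'.
  - move=> f hf; rewrite mul0r addr0; apply: le_trans (upwind_coercive dx0 p hf).
    by rewrite ler_wpM2r ?nsq_ge0// mulrC.
  - by [].
  - exact: ltW.
  - by move=> f g; exact: fpair_Dfun.
  - by move=> xi; exact: upwind_consistency.
move=> C0 C00.
(* The constant of [scheme_error] with [c = 8 * C0] and the [K] of [central_consistency]. *)
exists (expR (8 * C0 * T) * T * ((Num.sqrt (@kappa R))^-1 * Cw * ((2 * p + 2)%:R + 2))).
  by rewrite !mulr_gt0 ?expR_gt0 ?invr_gt0// ltr_wpDl.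
move=> u0 u dx dt v _ _ hu dx0 dt0 hv cfl.
rewrite (funext (D_centralE dx p)) in hv.
have c0 : 0 <= 8 * C0 by rewrite mulr_ge0// ltW.
apply: (scheme_error (L := cfun dx p) (S := csym dx p)
  dx0 dt0 theta01 c0 _ _ _ _ _ _ _ _ _ _ _ Cw0 hCw T_gt0 hu hv).
- by move=> f; exact: CL2_cfun.
- by move=> f g x; exact: cfunB.
- by move=> w x; exact: cfun_st.
- by move=> f j hf; exact: cell_average_cfun.
- by move=> f hf; rewrite ip_cfun.
- exists ((dx ^- (2 * p + 1)) ^+ 2 * 4 ^+ (2 * p + 1)).
    by rewrite mulr_ge0 ?sqr_ge0 ?exprn_ge0.
  by move=> f hf; rewrite -mulrA nsq_cfun_le.
- move=> f hf; rewrite ip_cfun// mulr0 add0r.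
  have h0 : 0 <= 8 * C0 * nsq f by rewrite mulr_ge0 ?nsq_ge0.
  (* For theta >= 1/2 the left-hand side is nonpositive. Otherwise its factor is positive and the
     upper bound on |L f|^2 may be multiplied by it. *)
  case: (lerP ((1 - 2 * theta) * dt) 0) => th.
    by apply: le_trans h0; rewrite mulr_le0_ge0// nsq_ge0.
  have := ler_wpM2l (ltW th) (nsq_cfun_le dx p hf); move=> /le_trans; apply.
  rewrite mulrC in cfl; apply: le_trans (ler_wpM2r _ cfl) _.
    by rewrite mulr_ge0 ?sqr_ge0// mulr_ge0 ?nsq_ge0// exprn_ge0.
  rewrite le_eqVlt; apply/orP; left; apply/eqP.
  (* The powers of 2 and of [dx] cancel against the CFL bound, leaving 2 C_0 times 4, the 8 C_0 of
     the growth rate. *)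
  have -> : (4 : R) ^+ (2 * p + 1) = 4 * 2 ^+ (4 * p).
    have -> : (4 * p = 2 * (2 * p))%N by rewrite mulnA.
    have e4 : (2 : R) ^+ 2 = 4 by rewrite expr2 -natrM.
    by rewrite [X in _ = _ * X]exprM e4 exprD expr1 mulrC.
  have -> : dx ^+ (4 * p + 2) = (dx ^+ (2 * p + 1)) ^+ 2 by rewrite -exprM mulnDl mulnAC.
  by field; rewrite !expf_neq0 ?gt_eqF.
- by [].
- by rewrite exprn_ge0// ltW.
- by move=> f g; exact: fpair_cfun.
- by move=> xi; exact: central_consistency.
Qed.
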